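(* The union of all Haar null conjugacy classes of $\mathrm{Aut}(\mathbb{Q},<)$ is Haar null.
   Context: $\mathrm{Aut}(\mathbb{Q},<)$ is the group of order-preserving bijections of $\mathbb{Q}$ with the topology of pointwise convergence (a Polish group). For a Polish group $G$, a Borel set $B\subseteq G$ is Haar null if there is a Borel probability measure $\mu$ on $G$ with $\mu(gBh)=0$ for all $g,h\in G$; an arbitrary set is Haar null if it is contained in a Borel Haar null set. *)

(* Defs.v *)
From HB Require Import structures.
From mathcomp Require Import all_boot all_order all_algebra.
From mathcomp Require Import all_classical all_reals all_analysis.

Set Implicit Arguments.
Unset Strict Implicit.
Unset Printing Implicit Defensive.

Import Order.TTheory GRing.Theory Num.Theory.
Local Open Scope classical_set_scope.

(* [Pointed] is only there because [g_sigma_algebraType] asks for it. *)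
HB.mixin Record isTopologicalGroup G of PointedTopological G & Group G := {
  mulg_continuous : continuous (fun x : G * G => (x.1 * x.2)%g) ;
  invg_continuous : continuous (fun x : G => x^-1%g)
}.

#[short(type="topGroupType")]
HB.structure Definition TopologicalGroup :=
  {G of PointedTopological G & Group G & isTopologicalGroup G}.

Definition borelType (G : topGroupType) := g_sigma_algebraType (@open G).

Definition borel_set (G : topGroupType) (B : set G) : Prop :=
  (@open G).-sigma.-measurable B.

Definition borel_haar_null (R : realType) (G : topGroupType) (B : set G) :
    Prop :=
  borel_set B /\
  exists mu : probability (borelType G) R,
    forall g h : G, mu [set (g * x * h)%g | x in B] = 0%E.

Definition haar_null (R : realType) (G : topGroupType) (A : set G) : Prop :=
  exists2 B : set G, borel_haar_null R B & A `<=` B.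

Definition conjugacy_class (G : groupType) (x : G) : set G :=
  [set (x ^ h)%g | h in [set: G]].

Record autQ := AutQ {
  autQ_fun :> rat -> rat ;
  autQ_homo : {homo autQ_fun : x y / (x < y)%R} ;
  autQ_bij : bijective autQ_fun
}.

Lemma autQ_eq (f g : autQ) : f =1 g -> f = g.
Proof.
case: f g => [f fh fb] [g gh gb] /= /funext fg.
by case: _ / fg in gh gb *; congr AutQ; exact: Prop_irrelevance.
Qed.

HB.instance Definition _ := gen_eqMixin autQ.
HB.instance Definition _ := gen_choiceMixin autQ.

Definition autQ_one : autQ :=
  @AutQ id (fun _ _ => id)
    (Bijective (fun=> erefl) (fun=> erefl)).

Definition autQ_mul (f g : autQ) : autQ :=
  @AutQ (f \o g) (fun _ _ h => autQ_homo f (autQ_homo g h))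
    (bij_comp (autQ_bij f) (autQ_bij g)).

Lemma autQ_inv_subproof (f : autQ) :
  exists g : autQ, cancel f g /\ cancel g f.
Proof.
have [g fK gK] := autQ_bij f.
have gh : {homo g : x y / (x < y)%R}.
  move=> x y; rewrite -{1}(gK x) -{1}(gK y) => fxy.
  case: (ltgtP (g x) (g y)) fxy => // [|->]; last by rewrite ltxx.
  by move=> /(autQ_homo f) yx /(lt_trans yx); rewrite ltxx.
by exists (@AutQ g gh (Bijective gK fK)).
Qed.

Definition autQ_inv (f : autQ) : autQ := projT1 (cid (autQ_inv_subproof f)).

Lemma autQK (f : autQ) : cancel f (autQ_inv f).
Proof. by rewrite /autQ_inv; case: cid => g []. Qed.

Lemma autQVK (f : autQ) : cancel (autQ_inv f) f.
Proof. by rewrite /autQ_inv; case: cid => g []. Qed.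

Lemma autQ_mulA : associative autQ_mul.
Proof. by move=> f g h; exact: autQ_eq. Qed.

Lemma autQ_mul1 : left_id autQ_one autQ_mul.
Proof. by move=> f; exact: autQ_eq. Qed.

Lemma autQ_mulr1 : right_id autQ_one autQ_mul.
Proof. by move=> f; exact: autQ_eq. Qed.

Lemma autQ_mulV : left_inverse autQ_one autQ_inv autQ_mul.
Proof. by move=> f; apply: autQ_eq; exact: autQK. Qed.

Lemma autQ_mulrV : right_inverse autQ_one autQ_inv autQ_mul.
Proof. by move=> f; apply: autQ_eq; exact: autQVK. Qed.

HB.instance Definition _ := @isGroup.Build autQ autQ_one autQ_inv autQ_mul
  autQ_mulA autQ_mul1 autQ_mulr1 autQ_mulV autQ_mulrV.

HB.instance Definition _ := isPointed.Build autQ 1%g.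

(* Pointwise convergence is meant with [rat] discrete, i.e. [autQ] is a closed
   subgroup of the permutation group of [rat]; using the order topology of
   [rat] instead would give a strictly coarser topology. *)
Definition autQ_ptws (f : autQ) : {ptws rat -> discrete_topology rat} := f.

HB.instance Definition _ := Topological.copy autQ (initial_topology autQ_ptws).

Lemma autQ_nbhs_eval (f : autQ) (t : rat) :
  nbhs f [set g : autQ | g t = f t].
Proof.
have cf : continuous autQ_ptws by exact: initial_continuous.
have ct := @proj_continuous rat (fun=> discrete_topology rat) t (autQ_ptws f).
exact: (cf f _ (ct _ (discrete_set1 (f t : discrete_topology rat)))).
Qed.

Lemma autQ_continuous (T : topologicalType) (F : T -> autQ) :
  (forall x t, \forall y \near x, F y t = F x t) -> continuous F.
Proof.
move=> Fev.
apply: (@continuous_comp_initial _ _ _ autQ_ptws) => x.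
apply/cvg_sup => t A /= [_ [[B oB <-] /= Bx] /filterS]; apply.
by apply: filterS (Fev x t) => y /= Fy; rewrite /autQ_ptws Fy.
Qed.

Lemma autQ_mul_continuous :
  continuous (fun x : autQ * autQ => (x.1 * x.2)%g).
Proof.
apply: autQ_continuous => -[f g] t /=.
exists ([set f' : autQ | f' (g t) = f (g t)], [set g' : autQ | g' t = g t]).
  by split; exact: autQ_nbhs_eval.
by move=> [f' g'] [/= ff gg]; rewrite /= gg.
Qed.

Lemma autQ_inv_continuous : continuous (fun x : autQ => x^-1%g).
Proof.
apply: autQ_continuous => f t /=.
apply: filterS (autQ_nbhs_eval f (f^-1%g t)) => g.
by rewrite /= (autQVK f t) => gt; rewrite -[in LHS]gt; exact: (autQK g).
Qed.

HB.instance Definition _ :=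
  isTopologicalGroup.Build autQ autQ_mul_continuous autQ_inv_continuous.

(* Main.v *)
(** Write [f > id] on a rational interval without [f] carrying its left end
    beyond its right end as "[f] touches the identity".  The classes that are
    not Haar null are those of the [f] with finitely many fixed points such that
    neither [f] nor [f^-1] touches the identity.

    The remaining [f] form a Haar null set, witnessed by the law of
    [phi_a * psi_b] for independent uniform [a] and [b].  Here [psi_b] is built
    by back-and-forth with random choices: its coincidences with a given
    automorphism have summable probabilities, so almost surely there are finitely
    many.  Coding [rat] by the nonempty integer sequences in lexicographic order,
    [phi_a] shifts the [n]-th entry by [floor (2 ^ n * a)]; for given [u], [w]
    and a given interval, at most one [a] makes [u * phi_a * w] touch the
    identity there, since two of them would preserve a common cut not realised
    by a rational.

    Conversely let [f] be as above and [mu] a Borel probability measure.  By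
    tightness there is [K] with [mu K > 0] on which all [h x] and [h^-1 x] take
    finitely many values, and [h z] is constant for each fixed point [z] of [f].
    One constructs a single [g] such that [g^-1 * h] is conjugate to [f] for
    every [h] in [K], as a limit of finite chains of points [(x, g x)], each
    labelled for every [h] by an orbital of [f] telling on which side of [g] the
    graph of [h] runs there.  Between consecutive points all [h] that change
    their label do so from the same orbital to the same orbital, so one can
    insert a further point of the domain or of the range, or a further orbital. *)

Require Import Defs.
From HB Require Import structures.
From mathcomp Require Import all_boot all_order all_algebra.
From mathcomp Require Import all_classical all_reals all_analysis.
From mathcomp Require Import ring lra zify.

Set Implicit Arguments.
Unset Strict Implicit.
Unset Printing Implicit Defensive.

Import Order.TTheory GRing.Theory Num.Theory.

(** * Back-and-forth with an oracle *)

(** One [g] must serve uncountably many [h], so a point inserted for the sake of one [h] could spoil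
    the others. Two facts prevent this. Finitely many values over an abscissa leave room between an
    end of a cell and the next value. And a member that keeps its label in a cell avoids the whole
    rectangle, so it is compatible with every node inserted there; in the limit this also puts
    points with equal labels into one orbital of [g^-1 * h]. The absence of touching enters only as
    an alternation property: two orbitals moved in the same direction are separated by a fixed point
    or by an orbital moved in the other one. Labels suffice because the order of the orbitals, with
    their directions, determines the conjugacy class.

    On the null side a single measure has to work for three Borel sets and for all translates. Each
    set is null for one of the two factors when the other one is frozen, even after multiplication
    by fixed automorphisms on both sides. This is why coincidences with an arbitrary automorphism
    are controlled, and not only fixed points. *)

Definition dlo (T : eqType) (lt : rel T) :=
  [/\ irreflexive lt, transitive lt, (forall x y, x != y -> lt x y || lt y x),
      (forall x y, lt x y -> exists z, lt x z /\ lt z y) &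
      forall x, (exists y, lt y x) /\ exists y, lt x y].

Lemma dlo_max (T : eqType) (lt : rel T) (A : seq T) a : dlo lt -> a \in A ->
  exists2 m, m \in A & forall b, b \in A -> b = m \/ lt b m.
Proof.
move=> [irr tr tot _ _]; elim: A a => [//|x A IH] a _.
case: A IH => [_|y A IH].
  by exists x; rewrite ?mem_head // => b; rewrite inE => /eqP->; left.
have [m mA mP] := IH y (mem_head _ _).
have [xm|/tot/orP[xm|mx]] := eqVneq x m.
- exists m; first by rewrite inE mA orbT.
  by move=> b; rewrite inE => /orP[/eqP->|/mP//]; left.
- exists m; first by rewrite inE mA orbT.
  by move=> b; rewrite inE => /orP[/eqP->|/mP//]; right.
- exists x; first exact: mem_head.
  move=> b; rewrite inE => /orP[/eqP->|/mP[->|bm]]; [by left|by right|].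
  by right; apply: tr mx.
Qed.

Lemma dloV (T : eqType) (lt : rel T) : dlo lt -> dlo (fun x y => lt y x).
Proof.
move=> [irr tr tot den unb]; split=> //.
- by move=> y x z xy yz; apply: tr yz xy.
- by move=> x y /tot; rewrite orbC.
- by move=> x y /den[z [h1 h2]]; exists z.
- by move=> x; have [? ?] := unb x.
Qed.

Section Between.
Variables (T : eqType) (lt : rel T) (pt : T).
Hypothesis dloT : dlo lt.

Lemma dlo_between (A B : seq T) :
  (forall a b, a \in A -> b \in B -> lt a b) ->
  exists y, (forall a, a \in A -> lt a y) /\ (forall b, b \in B -> lt y b).
Proof.
case: (dloT) => irr tr tot den unb AB.
case: A AB => [|a A] AB; case: B AB => [|b B] AB.
- by exists pt.
- have [m mB mP] := dlo_max (dloV dloT) (mem_head b B).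
  have [[y ym] _] := unb m; exists y; split=> // c /mP[->//|mc].
  exact: tr mc.
- have [m mA mP] := dlo_max dloT (mem_head a A).
  have [_ [y ym]] := unb m; exists y; split=> // c /mP[->//|mc].
  exact: tr ym.
have [m mA mP] := dlo_max dloT (mem_head a A).
have [n nB nP] := dlo_max (dloV dloT) (mem_head b B).
have [y [my yn]] := den _ _ (AB m n mA nB).
exists y; split=> c; [move=> /mP[->//|cm]|move=> /nP[->//|nc]].
  exact: tr my.
exact: tr nc.
Qed.

(** An increasing sequence is built inside the gap. Its injectivity later ensures that a prescribed
    pair is produced by at most one value of the oracle. *)
Lemma dlo_betweens (A B : seq T) :
  (forall a b, a \in A -> b \in B -> lt a b) ->
  exists v : nat -> T, injective v /\ forall n,
    (forall a, a \in A -> lt a (v n)) /\ (forall b, b \in B -> lt (v n) b).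
Proof.
case: (dloT) => irr tr tot den unb AB.
pose S := {y | (forall a, a \in A -> lt a y) /\ (forall b, b \in B -> lt y b)}.
have nxt (y : S) : {z : S | lt (sval y) (sval z)}.
  apply: cid; case: y => y [h1 h2] /=.
  have [|z [z1 z2]] := @dlo_between (y :: A) B.
    by move=> a b; rewrite inE => /orP[/eqP->|]; [exact: h2|exact: AB].
  have h : (forall a, a \in A -> lt a z) /\ (forall b, b \in B -> lt z b).
    by split=> // a aA; apply: z1; rewrite inE aA orbT.
  by exists (exist _ z h) => /=; apply: z1; rewrite mem_head.
have s0 : S by apply: cid; exact: dlo_between.
pose v n := iter n (fun y => sval (nxt y)) s0.
have vS n : lt (sval (v n)) (sval (v n.+1)) by exact: svalP (nxt (v n)).
have vlt n k : lt (sval (v n)) (sval (v (n + k).+1)).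
  elim: k => [|k IH]; first by rewrite addn0.
  by rewrite addnS; apply: tr IH (vS _).
exists (fun n => sval (v n)); split; last by move=> n; exact: svalP (v n).
move=> m n e; case: (ltngtP m n) => // h; exfalso.
  by have := vlt m (n - m.+1); rewrite -addSn subnKC // e irr.
by have := vlt n (m - n.+1); rewrite -addSn subnKC // -e irr.
Qed.
End Between.

Definition partial_iso (X Y : eqType) (ltX : rel X) (ltY : rel Y)
    (s : seq (X * Y)) :=
  forall p q, p \in s -> q \in s -> ltX p.1 q.1 = ltY p.2 q.2.

Definition flip (X Y : Type) (p : X * Y) : Y * X := (p.2, p.1).

Lemma partial_iso_flip (X Y : eqType) (ltX : rel X) (ltY : rel Y) s :
  partial_iso ltX ltY s -> partial_iso ltY ltX (map (@flip X Y) s).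
Proof.
by move=> H _ _ /mapP[p ps ->] /mapP[q qs ->]; rewrite /= (H p q).
Qed.

Lemma partial_iso_ext (X Y : eqType) (ltX : rel X) (ltY : rel Y) (y0 : Y) s x :
  dlo ltX -> dlo ltY -> partial_iso ltX ltY s ->
  x \notin map fst s ->
  exists v : nat -> Y, injective v /\
    forall n, partial_iso ltX ltY ((x, v n) :: s).
Proof.
move=> [irX trX totX _ _] dY H xs; have [irY trY _ _ _] := dY.
pose A := [seq p.2 | p <- s & ltX p.1 x]; pose B := [seq p.2 | p <- s & ltX x p.1].
have [|v [vi vAB]] := dlo_betweens y0 dY (A := A) (B := B).
  move=> _ _ /mapP[p + ->] /mapP[q + ->]; rewrite !mem_filter.
  by move=> /andP[px ps] /andP[xq qs]; rewrite -H //; apply: trX xq.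
exists v; split=> // n.
have [vA vB] := vAB n.
have key p : p \in s -> ltX p.1 x = ltY p.2 (v n) /\ ltX x p.1 = ltY (v n) p.2.
  move=> ps; have px : p.1 != x.
    by apply: contraNneq xs => <-; apply: map_f.
  have /orP[h|h] := totX _ _ px.
    have h' : ltY p.2 (v n) by apply: vA; apply: map_f; rewrite mem_filter h.
    rewrite h h'; split=> //.
    have -> : ltX x p.1 = false.
      by apply/negP => k; have := trX _ _ _ h k; rewrite irX.
    by apply/esym/negP => k; have := trY _ _ _ h' k; rewrite irY.
  have h' : ltY (v n) p.2 by apply: vB; apply: map_f; rewrite mem_filter h.
  rewrite h h'; split=> //.
  have -> : ltX p.1 x = false.
    by apply/negP => k; have := trX _ _ _ h k; rewrite irX.
  by apply/esym/negP => k; have := trY _ _ _ h' k; rewrite irY.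
move=> p q; rewrite !inE => /orP[/eqP->|ps] /orP[/eqP->|qs] //=.
- by rewrite irX irY.
- by have [] := key q qs.
- by have [] := key p ps.
- exact: H.
Qed.

Section BackAndForth.
Variables (X Y : countType) (ltX : rel X) (ltY : rel Y) (x0 : X) (y0 : Y).
Hypotheses (dloX : dlo ltX) (dloY : dlo ltY).
Local Notation piso := (partial_iso ltX ltY).

(** The hypotheses stand under the existential so that choice yields a total function, with the
    constant [y0] on inputs that do not satisfy them. *)
Lemma forth_values s x : exists v : nat -> Y, piso s -> x \notin map fst s ->
  injective v /\ forall n, piso ((x, v n) :: s).
Proof.
have [[h1 h2]|h] := pselect (piso s /\ x \notin map fst s).
  by have [v H] := partial_iso_ext y0 dloX dloY h1 h2; exists v.
by exists (fun=> y0) => h1 h2; case: h.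
Qed.

Lemma back_values s y : exists v : nat -> X, piso s -> y \notin map snd s ->
  injective v /\ forall n, piso ((v n, y) :: s).
Proof.
have [[h1 h2]|h] := pselect (piso s /\ y \notin map snd s); last first.
  by exists (fun=> x0) => h1 h2; case: h.
have h1' := partial_iso_flip h1.
have [|v [vi H]] := partial_iso_ext x0 dloY dloX h1' (x := y).
  by rewrite -map_comp.
exists v => _ _; split=> // n.
have := partial_iso_flip (H n); rewrite /= -map_comp.
by rewrite (eq_map (g := id)) ?map_id //; case.
Qed.

Definition forth s x := sval (cid (forth_values s x)).

Lemma forthP s x : piso s -> x \notin map fst s ->
  injective (forth s x) /\ forall n, piso ((x, forth s x n) :: s).
Proof. by rewrite /forth; case: cid. Qed.

Definition back s y := sval (cid (back_values s y)).

Lemma backP s y : piso s -> y \notin map snd s ->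
  injective (back s y) /\ forall n, piso ((back s y n, y) :: s).
Proof. by rewrite /back; case: cid. Qed.

(* The pair added at stage [k] to the partial isomorphism [s], the number [c]
   selecting one of infinitely many admissible partners. *)
Definition new_pair (s : seq (X * Y)) (k c : nat) : option (X * Y) :=
  if odd k then
    if unpickle k./2 is Some y then
      if y \in map snd s then None else Some (back s y c, y)
    else None
  else
    if unpickle k./2 is Some x then
      if x \in map fst s then None else Some (x, forth s x c)
    else None.

Fixpoint stage (c : nat -> nat) k : seq (X * Y) :=
  if k is k'.+1 then
    (if new_pair (stage c k') k' (c k') is Some p then [:: p] else [::]) ++
      stage c k'
  else [::].

Lemma new_pair_iso s k c p : piso s -> new_pair s k c = Some p -> piso (p :: s).
Proof.
rewrite /new_pair => ps; case: ifP => _.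
  case: (unpickle _) => // y; case: ifPn => // ys [<-].
  by have [_] := backP ps ys; apply.
case: (unpickle _) => // x; case: ifPn => // xs [<-].
by have [_] := forthP ps xs; apply.
Qed.

Lemma stage_iso c k : piso (stage c k).
Proof.
elim: k => [//|k IH] /=.
by case E : (new_pair _ _ _) => [p|] //; apply: new_pair_iso E.
Qed.

(** This is the source of the probability estimate: the candidates at a stage are pairwise distinct,
    so at most one choice puts the new pair on the graph of [u]. Injectivity of [u] serves the
    stages where the range element is prescribed. *)
Lemma new_pair_inj (u : X -> Y) s k c c' x x' : injective u -> piso s ->
  new_pair s k c = Some (x, u x) -> new_pair s k c' = Some (x', u x') -> c = c'.
Proof.
rewrite /new_pair => ui ps; case: ifP => _.
  case: (unpickle _) => // y; case: ifPn => // ys [e1 e2] [e1' e2'].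
  have [vi _] := backP ps ys; apply: vi; apply: ui.
  by rewrite e1 e1' -e2 -e2'.
case: (unpickle _) => // y; case: ifPn => // ys [e1 e2] [e1' e2'].
have [vi _] := forthP ps ys; apply: vi.
by rewrite e2 e2' -e1 -e1'.
Qed.

Lemma eq_stage c c' k : (forall i, i < k -> c i = c' i) -> stage c k = stage c' k.
Proof.
elim: k => [//|k IH] H /=; rewrite IH ?H // => i ik.
by apply: H; apply: ltnW.
Qed.

Lemma stage_mono c k n : k <= n -> {subset stage c k <= stage c n}.
Proof.
move/subnKC <-; elim: (n - k) => [|m IH] p; first by rewrite addn0.
by move=> /IH ps; rewrite addnS /= mem_cat ps orbT.
Qed.

(** Even stages serve the domain and odd ones the range. The point of code [n] is treated at stage
    [n.*2], hence is present one stage later. *)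
Lemma stage_dom c x : x \in map fst (stage c (pickle x).*2.+1).
Proof.
rewrite /= /new_pair odd_double doubleK pickleK.
by case: ifPn => //= _; rewrite mem_head.
Qed.

Lemma stage_ran c y : y \in map snd (stage c (pickle y).*2.+2).
Proof.
rewrite [stage _ _]/= /new_pair /= odd_double /= uphalf_double pickleK.
by case: ifPn => //= _; rewrite mem_head.
Qed.

Lemma stage_new c k p : p \in stage c k ->
  exists2 n, n < k & new_pair (stage c n) n (c n) = Some p.
Proof.
elim: k => [//|k IH] /=; rewrite mem_cat => /orP[|/IH[n nk E]]; last first.
  by exists n => //; apply: ltnW.
by case E : (new_pair _ _ _) => [q|] //; rewrite inE => /eqP->; exists k.
Qed.

Definition limit_graph c x y := exists k, (x, y) \in stage c k.

Lemma limit_graph_order c x y x' y' : limit_graph c x y -> limit_graph c x' y' ->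
  ltX x x' = ltY y y'.
Proof.
move=> [k h] [k' h']; apply: (@stage_iso c (maxn k k') (x, y) (x', y')).
  by apply: stage_mono h; rewrite leq_maxl.
by apply: stage_mono h'; rewrite leq_maxr.
Qed.

(** The explicit stage shows that the value at [x] depends on finitely many choices, which makes
    evaluation at [x] measurable. *)
Lemma limit_graph_dom c x : exists2 y, limit_graph c x y &
  (x, y) \in stage c (pickle x).*2.+1.
Proof.
have /mapP[[x' y] p /= e] := stage_dom c x; rewrite -e in p.
by exists y => //; exists (pickle x).*2.+1.
Qed.

Lemma limit_graph_ran c y : exists x, limit_graph c x y.
Proof.
have /mapP[[x y'] p /= e] := stage_ran c y; rewrite -e in p.
by exists x, (pickle y).*2.+2.
Qed.

End BackAndForth.

Local Open Scope order_scope.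

(** * Cells *)

Section DenseOrder.
Context {d : Order.disp_t} {E : orderType d}.
Hypothesis dense : forall x y : E, x < y -> exists z, x < z < y.

(** Here finiteness is turned into room: close enough to [c], none of the finitely many points of
    [s] beyond [c] has been passed. *)
Lemma just_above (s : seq E) (c u : E) : c < u ->
  exists y, [/\ c < y, y < u & forall v, v \in s -> c < v -> y < v].
Proof.
elim: s u => [|v s IH] u cu.
  by have [z /andP[cz zu]] := dense cu; exists z.
case: (ltP c v) => cv; last first.
  have [y [cy yu ys]] := IH u cu; exists y; split=> // w.
  by rewrite inE => /orP[/eqP->|/ys//]; rewrite ltNge cv.
have [|y [cy yu ys]] := IH (Order.min u v); first by rewrite lt_min cu.
move: yu; rewrite lt_min => /andP[yu yv]; exists y; split=> // w.
by rewrite inE => /orP[/eqP->|/ys].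
Qed.

Lemma just_below (s : seq E) (c u : E) : u < c ->
  exists y, [/\ y < c, u < y & forall v, v \in s -> v < c -> v < y].
Proof.
elim: s u => [|v s IH] u cu.
  by have [z /andP[cz zu]] := dense cu; exists z.
case: (ltP v c) => cv; last first.
  have [y [cy yu ys]] := IH u cu; exists y; split=> // w.
  by rewrite inE => /orP[/eqP->|/ys//]; rewrite ltNge cv.
have [|y [cy yu ys]] := IH (Order.max u v); first by rewrite gt_max cu.
move: yu; rewrite gt_max => /andP[yu yv]; exists y; split=> // w.
by rewrite inE => /orP[/eqP->|/ys].
Qed.
End DenseOrder.

(** The lists bound the values uniformly in [i]; the two finiteness clauses are exchanged when the
    family is inverted. *)
Definition tame_family d (E : orderType d) (I : Type) (F G : I -> E -> E) :=
  [/\ forall i, cancel (F i) (G i), forall i, cancel (G i) (F i),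
      forall i, {mono F i : x y / x < y},
      forall x, exists s : seq E, forall i, F i x \in s
    & forall y, exists s : seq E, forall i, G i y \in s].

(** This is all that the construction retains of the assumption that neither [f] nor its inverse
    touches the identity. *)
Definition alternating d (E : orderType d) (isL : E -> Prop) (sg : E -> int) :=
  forall l l', isL l -> isL l' -> l < l' ->
    (0 < sg l)%R && (0 < sg l')%R || (sg l < 0)%R && (sg l' < 0)%R ->
  exists m, [/\ isL m, l < m, m < l' &
    ((0 < sg m)%R != (0 < sg l)%R) || ((sg m < 0)%R != (sg l < 0)%R)].

Section Cells.
Context {d : Order.disp_t} {E : orderType d} {I : Type}.

(* A point [(x, y)] of the graph under construction, together with the label
   there of every member of the family. *)
Definition node := (E * E * (I -> E))%type.
Implicit Types (P Q N M : node).

Section Defs.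
Variables (isL : E -> Prop) (sg : E -> int) (F : I -> E -> E).

(** For a [g] through the node, a positive label means that [F i] runs above [g], so that
    [g^-1 * F i] moves the abscissa up. *)
Definition good N := forall i, [/\ isL (N.2 i),
  (N.1.2 < F i N.1.1) = (0 < sg (N.2 i))%R &
  (F i N.1.1 < N.1.2) = (sg (N.2 i) < 0)%R].

(* The graph of [F i] stays on one side of the whole rectangle spanned by [p] and
   [q], so that one step of [g^-1 * F i] or of its inverse crosses it. *)
Definition robust i (p q : E * E) := q.2 <= F i p.1 \/ F i q.1 <= p.2.

(** Requiring different signs leaves six kinds of steps, three up to exchanging the coordinates. *)
Definition differ l l' :=
  ((0 < sg l)%R != (0 < sg l')%R) || ((sg l < 0)%R != (sg l' < 0)%R).

(** A node where a member has a label of sign zero lies on the graph of that member. Such labels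
    cannot be inserted freely, so they are all placed in the initial chain and none may be skipped
    by a cell. *)
Definition admissible l l' := [/\ isL l, isL l', l < l' &
  forall m, isL m -> l < m -> m < l' -> sg m != 0%R].

Definition cell P Q l l' := [/\ P.1.1 < Q.1.1, P.1.2 < Q.1.2,
  admissible l l' &
  forall i, (P.2 i = Q.2 i /\ robust i P.1 Q.1) \/ (P.2 i = l /\ Q.2 i = l')].

Definition step P Q := [/\ good P, good Q & exists l l', cell P Q l l' /\ differ l l'].

Fixpoint chain P (s : seq node) : Prop :=
  if s is Q :: s' then step P Q /\ chain Q s' else True.

Lemma chain_cat P s t : chain P (s ++ t) <-> chain P s /\ chain (last P s) t.
Proof.
by elim: s P => [|Q s IH] P /=; [split=> [|[]]|rewrite IH; split=> [[? []]|[[]]]].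
Qed.

Lemma chain_join P s N t Q :
  chain P (rcons s N) -> chain N (rcons t Q) ->
  chain P (rcons (s ++ N :: t) Q).
Proof.
by move=> h1 h2; rewrite rcons_cat rcons_cons -cat_rcons chain_cat last_rcons.
Qed.

End Defs.

(** * Inserting nodes into a single cell *)

Section Refine.
Hypothesis dense : forall x y : E, x < y -> exists z, x < z < y.
Variables (isL : E -> Prop) (sg : E -> int) (F G : I -> E -> E).
Hypothesis tame : tame_family F G.
Hypothesis alt : alternating isL sg.

Let FK i : cancel (F i) (G i). Proof. by case: tame. Qed.
Let GK i : cancel (G i) (F i). Proof. by case: tame. Qed.
Let Flt i : {mono F i : x y / x < y}. Proof. by case: tame. Qed.
Let Ffin x : exists s : seq E, forall i, F i x \in s. Proof. by case: tame. Qed.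
Let Gfin x : exists s : seq E, forall i, G i x \in s. Proof. by case: tame. Qed.
Let Fle i : {mono F i : x y / x <= y}.
Proof. by move=> x y; rewrite !leNgt Flt. Qed.
Let ltFG i x y : (F i x < y) = (x < G i y).
Proof. by rewrite -{1}(GK i y) Flt. Qed.
Let ltGF i x y : (y < F i x) = (G i y < x).
Proof. by rewrite -{1}(GK i y) Flt. Qed.

Local Notation good := (good isL sg F).
Local Notation robust := (robust F).
Local Notation admissible := (admissible isL sg).
Local Notation cell := (cell isL sg F).
Local Notation chain := (chain isL sg F).
Local Notation step := (step isL sg F).

Definition cross P Q i := P.2 i != Q.2 i.

Lemma cell_cross P Q l l' i : cell P Q l l' -> cross P Q i ->
  P.2 i = l /\ Q.2 i = l'.
Proof. by case=> _ _ _ /(_ i)[[PQ _]|//]; rewrite /cross PQ eqxx. Qed.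

(** Only crossing members need attention: for the others the rectangle is robust, so the graph lies
    on the same side of [p], and both subrectangles remain robust. A crossing member may keep an end
    label on a robust half, or change on that half according to the pair [l], [ml] or the pair [mr],
    [l']. *)
Lemma cell_ins P Q l l' (p : E * E) (mu : I -> E) ml mr :
  good P -> good Q -> cell P Q l l' ->
  P.1.1 < p.1 -> p.1 < Q.1.1 -> P.1.2 < p.2 -> p.2 < Q.1.2 ->
  admissible l ml -> admissible mr l' ->
  (forall i, cross P Q i ->
    [/\ isL (mu i), (p.2 < F i p.1) = (0 < sg (mu i))%R,
        (F i p.1 < p.2) = (sg (mu i) < 0)%R,
        mu i = l /\ robust i P.1 p \/ mu i = ml &
        mu i = l' /\ robust i p Q.1 \/ mu i = mr]) ->
  exists N, [/\ N.1 = p, good N, cell P N l ml, cell N Q mr l' &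
    forall i, N.2 i = if cross P Q i then mu i else P.2 i].
Proof.
move=> gP gQ cPQ Px xQ Py yQ al ar H.
pose N : node := (p, fun i => if cross P Q i then mu i else P.2 i).
have nc i : ~~ cross P Q i ->
    [/\ (p.2 < F i p.1) = (0 < sg (P.2 i))%R,
        (F i p.1 < p.2) = (sg (P.2 i) < 0)%R,
        robust i P.1 p & robust i p Q.1].
  move=> ncr; have PQi : P.2 i = Q.2 i by apply/eqP; move: ncr; rewrite negbK.
  have rb : robust i P.1 Q.1.
    case: cPQ => _ _ [_ _ ll' _] /(_ i)[[_ //]|[e1 e2]].
    by move: ll'; rewrite -e1 -e2 PQi ltxx.
  have [_ gP1 gP2] := gP i.
  case: rb => rb.
    have lt1 : P.1.2 < F i P.1.1 by apply: lt_le_trans rb; apply: lt_trans yQ.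
    have lt2 : p.2 < F i p.1.
      by apply: (lt_trans yQ); apply: (le_lt_trans rb); rewrite Flt.
    split.
    - by rewrite -gP1 lt1.
    - by rewrite -gP2 !ltNge ltW // ltW.
    - by left; apply: ltW; apply: lt_le_trans rb.
    - by left; apply: (le_trans rb); rewrite Fle ltW.
  have lt1 : F i P.1.1 < P.1.2.
    by apply: lt_le_trans rb; rewrite Flt; apply: lt_trans xQ.
  have lt2 : F i p.1 < p.2.
    by apply: le_lt_trans Py; apply: le_trans rb; rewrite Fle ltW.
  split.
  - by rewrite -gP1 !ltNge ltW // ltW.
  - by rewrite -gP2 lt1.
  - by right; apply: le_trans rb; rewrite Fle ltW.
  - by right; apply: (le_trans rb); rewrite ltW.
exists N; split=> //.
- move=> i; rewrite /N /=; case: ifPn => [/H[] //|/nc[-> -> _ _]].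
  by split=> //; have [] := gP i.
- split=> // i; rewrite /N /=; case: ifPn => [cr|/nc[_ _ r1 r2]]; last by left.
  have [e1 e2] := cell_cross cPQ cr.
  by have [_ _ _ [[-> r]|->] _] := H _ cr; [left|right].
- split=> // i; rewrite /N /=; case: ifPn => [cr|ncr].
    have [e1 e2] := cell_cross cPQ cr.
    by have [_ _ _ _ [[-> r]|->]] := H _ cr; [left|right].
  have [_ _ r1 r2] := nc _ ncr; left; split=> //.
  by apply/eqP; move: ncr; rewrite negbK.
Qed.

Lemma pos_above P Q l l' i : good P -> cell P Q l l' -> cross P Q i ->
  (0 < sg l)%R -> P.1.2 < F i P.1.1.
Proof. by move=> gP c /(cell_cross c)[e _] s; have [_ -> _] := gP i; rewrite e. Qed.

Lemma neg_below P Q l l' i : good Q -> cell P Q l l' -> cross P Q i ->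
  (sg l' < 0)%R -> F i Q.1.1 < Q.1.2.
Proof. by move=> gP c /(cell_cross c)[_ e] s; have [_ _ ->] := gP i; rewrite e. Qed.

Lemma pos_abover P Q l l' i : good Q -> cell P Q l l' -> cross P Q i ->
  (0 < sg l')%R -> Q.1.2 < F i Q.1.1.
Proof. by move=> gP c /(cell_cross c)[_ e] s; have [_ -> _] := gP i; rewrite e. Qed.

Lemma zero_eql P Q l l' i : good P -> cell P Q l l' -> cross P Q i ->
  sg l = 0%R -> F i P.1.1 = P.1.2.
Proof.
move=> gP c /(cell_cross c)[e _] s; have [_ e1 e2] := gP i.
by apply: le_anti; rewrite !leNgt e1 e2 e s.
Qed.

Lemma zero_eqr P Q l l' i : good Q -> cell P Q l l' -> cross P Q i ->
  sg l' = 0%R -> F i Q.1.1 = Q.1.2.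
Proof.
move=> gP c /(cell_cross c)[_ e] s; have [_ e1 e2] := gP i.
by apply: le_anti; rewrite !leNgt e1 e2 e s.
Qed.

Lemma pos_sign (l : E) (p : E * E) i : (0 < sg l)%R -> p.2 < F i p.1 ->
  (p.2 < F i p.1) = (0 < sg l)%R /\ (F i p.1 < p.2) = (sg l < 0)%R.
Proof. by move=> s h; rewrite h s (lt_gtF h) (lt_gtF s). Qed.

Lemma neg_sign (l : E) (p : E * E) i : (sg l < 0)%R -> F i p.1 < p.2 ->
  (p.2 < F i p.1) = (0 < sg l)%R /\ (F i p.1 < p.2) = (sg l < 0)%R.
Proof. by move=> s h; rewrite h s (lt_gtF h) (lt_gtF s). Qed.


Lemma step_cell P Q l l' :
  differ sg l l' -> good P -> good Q -> cell P Q l l' -> step P Q.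
Proof. by move=> df gP gQ c; split=> //; exists l, l'. Qed.

Lemma differPN l l' : (0 < sg l)%R -> (sg l' < 0)%R -> differ sg l l'.
Proof. by rewrite /differ => s s'; rewrite s s' (lt_gtF s'). Qed.

Lemma differNP l l' : (sg l < 0)%R -> (0 < sg l')%R -> differ sg l l'.
Proof. by rewrite /differ => s s'; rewrite s s' (lt_gtF s). Qed.

Lemma differ0 l l' : sg l = 0%R -> sg l' != 0%R -> differ sg l l'.
Proof.
by rewrite /differ => -> s; rewrite ltxx; move: s; rewrite neq_lt => /orP[]->;
  rewrite ?orbT.
Qed.

Lemma differr0 l l' : sg l != 0%R -> sg l' = 0%R -> differ sg l l'.
Proof.
by rewrite /differ => s ->; rewrite ltxx; move: s; rewrite neq_lt => /orP[]->;
  rewrite ?orbT.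
Qed.

(* The prefixes [LR], [ZP] and [PZ] refer to cells whose two labels have signs
   (+, -), (0, +) and (+, 0); exchanging the coordinates yields the other ones. *)
Section LR.
Variables (P Q : node) (l l' : E).
Hypotheses (gP : good P) (gQ : good Q) (c : cell P Q l l').
Hypotheses (sl : (0 < sg l)%R) (sl' : (sg l' < 0)%R).

(** The height is chosen just above [P], below all values over the left end of members that run
    above [P]. Crossing members then keep [l], robustly, between [P] and the new node, and all
    change after it. *)
Lemma LR_left q y0 : P.1.1 < q -> q < Q.1.1 -> P.1.2 < y0 -> y0 <= Q.1.2 ->
  exists N, [/\ N.1.1 = q /\ N.1.2 < y0, good N, cell P N l l', cell N Q l l' &
    forall i, N.2 i = P.2 i].
Proof.
move=> Pq qQ Py yQ; have [s sP] := Ffin P.1.1.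
have [y [y1 y2 ys]] := just_above dense s Py.
have hP i : cross P Q i -> y < F i P.1.1.
  by move=> cr; apply: ys => //; apply: pos_above c cr sl.
have [_ _ al _] := c.
have [|||||||N [Np gN c1 c2 NE]] :=
    @cell_ins P Q l l' (q, y) (fun=> l) l' l gP gQ c => //=.
- by apply: lt_le_trans yQ.
- move=> i cr; have h := hP i cr.
  have [s1 s2] : (y < F i q) = (0 < sg l)%R /\ (F i q < y) = (sg l < 0)%R.
    by apply: (@pos_sign l (q, y)) => //=; apply: (lt_trans h); rewrite Flt.
  by split=> //; [case: al|left; split=> //; left; apply: ltW|right].
exists N; rewrite Np; split=> // i; rewrite NE; case: ifPn => // cr.
by have [] := cell_cross c cr.
Qed.

(** The same at the opposite corner: just below [Q], and above the values over the right end of the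
    members below [Q], every crossing member already has label [l']. *)
Lemma LR_right q y0 : P.1.1 < q -> q < Q.1.1 -> P.1.2 <= y0 -> y0 < Q.1.2 ->
  exists N, [/\ N.1.1 = q /\ y0 < N.1.2, good N, cell P N l l', cell N Q l l' &
    forall i, N.2 i = Q.2 i].
Proof.
move=> Pq qQ Py yQ; have [s sQ] := Ffin Q.1.1.
have [y [y1 y2 ys]] := just_below dense s yQ.
have hP i : cross P Q i -> F i Q.1.1 < y.
  by move=> cr; apply: ys => //; apply: neg_below c cr sl'.
have [_ _ al _] := c.
have [|||||||N [Np gN c1 c2 NE]] :=
    @cell_ins P Q l l' (q, y) (fun=> l') l' l gP gQ c => //=.
- by apply: le_lt_trans y2.
- move=> i cr; have h := hP i cr.
  have [s1 s2] : (y < F i q) = (0 < sg l')%R /\ (F i q < y) = (sg l' < 0)%R.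
    by apply: (@neg_sign l' (q, y)) => //=; apply: lt_trans h; rewrite Flt.
  by split=> //; [case: al|right|left; split=> //; right; apply: ltW].
exists N; rewrite Np; split=> // i; rewrite NE; case: ifPn => [cr|].
  by have [] := cell_cross c cr.
by rewrite negbK => /eqP.
Qed.
End LR.

(** A member passing through height [y] inside the cell would have no robust half. The abscissa is
    therefore taken so close to [P] that no member reaches height [y] in between, after bounding the
    cell on the right by a node [M] there. *)
Lemma LR_ran P Q l l' y : good P -> good Q -> cell P Q l l' ->
  (0 < sg l)%R -> (sg l' < 0)%R -> P.1.2 < y -> y < Q.1.2 ->
  exists t, chain P (rcons t Q) /\ exists2 N, N \in t & N.1.2 = y.
Proof.
move=> gP gQ c sl sl' Py yQ; have [s sG] := Gfin y.
have PQx : P.1.1 < Q.1.1 by case: c.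
have [x0 [Px0 x0Q x0s]] := just_above dense s PQx.
have [b /andP[]] := dense Px0.
move: x0 x0Q Px0 x0s b => b bQ Pb bs x Px xb.
(* [b] precedes every [G i y] lying to the right of [P], so between the two abscissas no graph meets
   the height [y]. *)
have dich i : y <= F i P.1.1 \/ F i b < y.
  rewrite ltFG leNgt ltFG; case: (ltP P.1.1 (G i y)) => h; last by left.
  by right; apply: bs.
have [M [[Mb yM] gM c1 c2 ME]] := LR_right gP gQ c sl' Pb bQ (ltW Py) yQ.
have [_ _ al _] := c.
have [|||||||N [Np gN c3 c4 NE]] := @cell_ins P M l l' (x, y)
   (fun i => if F i x < y then l' else l) l' l gP gM c1 => //=.
- by rewrite Mb.
- move=> i cr; have [al1 al2 _ _] := al.
  case: ifPn => h.
    have [s1 s2] := @neg_sign l' (x, y) i sl' h.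
    split=> //; first by right.
    left; split=> //; right; rewrite /= Mb.
    case: (dich i) => [h1|/ltW//]; move: h; rewrite ltNge (le_trans h1) //.
    by rewrite Fle ltW.
  have [h1|h1] := dich i; last first.
    by move: h; rewrite (lt_trans _ h1) // Flt.
  have h2 : y < F i x by apply: (le_lt_trans h1); rewrite Flt.
  have [s1 s2] := @pos_sign l (x, y) i sl h2.
  by split; rewrite ?(lt_gtF sl) //; [left; split=> //; left|right].
exists [:: N; M]; split; last by exists N; rewrite ?inE ?eqxx // Np.
have df := differPN sl sl'.
by split; [apply: step_cell c3|split; [apply: step_cell c4|
  split=> //; apply: step_cell c2]].
Qed.


(** When one height [w] separates the values over [P] from those over [Q] for all crossing members,
    every such member is below a node at height [w] near the left end and above one at a slightly
    greater height near the right end. *)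
Lemma LR_lab2 P Q l l' w m1 m2 : good P -> good Q -> cell P Q l l' ->
  (0 < sg l)%R -> (sg l' < 0)%R ->
  isL m1 -> isL m2 -> (sg m1 < 0)%R -> (0 < sg m2)%R ->
  l < m1 -> m1 < m2 -> m2 < l' ->
  (forall i, cross P Q i -> F i P.1.1 < w /\ w < F i Q.1.1) ->
  exists t, chain P (rcons t Q) /\ forall i, cross P Q i ->
    (exists2 N, N \in t & N.2 i = m1) /\ (exists2 N, N \in t & N.2 i = m2).
Proof.
move=> gP gQ c sl sl' L1 L2 s1 s2 lm1 m12 m2l W.
have [[j crj]|ncr] := pselect (exists i, cross P Q i); last first.
  exists [::]; split.
    by split=> //; apply: step_cell c => //; apply: differPN.
  by move=> i cr; case: ncr; exists i.
have [PQx PQy al _] := c; have [Ll Ll' ll' nz] := al.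
have [wP wQ] := W _ crj.
have ajP := pos_above gP c crj sl; have ajQ := neg_below gQ c crj sl'.
have [s sQ] := Ffin Q.1.1.
have [w2 [ww2 w2Q w2s]] := just_above dense s wQ.
have {w2s} w2F i : cross P Q i -> w2 < F i Q.1.1.
  by move=> cr; apply: w2s => //; have [] := W _ cr.
have [s' sG] := Gfin w.
have [x1 [Px1 x1Q x1s]] := just_above dense s' PQx.
have {x1s} x1F i : cross P Q i -> F i x1 < w.
  by move=> cr; rewrite ltFG; apply: x1s => //; rewrite -ltFG; have [] := W _ cr.
have [s'' sG''] := Gfin w2.
have [x2 [x2Q x12 x2s]] := just_below dense s'' x1Q.
have {x2s} x2F i : cross P Q i -> w2 < F i x2.
  by move=> cr; rewrite ltGF; apply: x2s => //; rewrite -ltGF; apply: w2F.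
have m1l := lt_trans m12 m2l.
have a1 : admissible l m1.
  by split=> // m Lm lm mm; apply: nz => //; apply: lt_trans m1l.
have a2 : admissible m1 l'.
  by split=> // m Lm lm mm; apply: nz => //; apply: lt_trans lm.
have a3 : admissible m1 m2.
  by split=> // m Lm lm mm; have [_ _ _ ->] := a2 => //; apply: lt_trans m2l.
have a4 : admissible m2 l'.
  by split=> // m Lm lm mm; have [_ _ _ ->] := a2 => //; apply: lt_trans lm.
have [|||||||N [Np gN c1 c2 NE]] := @cell_ins P Q l l' (x1, w)
   (fun i => m1) m1 m1 gP gQ c => //=.
- by apply: lt_trans wP.
- by apply: (lt_trans wQ).
- move=> i cr; have [//|t1 t2] := @neg_sign m1 (x1, w) i s1; first exact: x1F.
  by split=> //; right.
have crN i : cross P Q i -> cross N Q i.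
  move=> cr; rewrite /cross NE cr; have [_ ->] := cell_cross c cr.
  by rewrite lt_eqF.
have [|||||||M [Mp gM c3 c4 ME]] := @cell_ins N Q m1 l' (x2, w2)
   (fun i => m2) m2 m2 gN gQ c2 => //=; rewrite ?Np //=.
- by apply: (lt_trans w2Q).
- move=> i cr; have crP : cross P Q i.
    by move: cr; rewrite /cross NE; case: ifPn.
  have [//|t1 t2] := @pos_sign m2 (x2, w2) i s2; first exact: x2F.
  by split=> //; right.
exists [:: N; M]; split.
  split; first by apply: step_cell c1 => //; apply: differPN.
  split; first by apply: step_cell c3 => //; apply: differNP.
  by split=> //; apply: step_cell c4 => //; apply: differPN.
move=> i cr; split; [exists N|exists M]; rewrite ?inE ?eqxx ?orbT //.
  by rewrite NE cr.
by rewrite ME crN.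
Qed.

(* The members through the highest value [v] over the left end are split off
   first; just to the right of that end they all rise by less than they do up to
   the right end, which leaves room for two more sign changes. *)
Lemma LR_lab_rec vs P Q l l' m1 m2 : good P -> good Q -> cell P Q l l' ->
  (0 < sg l)%R -> (sg l' < 0)%R ->
  isL m1 -> isL m2 -> (sg m1 < 0)%R -> (0 < sg m2)%R ->
  l < m1 -> m1 < m2 -> m2 < l' ->
  sorted >=%O vs ->
  (forall i, cross P Q i -> F i P.1.1 \in vs) ->
  (forall i j, F i P.1.1 < F j P.1.1 -> F i Q.1.1 < F j P.1.1) ->
  exists t, chain P (rcons t Q) /\ forall i, cross P Q i ->
    (exists2 N, N \in t & N.2 i = m1) /\ (exists2 N, N \in t & N.2 i = m2).
Proof.
move=> gP + + sl sl' L1 L2 s1 s2 lm1 m12 m2l.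
have df := differPN sl sl'.
elim: vs Q => [|v vs IH] Q gQ c srt Fvs sep.
  exists [::]; split; first by split=> //; apply: step_cell c.
  by move=> i /Fvs.
have vsv : {in vs, forall u, u <= v}.
  by move=> u uvs; have /allP/(_ u uvs) := order_path_min ge_trans srt.
have {}srt : sorted >=%O vs by apply: path_sorted srt.
have [[j [crj Fj]]|nv] := pselect (exists i, cross P Q i /\ F i P.1.1 = v);
  last first.
  apply: IH => // i cr; have := Fvs i cr; rewrite inE => /orP[/eqP e|//].
  by case: nv; exists i.
have [PQx PQy al _] := c; have [Ll Ll' ll' nz] := al.
have Pv : P.1.2 < v by rewrite -Fj; apply: pos_above c crj sl.
have vQ : v < F j Q.1.1 by rewrite -Fj Flt.
have FjQ := neg_below gQ c crj sl'.
have [s sF] := Ffin Q.1.1.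
have [dl [dlv Pdl dls]] := just_below dense s Pv.
have {dls} lowQ i : F i P.1.1 < v -> F i Q.1.1 < dl.
  by move=> h; apply: dls => //; rewrite -Fj; apply: sep; rewrite Fj.
have [w [vw wQ ws]] := just_above dense s vQ.
have {ws} wF i : F i P.1.1 = v -> w < F i Q.1.1.
  by move=> h; apply: ws => //; rewrite -h Flt.
have [s' sG] := Gfin w.
have [b [Pb bQ bs]] := just_above dense s' PQx.
have {bs} bF i : F i P.1.1 = v -> F i b < w.
  by move=> h; rewrite ltFG; apply: bs => //; rewrite -ltFG h.
have dich i : cross P Q i -> F i P.1.1 < v \/ F i P.1.1 = v.
  move=> cr; have := Fvs i cr; rewrite inE => /orP[/eqP->|/vsv]; first by right.
  by rewrite le_eqVlt => /orP[/eqP|]; [right|left].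
(* At this node the members through [v] are still above and all other crossing members already
   below. The former thus cross from [N] to [Q], the latter from [P] to [N]. *)
have [|||||||N [Np gN c1 c2 NE]] := @cell_ins P Q l l' (b, dl)
   (fun i => if F i P.1.1 == v then l else l') l' l gP gQ c => //=.
- by apply: (lt_trans dlv); apply: (lt_trans vQ).
- move=> i cr; case: eqP => [e|ne].
    have [//||t1 t2] := @pos_sign l (b, dl) i.
      by rewrite /= (lt_trans dlv) // -e Flt.
    by split=> //; [left; split=> //; left; rewrite /= e ltW|right].
  have [lt|//] := dich i cr.
  have [//||t1 t2] := @neg_sign l' (b, dl) i.
    by rewrite /= (lt_trans _ (lowQ _ lt)) // Flt.
  by split=> //; [right|left; split=> //; right; rewrite /= ltW // lowQ].
have crPN i : cross P N i = cross P Q i && (F i P.1.1 != v).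
  rewrite {1}/cross NE.
  have [cr|ncr] := boolP (cross P Q i); last by rewrite eqxx.
  have [-> _] := cell_cross c cr.
  by case: (eqVneq (F i P.1.1) v) => _; rewrite ?eqxx // lt_eqF.
have crNQ i : cross N Q i = cross P Q i && (F i P.1.1 == v).
  rewrite {1}/cross NE.
  have [cr|ncr] := boolP (cross P Q i); last exact: negbTE.
  have [_ ->] := cell_cross c cr.
  by case: (eqVneq (F i P.1.1) v) => _; rewrite ?eqxx // lt_eqF.
have [||t1 [ch1 H1]] := IH N gN c1 srt.
- move=> i; rewrite crPN => /andP[cr /negbTE ne].
  by have := Fvs i cr; rewrite inE ne.
- move=> i k h; apply: lt_trans (sep _ _ h); rewrite Np /= Flt //.
have [|t2 [ch2 H2]] := LR_lab2 (w := w) gN gQ c2 sl sl' L1 L2 s1 s2 lm1 m12 m2l.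
  by move=> i; rewrite crNQ Np /= => /andP[_ /eqP e]; split; [apply: bF|apply: wF].
exists (t1 ++ N :: t2); split; first exact: chain_join ch1 ch2.
move=> i cr; have [e|ne] := eqVneq (F i P.1.1) v.
  have [|[M M1 M2] [M' M3 M4]] := H2 i; first by rewrite crNQ cr e eqxx.
  by split; [exists M|exists M']; rewrite ?mem_cat ?inE ?M1 ?M3 ?orbT.
have [|[M M1 M2] [M' M3 M4]] := H1 i; first by rewrite crPN cr ne.
by split; [exists M|exists M']; rewrite ?mem_cat ?inE ?M1 ?M3 ?orbT.
Qed.

Lemma fin_image (s : seq E) : exists s' : seq E,
  forall x, x \in s -> forall i, G i x \in s'.
Proof.
elim: s => [|x s [s' Hs]]; first by exists [::].
have [t Ht] := Gfin x; exists (t ++ s') => y.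
rewrite inE => /orP[/eqP->|ys] i; rewrite mem_cat ?Ht //.
by rewrite Hs ?orbT.
Qed.

(** Between signs + and - new labels come in pairs, a negative one followed by a positive one.
    Alternation supplies the missing partner of [m] on the appropriate side. *)
Lemma LR_lab P Q l l' m : good P -> good Q -> cell P Q l l' ->
  (0 < sg l)%R -> (sg l' < 0)%R -> isL m -> l < m -> m < l' ->
  exists t, chain P (rcons t Q) /\ forall i, cross P Q i ->
    exists2 N, N \in t & N.2 i = m.
Proof.
move=> gP gQ c sl sl' Lm lm ml'.
have [PQx PQy al _] := c; have [Ll Ll' ll' nz] := al.
have [m1 [m2 [[L1 L2] [s1 s2] [lm1 m12 m2l] mE]]] : exists m1 m2,
    [/\ isL m1 /\ isL m2, (sg m1 < 0)%R /\ (0 < sg m2)%R,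
     [/\ l < m1, m1 < m2 & m2 < l'] & m = m1 \/ m = m2].
  have /orP[sm|sm] : (sg m < 0)%R || (0 < sg m)%R by rewrite -neq_lt; apply: nz.
    have [|m2 [Lm2 mm2 m2l dm]] := alt Lm Ll' ml'; first by rewrite sm sl' orbT.
    exists m, m2; split=> //; last by left.
    split=> //; move: dm; rewrite sm (lt_gtF sm).
    have := nz m2 Lm2 (lt_trans lm mm2) m2l.
    by rewrite neq_lt => /orP[] h; rewrite h ?(lt_gtF h).
  have [|m1 [Lm1 lm1 mm1 dm]] := alt Ll Lm lm; first by rewrite sl sm.
  exists m1, m; split=> //; last by right.
  split=> //; move: dm; rewrite sl (lt_gtF sl).
  have := nz m1 Lm1 lm1 (lt_trans mm1 ml').
  by rewrite neq_lt => /orP[] h; rewrite h ?(lt_gtF h).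
have [vs Fvs] := Ffin P.1.1.
have [s Gs] := fin_image vs.
have [b [Pb bQ bs]] := just_above dense s PQx.
(* Up to [b], no member climbs to a greater value taken over the left end by another one; the
   recursion is run on the thin cell ending at [b]. *)
have sep i j : F i P.1.1 < F j P.1.1 -> F i b < F j P.1.1.
  by move=> h; rewrite ltFG; apply: bs; [apply: Gs; apply: Fvs|rewrite -ltFG].
have [N [[Nb _] gN c1 c2 NE]] := LR_right gP gQ c sl' Pb bQ (lexx _) PQy.
have [|||t [ch H]] := @LR_lab_rec (sort >=%O vs) P N l l' m1 m2 gP gN c1 sl sl'
    L1 L2 s1 s2 lm1 m12 m2l.
- by apply: sort_sorted => x y; apply: le_total.
- by move=> i _; rewrite mem_sort Fvs.
- by rewrite Nb.
exists (t ++ [:: N]); split.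
  by apply: (chain_join ch); split=> //; apply: step_cell c2 => //; apply: differPN.
move=> i cr; have [|[M M1 M2] [M' M3 M4]] := H i.
  by rewrite /cross NE.
by case: mE => ->; [exists M|exists M'] => //; rewrite mem_cat ?M1 ?M3.
Qed.


Lemma LR_dom P Q l l' q : good P -> good Q -> cell P Q l l' ->
  (0 < sg l)%R -> (sg l' < 0)%R -> P.1.1 < q -> q < Q.1.1 ->
  exists t, chain P (rcons t Q) /\ exists2 N, N \in t & N.1.1 = q.
Proof.
move=> gP gQ c sl sl' Pq qQ; have [_ PQy _ _] := c.
have [N [[Nq _] gN c1 c2 _]] := LR_left gP gQ c sl Pq qQ PQy (lexx _).
exists [:: N]; split; last by exists N; rewrite ?mem_head.
have df := differPN sl sl'.
by split; [apply: step_cell c1|split=> //; apply: step_cell c2].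
Qed.

(** * Cells with one label of sign zero *)

Section ZeroPos.
Variables (P Q : node) (l l' : E).
Hypotheses (gP : good P) (gQ : good Q) (c : cell P Q l l').
Hypotheses (sl : sg l = 0%R) (sl' : (0 < sg l')%R).

Let al : admissible l l'. Proof. by case: c. Qed.
Let df : differ sg l l'. Proof. by apply: differ0 => //; rewrite gt_eqF. Qed.

(** Once all crossing members have risen to the height of [Q], any node over such an abscissa is
    below them, and the rest of the cell is robust. *)
Lemma ZP_ins x y : P.1.1 < x -> x < Q.1.1 -> P.1.2 < y -> y < Q.1.2 ->
  (forall i, cross P Q i -> Q.1.2 <= F i x) ->
  exists N, [/\ N.1 = (x, y), good N, cell P N l l', cell N Q l l' &
    forall i, N.2 i = Q.2 i].
Proof.
move=> Px xQ Py yQ hx; have [Ll Ll' _ _] := al.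
have [|||||||N [Np gN c1 c2 NE]] := @cell_ins P Q l l' (x, y)
   (fun i => l') l' l gP gQ c => //=.
  move=> i cr; have h := hx i cr.
  have [//||t1 t2] := @pos_sign l' (x, y) i; first by apply: lt_le_trans h.
  by split=> //; [right|left; split=> //; left].
exists N; split=> // i; rewrite NE; case: ifPn => [cr|].
  by have [] := cell_cross c cr.
by rewrite negbK => /eqP.
Qed.

Let near_right u : u < Q.1.1 ->
  exists x, [/\ x < Q.1.1, u < x & forall i, cross P Q i -> Q.1.2 <= F i x].
Proof.
move=> uQ; have [s Gs] := Gfin Q.1.2.
have [x [xQ ux xs]] := just_below dense s uQ.
exists x; split=> // i cr; rewrite ltW // ltGF; apply: xs => //.
by rewrite -ltGF; apply: pos_abover c cr sl'.
Qed.

Lemma ZP_ran y : P.1.2 < y -> y < Q.1.2 ->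
  exists t, chain P (rcons t Q) /\ exists2 N, N \in t & N.1.2 = y.
Proof.
move=> Py yQ; have [PQx _ _ _] := c.
have [x [xQ Px hx]] := near_right PQx.
have [N [Np gN c1 c2 _]] := ZP_ins Px xQ Py yQ hx.
exists [:: N]; split; last by exists N; rewrite ?mem_head // Np.
by split; [apply: step_cell c1|split=> //; apply: step_cell c2].
Qed.

(** Over [q] the members exceed the height of [P] but perhaps not that of [Q]. A node [M] further
    right and lower than all values over [q] makes the rest robust. *)
Lemma ZP_dom q : P.1.1 < q -> q < Q.1.1 ->
  exists t, chain P (rcons t Q) /\ exists2 N, N \in t & N.1.1 = q.
Proof.
move=> Pq qQ; have [PQx PQy _ _] := c.
have [s Fs] := Ffin q.
have [y1 [Py1 y1Q y1s]] := just_above dense s PQy.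
have y1F i : cross P Q i -> y1 < F i q.
  move=> cr; apply: y1s => //; rewrite -(zero_eql gP c cr sl); by rewrite Flt.
have [x1 [x1Q qx1 hx1]] := near_right qQ.
have [M [Mp gM c1 c2 ME]] := ZP_ins (lt_trans Pq qx1) x1Q Py1 y1Q hx1.
have [y /andP[Py yy1]] := dense Py1.
have [Ll Ll' _ _] := al.
have [|||||||N [Np gN c3 c4 NE]] := @cell_ins P M l l' (q, y)
   (fun i => l') l' l gP gM c1 => //=; rewrite ?Mp //=.
  move=> i; rewrite /cross ME => cr; have h := y1F i cr.
  have [//||t1 t2] := @pos_sign l' (q, y) i; first by apply: lt_trans h.
  by split=> //; [right|left; split=> //; left; rewrite /= ltW].
exists [:: N; M]; split; last by exists N; rewrite ?mem_head // Np.
split; first by apply: step_cell c3.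
by split; [apply: step_cell c4|split=> //; apply: step_cell c2].
Qed.

(** All crossing members pass through [P] itself, so just to the right of it they are still below
    any given height above [P]. This gives only negative labels; a positive one needs a negative one
    inserted before. *)
Lemma ZP_lab1 m : isL m -> l < m -> m < l' -> (sg m < 0)%R ->
  exists N, [/\ good N, cell P N l m, cell N Q m l' &
    forall i, cross P Q i -> N.2 i = m].
Proof.
move=> Lm lm ml' sm; have [PQx PQy _ _] := c.
have [y /andP[Py yQ]] := dense PQy.
have [s Gs] := Gfin y.
have [x [Px xQ xs]] := just_above dense s PQx.
have xF i : cross P Q i -> F i x < y.
  move=> cr; rewrite ltFG; apply: xs => //; rewrite -ltFG.
  by rewrite (zero_eql gP c cr sl).
have [Ll Ll' ll' nz] := al.
have [|||||||N [Np gN c3 c4 NE]] := @cell_ins P Q l l' (x, y)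
   (fun i => m) m m gP gQ c => //=.
- by split=> // k Lk lk km; apply: nz => //; apply: lt_trans ml'.
- by split=> // k Lk lk km; apply: nz => //; apply: lt_trans lk.
- move=> i cr; have [//||t1 t2] := @neg_sign m (x, y) i; first exact: xF.
  by split=> //; right.
by exists N; split=> // i cr; rewrite NE cr.
Qed.
End ZeroPos.

Section PosZero.
Variables (P Q : node) (l l' : E).
Hypotheses (gP : good P) (gQ : good Q) (c : cell P Q l l').
Hypotheses (sl : (0 < sg l)%R) (sl' : sg l' = 0%R).

Let al : admissible l l'. Proof. by case: c. Qed.
Let df : differ sg l l'. Proof. by apply: differr0 => //; rewrite gt_eqF. Qed.

Lemma PZ_ins x y : P.1.1 < x -> x < Q.1.1 -> P.1.2 < y -> y < Q.1.2 ->
  (forall i, cross P Q i -> y <= F i P.1.1) ->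
  exists N, [/\ N.1 = (x, y), good N, cell P N l l', cell N Q l l' &
    forall i, N.2 i = P.2 i].
Proof.
move=> Px xQ Py yQ hx; have [Ll Ll' _ _] := al.
have [|||||||N [Np gN c1 c2 NE]] := @cell_ins P Q l l' (x, y)
   (fun i => l) l' l gP gQ c => //=.
  move=> i cr; have h := hx i cr.
  have [//||t1 t2] := @pos_sign l (x, y) i.
    by apply: (le_lt_trans h); rewrite Flt.
  by split=> //; [left; split=> //; left|right].
exists N; split=> // i; rewrite NE; case: ifPn => // cr.
by have [] := cell_cross c cr.
Qed.

Let near_left u : P.1.2 < u ->
  exists y, [/\ P.1.2 < y, y < u & forall i, cross P Q i -> y <= F i P.1.1].
Proof.
move=> uQ; have [s Fs] := Ffin P.1.1.
have [y [Py yu ys]] := just_above dense s uQ.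
by exists y; split=> // i cr; rewrite ltW // ys //; apply: pos_above c cr sl.
Qed.

Lemma PZ_dom q : P.1.1 < q -> q < Q.1.1 ->
  exists t, chain P (rcons t Q) /\ exists2 N, N \in t & N.1.1 = q.
Proof.
move=> Pq qQ; have [_ PQy _ _] := c.
have [y [Py yQ hy]] := near_left PQy.
have [N [Np gN c1 c2 _]] := PZ_ins Pq qQ Py yQ hy.
exists [:: N]; split; last by exists N; rewrite ?mem_head // Np.
by split; [apply: step_cell c1|split=> //; apply: step_cell c2].
Qed.

(** The counterpart of [ZP_dom], reflected in the antidiagonal: the left end is moved to an abscissa
    over which all crossing members already exceed [y]. *)
Lemma PZ_ran y : P.1.2 < y -> y < Q.1.2 ->
  exists t, chain P (rcons t Q) /\ exists2 N, N \in t & N.1.2 = y.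
Proof.
move=> Py yQ; have [PQx PQy _ _] := c.
have [s Gs] := Gfin y.
have [x1 [x1Q Px1 x1s]] := just_below dense s PQx.
have x1F i : cross P Q i -> y < F i x1.
  move=> cr; rewrite ltGF; apply: x1s => //; rewrite -ltGF.
  by rewrite (zero_eqr gQ c cr sl').
have [y1 [Py1 y1y hy1]] := near_left Py.
have [M [Mp gM c1 c2 ME]] := PZ_ins Px1 x1Q Py1 (lt_trans y1y yQ) hy1.
have [x /andP[x1x xQ]] := dense x1Q.
have [Ll Ll' _ _] := al.
have [|||||||N [Np gN c3 c4 NE]] := @cell_ins M Q l l' (x, y)
   (fun i => l) l' l gM gQ c2 => //=; rewrite ?Mp //=.
  move=> i; rewrite /cross ME => cr; have h := x1F i cr.
  have [//||t1 t2] := @pos_sign l (x, y) i.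
    by apply: (lt_trans h); rewrite Flt.
  by split=> //; [left; split=> //; left; rewrite /= ltW|right].
exists [:: M; N]; split; last by exists N; rewrite ?inE ?eqxx ?orbT // Np.
split; first by apply: step_cell c1.
by split; [apply: step_cell c3|split=> //; apply: step_cell c4].
Qed.

Lemma PZ_lab1 m : isL m -> l < m -> m < l' -> (sg m < 0)%R ->
  exists N, [/\ good N, cell P N l m, cell N Q m l' &
    forall i, cross P Q i -> N.2 i = m].
Proof.
move=> Lm lm ml' sm; have [PQx PQy _ _] := c.
have [x /andP[Px xQ]] := dense PQx.
have [s Fs] := Ffin x.
have [y [yQ Py ys]] := just_below dense s PQy.
have xF i : cross P Q i -> F i x < y.
  by move=> cr; apply: ys => //; rewrite -(zero_eqr gQ c cr sl') Flt.
have [Ll Ll' ll' nz] := al.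
have [|||||||N [Np gN c3 c4 NE]] := @cell_ins P Q l l' (x, y)
   (fun i => m) m m gP gQ c => //=.
- by split=> // k Lk lk km; apply: nz => //; apply: lt_trans ml'.
- by split=> // k Lk lk km; apply: nz => //; apply: lt_trans lk.
- move=> i cr; have [//||t1 t2] := @neg_sign m (x, y) i; first exact: xF.
  by split=> //; right.
by exists N; split=> // i cr; rewrite NE cr.
Qed.
End PosZero.

End Refine.

(** * Exchanging the coordinates: inverse family and opposite signs *)

Definition swap N : node := ((N.1.2, N.1.1), N.2).

Lemma swapK : involutive swap.
Proof. by case=> -[x y] m. Qed.

Definition opp_sign (sg : E -> int) l := (- sg l)%R.

Lemma opp_signK : involutive opp_sign.
Proof. by move=> sg; apply/funext => l; rewrite /opp_sign opprK. Qed.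

Lemma tame_familyC (F G : I -> E -> E) : tame_family F G -> tame_family G F.
Proof.
case=> FK GK Flt Ff Gf; split=> // i x y.
by rewrite -(Flt i) !GK.
Qed.

Lemma alternating_opp isL (sg : E -> int) :
  alternating isL sg -> alternating isL (opp_sign sg).
Proof.
move=> alt l l' L L' ll'; rewrite /opp_sign !oppr_gt0 !oppr_lt0 orbC => H.
have [m [Lm lm ml h]] := alt _ _ L L' ll' H; exists m; split=> //.
by rewrite !oppr_gt0 !oppr_lt0 orbC.
Qed.

Lemma differ_opp (sg : E -> int) l l' :
  differ (opp_sign sg) l l' = differ sg l l'.
Proof. by rewrite /differ /opp_sign !oppr_gt0 !oppr_lt0 orbC. Qed.

Lemma admissible_opp isL (sg : E -> int) l l' :
  admissible isL sg l l' -> admissible isL (opp_sign sg) l l'.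
Proof.
case=> L L' ll' nz; split=> // m Lm lm ml.
by rewrite /opp_sign oppr_eq0; apply: nz.
Qed.

Section Swap.
Variables (isL : E -> Prop) (sg : E -> int) (F G : I -> E -> E).
Hypothesis tame : tame_family F G.

Let ltFG i x y : (F i x < y) = (x < G i y).
Proof. by case: tame => FK GK Flt _ _; rewrite -{1}(GK i y) Flt. Qed.
Let ltGF i x y : (y < F i x) = (G i y < x).
Proof. by case: tame => FK GK Flt _ _; rewrite -{1}(GK i y) Flt. Qed.

Lemma good_swap N : good isL sg F N -> good isL (opp_sign sg) G (swap N).
Proof.
move=> gN i; have [L h1 h2] := gN i; split=> //=.
  by rewrite -ltFG h2 /opp_sign oppr_gt0.
by rewrite -ltGF h1 /opp_sign oppr_lt0.
Qed.

Lemma cell_swap P Q l l' : cell isL sg F P Q l l' ->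
  cell isL (opp_sign sg) G (swap P) (swap Q) l l'.
Proof.
case=> h1 h2 al H; split=> //; first exact: admissible_opp.
move=> i; case: (H i) => [[e r]|[e1 e2]]; [left|by right].
split=> //; case: r => /= r; [right|left]; rewrite /= leNgt; apply/negP.
  by rewrite -ltFG ltNge r.
by rewrite -ltGF ltNge r.
Qed.

Lemma step_swap P Q : step isL sg F P Q ->
  step isL (opp_sign sg) G (swap P) (swap Q).
Proof.
case=> gP gQ [l [l' [c df]]]; split; [exact: good_swap|exact: good_swap|].
by exists l, l'; split; [exact: cell_swap|rewrite differ_opp].
Qed.

Lemma chain_swap P s : chain isL sg F P s ->
  chain isL (opp_sign sg) G (swap P) (map swap s).
Proof.
by elim: s P => [//|Q s IH] P [st ch]; split; [exact: step_swap|exact: IH].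
Qed.
End Swap.

Lemma chain_swapV isL sg (F G : I -> E -> E) P t Q : tame_family F G ->
  chain isL (opp_sign sg) G (swap P) (rcons t (swap Q)) ->
  chain isL sg F P (rcons (map swap t) Q).
Proof.
move=> tame /(chain_swap (tame_familyC tame)).
by rewrite opp_signK swapK map_rcons swapK.
Qed.

(** * Refining an arbitrary step *)

Section Refinement.
Hypothesis dense : forall x y : E, x < y -> exists z, x < z < y.
Variable isL : E -> Prop.

Definition upward (sg : E -> int) l l' :=
  (0 < sg l)%R || (sg l == 0%R) && (0 < sg l')%R.

Lemma upwardP (sg : E -> int) l l' : differ sg l l' -> upward sg l l' ->
  [\/ (0 < sg l)%R /\ (sg l' < 0)%R, sg l = 0%R /\ (0 < sg l')%R |
      (0 < sg l)%R /\ sg l' = 0%R].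
Proof.
rewrite /differ /upward => df /orP[h|/andP[/eqP h1 h2]]; last by constructor 2.
case: (ltgtP (sg l') 0%R) df => h' df; [by constructor 1| |by constructor 3].
by move: df; rewrite h /= (lt_gtF h).
Qed.

Lemma upward_opp (sg : E -> int) l l' : differ sg l l' ->
  ~~ upward sg l l' -> upward (opp_sign sg) l l'.
Proof.
rewrite /differ /upward /opp_sign !oppr_gt0 oppr_eq0.
by case: (ltgtP (sg l) 0%R) => //= h; case: (ltgtP (sg l') 0%R).
Qed.

Section Up.
Variables (sg : E -> int) (F G : I -> E -> E).
Hypotheses (tame : tame_family F G) (alt : alternating isL sg).
Variables (P Q : node) (l l' : E).
Hypotheses (gP : good isL sg F P) (gQ : good isL sg F Q).
Hypotheses (c : cell isL sg F P Q l l') (df : differ sg l l').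
Hypothesis up : upward sg l l'.

Lemma up_dom q : P.1.1 < q -> q < Q.1.1 -> exists t,
  chain isL sg F P (rcons t Q) /\ exists2 N, N \in t & N.1.1 = q.
Proof.
case: (upwardP df up) => [][s s']; [exact: (LR_dom dense tame gP gQ c)
  |exact: (ZP_dom dense tame gP gQ c)|exact: (PZ_dom dense tame gP gQ c)].
Qed.

Lemma up_ran q : P.1.2 < q -> q < Q.1.2 -> exists t,
  chain isL sg F P (rcons t Q) /\ exists2 N, N \in t & N.1.2 = q.
Proof.
case: (upwardP df up) => [][s s']; [exact: (LR_ran dense tame gP gQ c)
  |exact: (ZP_ran dense tame gP gQ c)|exact: (PZ_ran dense tame gP gQ c)].
Qed.

Lemma up_lab m : isL m -> l < m -> m < l' -> exists t,
  chain isL sg F P (rcons t Q) /\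
  forall i, cross P Q i -> exists2 N, N \in t & N.2 i = m.
Proof.
move=> Lm lm ml'.
have [_ _ [Ll Ll' ll' nz] _] := c.
have tameC := tame_familyC tame.
have nzm := nz m Lm lm ml'.
case: (upwardP df up) => [][s s']; first exact: (LR_lab dense tame alt gP gQ c).
- have [sm|sm] : (sg m < 0)%R \/ (0 < sg m)%R by apply/orP; rewrite -neq_lt.
    have [N [gN c1 c2 NE]] := ZP_lab1 dense tame gP gQ c s Lm lm ml' sm.
    exists [:: N]; split; last by move=> i /NE; exists N; rewrite ?mem_head.
    split; first by apply: step_cell c1 => //; apply: differ0; rewrite ?lt_eqF.
    by split=> //; apply: step_cell c2 => //; apply: differNP.
  (* For a positive [m] a negative [m'] beyond it is inserted by alternation. The cell from [P] to
     that node has signs (0, -), which become (0, +) after exchanging the coordinates, and there [m]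
     counts as negative. *)
  have [|m' [Lm' mm' ml d']] := alt Lm Ll' ml'; first by rewrite sm s'.
  have sm' : (sg m' < 0)%R.
    have := nz m' Lm' (lt_trans lm mm') ml; rewrite neq_lt => /orP[//|h].
    by move: d'; rewrite h sm (lt_gtF h) (lt_gtF sm).
  have [N [gN c1 c2 NE]] :=
    ZP_lab1 dense tame gP gQ c s Lm' (lt_trans lm mm') ml sm'.
  have [||M [gM c3 c4 ME]] := @ZP_lab1 dense isL (opp_sign sg) G F tameC
    (swap P) (swap N) l m' (good_swap tame gP) (good_swap tame gN)
    (cell_swap tame c1) _ m Lm lm mm'.
  + by rewrite /opp_sign s.
  + by rewrite /opp_sign oppr_lt0.
  have gM' := good_swap tameC gM; rewrite opp_signK in gM'.
  have := cell_swap tameC c3; have := cell_swap tameC c4.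
  rewrite !opp_signK !swapK => c4' c3'.
  exists [:: swap M; N]; split.
    split; first by apply: step_cell c3' => //; apply: differ0; rewrite ?gt_eqF.
    split; first by apply: step_cell c4' => //; apply: differPN.
    by split=> //; apply: step_cell c2 => //; apply: differNP.
  move=> i cr; exists (swap M); rewrite ?mem_head //= ME //.
  rewrite /cross /= NE //; have [-> _] := cell_cross c cr.
  by rewrite lt_eqF // (lt_trans lm).
- have [sm|sm] : (sg m < 0)%R \/ (0 < sg m)%R by apply/orP; rewrite -neq_lt.
    have [N [gN c1 c2 NE]] := PZ_lab1 dense tame gP gQ c s' Lm lm ml' sm.
    exists [:: N]; split; last by move=> i /NE; exists N; rewrite ?mem_head.
    split; first by apply: step_cell c1 => //; apply: differPN.
    by split=> //; apply: step_cell c2 => //; apply: differr0; rewrite ?lt_eqF.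
  (* Here the auxiliary negative label precedes [m], and the cell that remains has signs (-, 0). *)
  have [|m' [Lm' mm' ml d']] := alt Ll Lm lm; first by rewrite sm s.
  have sm' : (sg m' < 0)%R.
    have := nz m' Lm' mm' (lt_trans ml ml'); rewrite neq_lt => /orP[//|h].
    by move: d'; rewrite h s (lt_gtF h) (lt_gtF s).
  have [N [gN c1 c2 NE]] :=
    PZ_lab1 dense tame gP gQ c s' Lm' mm' (lt_trans ml ml') sm'.
  have [||M [gM c3 c4 ME]] := @PZ_lab1 dense isL (opp_sign sg) G F tameC
    (swap N) (swap Q) m' l' (good_swap tame gN) (good_swap tame gQ)
    (cell_swap tame c2) _ m Lm ml ml'.
  + by rewrite /opp_sign s'.
  + by rewrite /opp_sign oppr_lt0.
  have gM' := good_swap tameC gM; rewrite opp_signK in gM'.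
  have := cell_swap tameC c3; have := cell_swap tameC c4.
  rewrite !opp_signK !swapK => c4' c3'.
  exists [:: N; swap M]; split.
    split; first by apply: step_cell c1 => //; apply: differPN.
    split; first by apply: step_cell c3' => //; apply: differNP.
    by split=> //; apply: step_cell c4' => //; apply: differr0; rewrite ?gt_eqF.
  move=> i cr; exists (swap M); rewrite ?inE ?eqxx ?orbT //= ME //.
  rewrite /cross /= NE //; have [_ ->] := cell_cross c cr.
  by rewrite lt_eqF // (lt_trans ml).
Qed.
End Up.

Section All.
Variables (sg : E -> int) (F G : I -> E -> E).
Hypotheses (tame : tame_family F G) (alt : alternating isL sg).
Local Notation chain := (chain isL sg F).
Local Notation step := (step isL sg F).

Lemma refine_dom P Q q : step P Q -> P.1.1 < q -> q < Q.1.1 -> exists t,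
  chain P (rcons t Q) /\ exists2 N, N \in t & N.1.1 = q.
Proof.
case=> gP gQ [l [l' [c df]]] Pq qQ.
have [up|nup] := boolP (upward sg l l'); first exact: (up_dom tame gP gQ c).
have [||||t [ch [N Nt Nq]]] := @up_ran (opp_sign sg) G F (tame_familyC tame)
  (swap P) (swap Q) l l' (good_swap tame gP) (good_swap tame gQ)
  (cell_swap tame c) _ _ q => //; first by rewrite differ_opp.
  exact: upward_opp.
exists (map swap t); split; first exact: chain_swapV ch.
by exists (swap N); rewrite ?(map_f swap Nt).
Qed.

Lemma refine_ran P Q q : step P Q -> P.1.2 < q -> q < Q.1.2 -> exists t,
  chain P (rcons t Q) /\ exists2 N, N \in t & N.1.2 = q.
Proof.
case=> gP gQ [l [l' [c df]]] Pq qQ.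
have [up|nup] := boolP (upward sg l l'); first exact: (up_ran tame gP gQ c).
have [||||t [ch [N Nt Nq]]] := @up_dom (opp_sign sg) G F (tame_familyC tame)
  (swap P) (swap Q) l l' (good_swap tame gP) (good_swap tame gQ)
  (cell_swap tame c) _ _ q => //; first by rewrite differ_opp.
  exact: upward_opp.
exists (map swap t); split; first exact: chain_swapV ch.
by exists (swap N); rewrite ?(map_f swap Nt).
Qed.

Lemma refine_lab P Q m : step P Q -> isL m -> exists t,
  chain P (rcons t Q) /\ forall i, P.2 i < m -> m < Q.2 i ->
    exists2 N, N \in t & N.2 i = m.
Proof.
move=> st Lm; have [gP gQ [l [l' [c df]]]] := st.
have cr i : P.2 i < m -> m < Q.2 i -> cross P Q i.
  by move=> Pm mQ; rewrite /cross lt_eqF // (lt_trans Pm).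
have [/andP[lm ml]|nlm] := boolP (l < m < l'); last first.
  exists [::]; split=> // i Pm mQ; have [e1 e2] := cell_cross c (cr i Pm mQ).
  by move: nlm; rewrite -e1 -e2 Pm mQ.
have [up|nup] := boolP (upward sg l l').
  have [t [ch H]] := up_lab tame alt gP gQ c df up Lm lm ml.
  by exists t; split=> // i Pm mQ; apply: H; apply: cr.
have [||||||t [ch H]] := @up_lab (opp_sign sg) G F (tame_familyC tame) _
  (swap P) (swap Q) l l' (good_swap tame gP) (good_swap tame gQ)
  (cell_swap tame c) _ _ m => //; first exact: alternating_opp.
- by rewrite differ_opp.
- exact: upward_opp.
exists (map swap t); split; first exact: chain_swapV ch.
move=> i Pm mQ; have [N Nt Nm] := H i (cr i Pm mQ).
by exists (swap N); rewrite ?(map_f swap Nt).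
Qed.

End All.
End Refinement.

End Cells.

(** * Generic chains of nodes *)

Section Generic.
Context {d : Order.disp_t} {E : orderType d} {I : Type}.
Hypothesis dense : forall x y : E, x < y -> exists z, x < z < y.
Variables (isL : E -> Prop) (sg : E -> int) (F G : I -> E -> E).
Hypotheses (tame : tame_family F G) (alt : alternating isL sg).
Local Notation node := (@node d E I).
Implicit Types (P Q N M : node) (s t : seq node).
Local Notation chain := (chain isL sg F).
Local Notation step := (step isL sg F).
Local Notation good := (good isL sg F).

Definition below N M := [/\ N.1.1 < M.1.1, N.1.2 < M.1.2 &
  forall i, N.2 i <= M.2 i].

Lemma below_trans N M Q : below N M -> below M Q -> below N Q.
Proof.
move=> [h1 h2 h3] [k1 k2 k3]; split=> [||i].
- exact: lt_trans k1.
- exact: lt_trans k2.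
- exact: le_trans (k3 i).
Qed.

Lemma step_below P Q : step P Q -> below P Q.
Proof.
case=> _ _ [l [l' [[h1 h2 [_ _ /ltW ll' _] H] _]]]; split=> // i.
by case: (H i) => [[->]|[-> ->]].
Qed.

Lemma chain_below P s N : chain P s -> N \in s -> below P N.
Proof.
elim: s P => [//|Q s IH] P [/step_below PQ ch]; rewrite inE => /orP[/eqP->//|Ns].
exact: below_trans PQ (IH _ ch Ns).
Qed.

Lemma chain_last P s N : chain P s -> N \in P :: s ->
  N = last P s \/ below N (last P s).
Proof.
elim: s P N => [|Q s IH] P N /=.
  by move=> _; rewrite inE => /eqP->; left.
move=> [st ch]; rewrite inE => /orP[/eqP->|]; last exact: IH.
right; have PQ := step_below st.
by have [<-//|h] := IH _ _ ch (mem_head _ _); apply: below_trans h.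
Qed.

Lemma chain_comparable P s N M : chain P s -> N \in P :: s -> M \in P :: s ->
  [\/ N = M, below N M | below M N].
Proof.
elim: s P => [|Q s IH] P.
  by move=> _; rewrite !inE => /eqP-> /eqP->; constructor 1.
move=> ch; rewrite ![in X in X -> _]inE => /orP[/eqP->|Ns].
  move=> /orP[/eqP->|Ms]; first by constructor 1.
  by constructor 2; apply: chain_below ch Ms.
move=> /orP[/eqP->|Ms]; last by apply: IH Ns Ms; case: ch.
by constructor 3; apply: chain_below ch Ns.
Qed.

Lemma chain_good P s N : good P -> chain P s -> N \in P :: s -> good N.
Proof.
elim: s P => [|Q s IH] P gP; first by move=> _; rewrite inE => /eqP->.
by move=> [[_ gQ _] ch]; rewrite inE => /orP[/eqP->//|]; apply: IH.
Qed.

(** Labels increase weakly along a chain, so equal labels at both ends are constant in between. A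
    step on which the label of [i] is constant is not a crossing one, as [l < l'], and hence is
    robust. *)
Lemma chain_link (r : node -> node -> Prop) P s N M i : chain P s ->
  (forall A B C, r A B -> r B C -> r A C) ->
  (forall A B, A \in P :: s -> B \in P :: s -> below A B -> A.2 i = B.2 i ->
     robust F i A.1 B.1 -> r A B) ->
  N \in P :: s -> M \in P :: s -> below N M -> N.2 i = M.2 i -> r N M.
Proof.
move=> + rtr; elim: s P N => [|Q s IH] P N.
  move=> _ _; rewrite !inE => /eqP-> /eqP-> [].
  by rewrite ltxx.
move=> /[dup] ch [st ch'] H; rewrite [in X in X -> _]inE => /orP[/eqP->|Ns];
    rewrite [in X in X -> _]inE => /orP[/eqP->|Ms].
- by case; rewrite ltxx.
- move=> bl e; have [_ _ PQ] := step_below st.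
  have QM : Q = M \/ below Q M.
    move: Ms; rewrite inE => /orP[/eqP->|Ms]; first by left.
    by right; apply: chain_below ch' Ms.
  have PQi : P.2 i = Q.2 i.
    apply: le_anti; rewrite PQ /= e.
    by case: QM => [->|[_ _]].
  have rPQ : r P Q.
    apply: H; rewrite ?inE ?eqxx ?orbT //; first exact: step_below.
    case: st => _ _ [l [l' [[_ _ [_ _ ll' _] K] _]]].
    case: (K i) => [[]//|[e1 e2]].
    by move: ll'; rewrite -e1 -e2 PQi ltxx.
  case: QM => [<-//|bQ]; apply: rtr rPQ _.
  apply: (IH Q Q ch') => //; rewrite ?mem_head -?PQi //.
  by move=> A B As Bs; apply: H; rewrite inE ?As ?Bs orbT.
- move=> [lt _ _]; have [lt' _ _] := chain_below ch Ns.
  by have := lt_trans lt lt'; rewrite ltxx.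
- by apply: (IH Q N ch') => // A B As Bs; apply: H; rewrite inE ?As ?Bs orbT.
Qed.

Lemma chain_dom P s q : chain P s -> P.1.1 < q -> q < (last P s).1.1 ->
  exists s', [/\ chain P s', {subset s <= s'}, last P s' = last P s &
    exists2 N, N \in s' & N.1.1 = q].
Proof.
elim: s P => [|Q s IH] P /=.
  by move=> _ h1 h2; have := lt_trans h1 h2; rewrite ltxx.
move=> [st ch] Pq ql; case: (ltgtP q Q.1.1) => [qQ|Qq|qQ].
- have [t [ct [N Nt Nq]]] := refine_dom dense tame st Pq qQ.
  exists (t ++ Q :: s); rewrite last_cat; split=> //.
  + by rewrite -cat_rcons chain_cat last_rcons.
  + by move=> M Ms; rewrite mem_cat Ms orbT.
  + by exists N; rewrite // mem_cat Nt.
- have [s' [ch' sub lst [N Ns Nq]]] := IH _ ch Qq ql.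
  exists (Q :: s'); split=> //; last by exists N; rewrite // inE Ns orbT.
  by move=> M; rewrite !inE => /orP[->//|/sub->]; rewrite orbT.
- by exists (Q :: s); split=> //; exists Q; rewrite ?mem_head.
Qed.

Lemma chain_ran P s q : chain P s -> P.1.2 < q -> q < (last P s).1.2 ->
  exists s', [/\ chain P s', {subset s <= s'}, last P s' = last P s &
    exists2 N, N \in s' & N.1.2 = q].
Proof.
elim: s P => [|Q s IH] P /=.
  by move=> _ h1 h2; have := lt_trans h1 h2; rewrite ltxx.
move=> [st ch] Pq ql; case: (ltgtP q Q.1.2) => [qQ|Qq|qQ].
- have [t [ct [N Nt Nq]]] := refine_ran dense tame st Pq qQ.
  exists (t ++ Q :: s); rewrite last_cat; split=> //.
  + by rewrite -cat_rcons chain_cat last_rcons.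
  + by move=> M Ms; rewrite mem_cat Ms orbT.
  + by exists N; rewrite // mem_cat Nt.
- have [s' [ch' sub lst [N Ns Nq]]] := IH _ ch Qq ql.
  exists (Q :: s'); split=> //; last by exists N; rewrite // inE Ns orbT.
  by move=> M; rewrite !inE => /orP[->//|/sub->]; rewrite orbT.
- by exists (Q :: s); split=> //; exists Q; rewrite ?mem_head.
Qed.

Lemma chain_lab P s m : chain P s -> isL m ->
  exists s', [/\ chain P s', {subset s <= s'}, last P s' = last P s &
    forall i, P.2 i < m -> m < (last P s).2 i ->
    exists2 N, N \in s' & N.2 i = m].
Proof.
move=> + Lm; elim: s P => [|Q s IH] P /=.
  move=> _; exists [::]; split=> // i h1 h2.
  by have := lt_trans h1 h2; rewrite ltxx.
move=> [st ch]; have [s' [ch' sub lst H]] := IH _ ch.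
have [t [ct K]] := refine_lab dense tame alt st Lm.
exists (t ++ Q :: s'); rewrite last_cat; split=> //.
- by rewrite -cat_rcons chain_cat last_rcons.
- move=> M; rewrite mem_cat !inE => /orP[->|/sub->]; by rewrite ?orbT.
move=> i Pm ml; case: (ltgtP m (Q.2 i)) => [mQ|Qm|mQ].
- by have [N Nt Nm] := K i Pm mQ; exists N; rewrite // mem_cat Nt.
- by have [N Nt Nm] := H i Qm ml; exists N; rewrite // mem_cat inE Nt !orbT.
- by exists Q; rewrite // mem_cat mem_head orbT.
Qed.

(** One element serves as abscissa, as ordinate and as label, so that a single enumeration of [E]
    drives the construction. *)
Lemma chain_refine P s e : chain P s ->
  exists s', [/\ chain P s', {subset s <= s'}, last P s' = last P s &
   [/\ P.1.1 < e -> e < (last P s).1.1 -> exists2 N, N \in s' & N.1.1 = e,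
       P.1.2 < e -> e < (last P s).1.2 -> exists2 N, N \in s' & N.1.2 = e &
       isL e -> forall i, P.2 i < e -> e < (last P s).2 i ->
         exists2 N, N \in s' & N.2 i = e]].
Proof.
move=> ch.
have [s1 [ch1 sub1 l1 H1]] : exists s', [/\ chain P s', {subset s <= s'},
    last P s' = last P s & P.1.1 < e -> e < (last P s).1.1 ->
    exists2 N, N \in s' & N.1.1 = e].
  have [/andP[h1 h2]|/negP nh] := boolP (P.1.1 < e < (last P s).1.1).
    by have [s' [? ? ? ?]] := chain_dom ch h1 h2; exists s'.
  by exists s; split=> // h1 h2; case: nh; rewrite h1.
have [s2 [ch2 sub2 l2 H2]] : exists s', [/\ chain P s', {subset s1 <= s'},
    last P s' = last P s & P.1.2 < e -> e < (last P s).1.2 ->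
    exists2 N, N \in s' & N.1.2 = e].
  have [/andP[h1 h2]|/negP nh] := boolP (P.1.2 < e < (last P s1).1.2).
    have [s' [? ? l' ?]] := chain_ran ch1 h1 h2; exists s'; split=> //.
    by rewrite l'.
  by exists s1; split=> // h1 h2; case: nh; rewrite h1 l1.
have [s3 [ch3 sub3 l3 H3]] : exists s', [/\ chain P s', {subset s2 <= s'},
    last P s' = last P s & isL e -> forall i, P.2 i < e -> e < (last P s).2 i ->
         exists2 N, N \in s' & N.2 i = e].
  have [Le|nL] := pselect (isL e).
    have [s' [? ? l' H]] := chain_lab ch2 Le; exists s'; split=> //.
      by rewrite l'.
    by move=> _; rewrite -l2.
  by exists s2; split=> // /nL.
exists s3; split=> //; first by move=> N /sub1/sub2/sub3.
split=> //.
- by move=> h1 h2; have [N /sub2/sub3 ? ?] := H1 h1 h2; exists N.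
- by move=> h1 h2; have [N /sub3 ? ?] := H2 h1 h2; exists N.
Qed.

(** The limit is the union of the nested chains and has no steps of its own. The last clause
    quantifies over [r] in order to carry to the limit whatever robustness yields along the finite
    chains. *)
Theorem generic_chain (enum : nat -> E) P s0 :
  (forall x, exists n, enum n = x) -> good P -> chain P s0 ->
  exists A : node -> Prop,
   [/\ A P /\ A (last P s0),
       forall x, P.1.1 < x -> x < (last P s0).1.1 -> exists2 N, A N & N.1.1 = x,
       forall y, P.1.2 < y -> y < (last P s0).1.2 -> exists2 N, A N & N.1.2 = y,
       forall m, isL m -> forall i, P.2 i < m -> m < (last P s0).2 i ->
         exists2 N, A N & N.2 i = m &
   [/\ forall N, A N -> good N,
       forall N, A N -> N = last P s0 \/ below N (last P s0),
       forall N M, A N -> A M -> [\/ N = M, below N M | below M N] &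
       forall (r : node -> node -> Prop) i N M,
         (forall A B C, r A B -> r B C -> r A C) ->
         (forall B C, A B -> A C -> below B C -> B.2 i = C.2 i ->
           robust F i B.1 C.1 -> r B C) ->
         A N -> A M -> below N M -> N.2 i = M.2 i -> r N M]].
Proof.
move=> enumP gP ch0.
pose T := {s : seq node | chain P s /\ last P s = last P s0}.
have nxt (st : T) n : {st' : T | {subset sval st <= sval st'} /\
  let e := enum n in
   [/\ P.1.1 < e -> e < (last P s0).1.1 ->
         exists2 N, N \in sval st' & N.1.1 = e,
       P.1.2 < e -> e < (last P s0).1.2 ->
         exists2 N, N \in sval st' & N.1.2 = e &
       isL e -> forall i, P.2 i < e -> e < (last P s0).2 i ->
         exists2 N, N \in sval st' & N.2 i = e]}.
  apply: cid; case: st => s [ch l].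
  have [s' [ch' sub l' H]] := chain_refine (enum n) ch.
  have h : chain P s' /\ last P s' = last P s0 by rewrite l'.
  by exists (exist _ s' h); split=> //=; rewrite -l.
pose S := fix S n : T :=
  if n is n'.+1 then sval (nxt (S n') n') else exist _ s0 (conj ch0 erefl).
pose A N := exists n, N \in P :: sval (S n).
have mono1 n : {subset sval (S n) <= sval (S n.+1)}.
  by rewrite /=; case: (nxt _ _) => ? [].
have mono n m : (n <= m)%N -> {subset P :: sval (S n) <= P :: sval (S m)}.
  move/subnKC <-; elim: (m - n)%N => [|k IH] N; first by rewrite addn0.
  move=> /IH; rewrite addnS !inE => /orP[->//|/mono1 ->].
  by rewrite orbT.
have chS n : chain P (sval (S n)) by case: (S n) => ? [].
have lS n : last P (sval (S n)) = last P s0 by case: (S n) => ? [].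
have common N M : A N -> A M ->
    exists n, N \in P :: sval (S n) /\ M \in P :: sval (S n).
  move=> [n Nn] [m Mm]; exists (maxn n m); split.
    by apply: mono Nn; rewrite leq_maxl.
  by apply: mono Mm; rewrite leq_maxr.
exists A; split.
- by split; exists 0%N; rewrite ?mem_head // mem_last.
- move=> x; have [n <-] := enumP x => h1 h2.
  have [] := svalP (nxt (S n) n) => _ /= [/(_ h1 h2)[N Ns Nx] _ _].
  by exists N => //; exists n.+1; rewrite inE Ns orbT.
- move=> x; have [n <-] := enumP x => h1 h2.
  have [] := svalP (nxt (S n) n) => _ /= [_ /(_ h1 h2)[N Ns Nx] _].
  by exists N => //; exists n.+1; rewrite inE Ns orbT.
- move=> x; have [n <-] := enumP x => Lx i h1 h2.
  have [] := svalP (nxt (S n) n) => _ /= [_ _ /(_ Lx i h1 h2)[N Ns Nx]].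
  by exists N => //; exists n.+1; rewrite inE Ns orbT.
split.
- by move=> N [n Nn]; apply: chain_good Nn.
- by move=> N [n Nn]; rewrite -(lS n); apply: chain_last.
- by move=> N M AN AM; have [n [? ?]] := common _ _ AN AM; apply: chain_comparable (chS n) _ _.
- move=> r i N M rtr H AN AM; have [n [Nn Mn]] := common _ _ AN AM.
  apply: (chain_link (chS n)) => // B C Bn Cn; apply: H; by exists n.
Qed.


(** * The initial chain through the labels of sign zero *)

Section Initial.
Variable i0 : I.

Definition zero_label z := [/\ isL z, sg z = 0%R & forall i, F i z = F i0 z].

Definition zero_node z : node := ((z, F i0 z), fun=> z).

Lemma good_zero z : zero_label z -> good (zero_node z).
Proof. by case=> Lz sz Fz i /=; split; rewrite ?sz ?Fz ?ltxx. Qed.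

(** Two labels of sign zero do not form a step, whence the node in the middle. All members agree at
    both ends and take finitely many values over [x], so a height above all of them, or below all of
    them, is available. *)
Lemma zero_chain1 a b m : zero_label a -> zero_label b -> a < m -> m < b ->
  isL m -> (forall k, isL k -> a < k -> k < b -> sg k != 0%R) ->
  exists N, step (zero_node a) N /\ step N (zero_node b).
Proof.
move=> za zb am mb Lm nz; have [FK GK Flt Ff Gf] := tame.
have [La sa Fa] := za; have [Lb sb Fb] := zb.
have sm := nz m Lm am mb.
have [x /andP[ax xb]] := dense (lt_trans am mb).
have [s Fs] := Ff x.
have Fab : F i0 a < F i0 b by rewrite Flt (lt_trans am).
suff [y [ay yb gN]] : exists y, [/\ F i0 a < y, y < F i0 b &
    good ((x, y), fun=> m)].
  exists ((x, y), fun=> m); split; split=> //; try exact: good_zero.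
    exists a, m; split; last exact: differ0.
    split=> //=; last by move=> i; right.
    by split=> // k Lk ak km; apply: nz => //; apply: lt_trans mb.
  exists m, b; split; last exact: differr0.
  split=> //=; last by move=> i; right.
  by split=> // k Lk mk kb; apply: nz => //; apply: lt_trans mk.
move: sm; rewrite neq_lt => /orP[sm|sm].
  have [y [yb ay ys]] := just_below dense s Fab.
  exists y; split=> // i /=.
  have h : F i x < y by apply: ys => //; rewrite -(Fb i) Flt.
  by split=> //; rewrite ?h ?sm // (lt_gtF h) (lt_gtF sm).
have [y [ay yb ys]] := just_above dense s Fab.
exists y; split=> // i /=.
have h : y < F i x by apply: ys => //; rewrite -(Fa i) Flt.
by split=> //; rewrite ?h ?sm // (lt_gtF h) (lt_gtF sm).
Qed.

Lemma zero_chain a zs :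
  (forall x y, zero_label x -> zero_label y -> x < y ->
    exists2 m, isL m & x < m < y) ->
  zero_label a -> (forall z, z \in zs -> zero_label z) -> path <%O a zs ->
  (forall m, isL m -> a < m -> m < last a zs -> sg m = 0%R -> m \in zs) ->
  exists s, chain (zero_node a) s /\
    last (zero_node a) s = zero_node (last a zs).
Proof.
move=> between; elim: zs a => [|b zs IH] a za zzs; first by exists [::].
move=> /= /andP[ab pb] H.
have zb : zero_label b by apply: zzs; rewrite mem_head.
have bzs z : z \in zs -> b < z.
  by move=> zz; have /allP/(_ z zz) := order_path_min lt_trans pb.
have bl : b <= last b zs.
  have := mem_last b zs; rewrite inE => /orP[/eqP->//|/bzs].
  exact: ltW.
have [m Lm /andP[am mb]] := between a b za zb ab.
have [|N [st1 st2]] := @zero_chain1 a b m za zb am mb Lm.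
  move=> k Lk ak kb; apply/eqP => sk.
  have := H k Lk ak (lt_le_trans kb bl) sk; rewrite inE => /orP[/eqP kb'|/bzs bk].
    by move: kb; rewrite kb' ltxx.
  by have := lt_trans kb bk; rewrite ltxx.
have [||s [ch l]] := IH b zb _ pb.
- by move=> z zz; apply: zzs; rewrite inE zz orbT.
- move=> k Lk bk kl sk; have := H k Lk (lt_trans ab bk) kl sk.
  by rewrite inE => /orP[/eqP kb|//]; move: bk; rewrite kb ltxx.
by exists (N :: zero_node b :: s).
Qed.
End Initial.

End Generic.

Local Close Scope order_scope.
Local Open Scope ring_scope.
Local Open Scope classical_set_scope.

(** * Orbitals and conjugacy *)

Lemma autQ_lt (f : autQ) : {mono f : x y / x < y}.
Proof. exact: leW_mono (le_mono (@autQ_homo f)). Qed.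

Lemma autQ_le (f : autQ) : {mono f : x y / x <= y}.
Proof. exact: le_mono (@autQ_homo f). Qed.

Lemma autQ_mulE (f g : autQ) x : (f * g)%g x = f (g x).
Proof. by []. Qed.

Lemma autQ_invK (f : autQ) x : f^-1%g (f x) = x.
Proof. exact: autQK. Qed.

Lemma autQ_invVK (f : autQ) x : f (f^-1%g x) = x.
Proof. exact: autQVK. Qed.

Lemma autQ_lt_inv (f : autQ) x y : (f^-1%g x < y) = (x < f y).
Proof. by rewrite -(autQ_lt f) autQ_invVK. Qed.

Lemma autQ_inv_lt (f : autQ) x y : (y < f^-1%g x) = (f y < x).
Proof. by rewrite -(autQ_lt f) autQ_invVK. Qed.

Lemma autQ_of_graph (r : rat -> rat -> Prop) :
  (forall x, exists y, r x y) -> (forall y, exists x, r x y) ->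
  (forall x y x' y', r x y -> r x' y' -> (x < x') = (y < y')) ->
  exists k : autQ, forall x y, r x y <-> y = k x.
Proof.
move=> tot sur ord; pose k x := sval (cid (tot x)).
have rk x : r x (k x) by rewrite /k; case: cid.
have uni x y x' y' : r x y -> r x' y' -> (x = x') <-> (y = y').
  move=> h h'; have a := ord _ _ _ _ h h'; have b := ord _ _ _ _ h' h.
  split=> e; move: a b; rewrite e !ltxx.
    by case: (ltgtP y y').
  by case: (ltgtP x x').
have kh : {homo k : x y / x < y} by move=> x y xy; rewrite -(ord x _ y _).
have kb : bijective k.
  pose k' y := sval (cid (sur y)).
  have rk' y : r (k' y) y by rewrite /k'; case: cid.
  exists k' => x; first by apply/(uni _ (k x) _ (k x)).
  by apply/(uni (k' x) _ (k' x) _).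
exists (AutQ kh kb) => x y; split=> [h|->]; last exact: rk.
by apply/(uni x _ x _) => //; exact: rk.
Qed.

(** * Integer powers and orbitals *)

Definition zpow (f : autQ) (n : int) : autQ :=
  match n with Posz n => (f ^+ n)%g | Negz n => (f ^- n.+1)%g end.

Lemma zpow0 f : zpow f 0 = 1%g. Proof. exact: expg0. Qed.

Lemma zpow1 f : zpow f 1 = f. Proof. exact: expg1. Qed.

Lemma zpowS f n : zpow f (n + 1) = (f * zpow f n)%g.
Proof.
case: n => n; first by rewrite -PoszD addn1 /= expgS.
rewrite NegzE; case: n => [|n].
  by rewrite addNr /= expg0 expg1 mulgV.
have -> : - n.+2%:Z + 1 = Negz n by rewrite NegzE; lia.
by rewrite /= [in RHS]expgSr invgM mulVKg.
Qed.

Lemma zpowP f n : zpow f (n - 1) = (f^-1 * zpow f n)%g.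
Proof. by rewrite -[in RHS](subrK 1 n) zpowS mulKg. Qed.

Lemma zpowD f m n : zpow f (m + n) = (zpow f m * zpow f n)%g.
Proof.
elim/int_rec: m => [|m IH|m IH]; first by rewrite add0r zpow0 mul1g.
  have -> : m.+1%:Z + n = m%:Z + n + 1 by lia.
  by rewrite zpowS IH -addn1 PoszD zpowS mulgA.
have -> : - m.+1%:Z + n = - m%:Z + n - 1 by lia.
have -> : - m.+1%:Z = - m%:Z - 1 by lia.
by rewrite !zpowP IH mulgA.
Qed.

Lemma zpowN f n : zpow f (- n) = ((zpow f n)^-1)%g.
Proof. by apply/eqP; rewrite -mulg_eq1 -zpowD addNr zpow0. Qed.

Lemma zpowV f n : zpow f^-1%g n = zpow f (- n).
Proof. by rewrite zpowN; case: n => n /=; rewrite expVgn ?invgK. Qed.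

Lemma zpowDE f m n x : zpow f (m + n) x = zpow f m (zpow f n x).
Proof. by rewrite zpowD. Qed.

Lemma zpowSE f n x : zpow f (n + 1) x = f (zpow f n x).
Proof. by rewrite zpowS. Qed.

Lemma zpow_succ f n x : zpow f n (f x) = zpow f (n + 1) x.
Proof. by rewrite zpowDE zpow1. Qed.

(** This is membership in the convex hull of the orbit of [x]; independent integers [m] and [n]
    avoid distinguishing the direction in which [f] moves. *)
Definition same_orbital (f : autQ) x y :=
  exists m n, zpow f m x <= y /\ y <= zpow f n x.

Section Orbitals.
Variable f : autQ.
Local Notation O := (same_orbital f).

Lemma orbital_refl x : O x x.
Proof. by exists 0, 0; rewrite zpow0. Qed.

Lemma orbital_sym x y : O x y -> O y x.
Proof.
move=> [m [n [h1 h2]]]; exists (- n), (- m).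
rewrite -(autQ_le (zpow f n)) -zpowDE addrN zpow0; split=> //.
by rewrite -(autQ_le (zpow f m)) -zpowDE addrN zpow0.
Qed.

Lemma orbital_trans x y z : O x y -> O y z -> O x z.
Proof.
move=> [m [n [h1 h2]]] [m' [n' [h3 h4]]]; exists (m' + m), (n' + n).
rewrite !zpowDE; split.
  by apply: le_trans h3; rewrite autQ_le.
by apply: (le_trans h4); rewrite autQ_le.
Qed.

Lemma orbital_zpow n x : O x (zpow f n x).
Proof. by exists n, n. Qed.

Lemma orbital_convex x y z : O x y -> x <= z <= y -> O x z.
Proof.
move=> [m [n [h1 h2]]] /andP[xz zy]; exists 0, n; rewrite zpow0; split=> //.
exact: le_trans h2.
Qed.

Lemma orbital_convexV x y z : O x y -> y <= z <= x -> O x z.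
Proof.
move=> [m [n [h1 h2]]] /andP[xz zy]; exists m, 0; rewrite zpow0; split=> //.
exact: le_trans xz.
Qed.

(** The choice depends only on the class as a set, so it is the same for all its points; the default
    never matters, as the class is nonempty. *)
Definition orep x := xget x [set y | O x y].

Lemma orep_orbital x : O x (orep x).
Proof. by apply: (@xgetPex _ x [set y | O x y]); exists x; exact: orbital_refl. Qed.

Lemma orep_eq x y : O x y -> orep x = orep y.
Proof.
move=> xy; have e : [set z | O x z] = [set z | O y z].
  apply/seteqP; split=> z /= h; last exact: orbital_trans h.
  by apply: orbital_trans h; exact: orbital_sym.
rewrite /orep /xget e; case: pselect => // -[].
by exists y; apply/asboolP; exact: orbital_refl.
Qed.


Lemma orbital_lt x y u v : x < y -> ~ O x y -> O x u -> O y v -> u < v.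
Proof.
move=> xy nO xu yv; rewrite ltNge; apply/negP => vu.
have [vx|xv] := leP v x.
  by apply: nO; apply/orbital_sym/(orbital_convexV yv); rewrite vx ltW.
apply: nO; apply: (@orbital_trans x v); last exact: orbital_sym.
by apply: (orbital_convex xu); rewrite ltW.
Qed.

Lemma orep_homo x y : x <= y -> orep x <= orep y.
Proof.
move=> xy; have [Oxy|nO] := pselect (O x y); first by rewrite (orep_eq Oxy).
apply: ltW; apply: (@orbital_lt x y) => //; try exact: orep_orbital.
by rewrite lt_neqAle xy andbT; apply/eqP => e; apply: nO; rewrite e; exact: orbital_refl.
Qed.

Lemma orep_id x : orep (orep x) = orep x.
Proof. by rewrite -(orep_eq (orep_orbital x)). Qed.

End Orbitals.

Lemma same_orbitalV f x y : same_orbital f^-1%g x y <-> same_orbital f x y.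
Proof.
split=> -[m [n [h1 h2]]]; exists (- m), (- n); first by rewrite -!zpowV.
by rewrite !zpowV !opprK.
Qed.

Lemma zpow_orbit_homo (f : autQ) x : x < f x ->
  {homo (fun n => zpow f n x) : m n / m <= n}.
Proof.
move=> xf m n mn.
have -> : n = m + `|n - m|%N by lia.
elim: `|n - m|%N => [|k IH]; first by rewrite addr0.
apply: (le_trans IH); rewrite -addn1 PoszD addrA -zpow_succ autQ_le.
exact: ltW.
Qed.

Lemma orbital_fundamental (f : autQ) x y : x < f x -> same_orbital f x y ->
  exists n w, [/\ x <= w, w < f x & y = zpow f n w].
Proof.
move=> xf [m [n [my yn]]].
have ex : exists k : nat, y < zpow f (m + k%:Z + 1) x.
  exists `|n - m|%N; apply: (le_lt_trans yn).
  have le : n <= m + `|n - m|%N by lia.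
  by apply: (le_lt_trans (zpow_orbit_homo xf le)); rewrite -zpow_succ autQ_lt.
have [k yk kmin] := ex_minnP ex.
exists (m + k%:Z), (zpow f (- (m + k%:Z)) y).
rewrite -zpowDE addrN zpow0; split=> //.
  rewrite -(autQ_le (zpow f (m + k%:Z))) -zpowDE addrN zpow0.
  case: k {yk} kmin => [|k] kmin; first by rewrite addr0.
  rewrite leNgt; apply/negP => h; suff: (k < k)%N by rewrite ltnn.
  by apply: kmin; rewrite -addrA -PoszD addn1.
rewrite -(autQ_lt (zpow f (m + k%:Z))) -zpowDE addrN zpow0.
by rewrite zpow_succ.
Qed.

(** * Conjugating one orbital onto another *)

Definition affine (a b c d w : rat) := c + (w - a) / (b - a) * (d - c).

Lemma affineK a b c d : a < b -> c < d ->
  cancel (affine a b c d) (affine c d a b).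
Proof.
move=> ab cd w; rewrite /affine.
have ba : b - a != 0 by rewrite subr_eq0 gt_eqF.
have dc : d - c != 0 by rewrite subr_eq0 gt_eqF.
by field; rewrite ba dc.
Qed.

Lemma affine_lt a b c d : a < b -> c < d ->
  {mono affine a b c d : x y / x < y}.
Proof.
move=> ab cd x y; rewrite /affine ltrD2l ltr_pM2r ?subr_gt0 //.
by rewrite ltr_pM2r ?invr_gt0 ?subr_gt0 // ltrD2r.
Qed.

Lemma affineL a b c d : affine a b c d a = c.
Proof. by rewrite /affine subrr !mul0r addr0. Qed.

Lemma affineR a b c d : a < b -> affine a b c d b = d.
Proof.
move=> ab; rewrite /affine divff ?mul1r ?subrKC //.
by rewrite subr_eq0 gt_eqF.
Qed.

Section Piece.
(** The affine map between the fundamental domains from [a] to [f a] and from [b] to [g b], extended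
    equivariantly. Given as a graph, its inverse is the piece with the roles exchanged. *)
Definition piece (f g : autQ) a b x y := exists n w,
  [/\ a <= w < f a, x = zpow f n w & y = zpow g n (affine a (f a) b (g b) w)].

Implicit Types f g : autQ.

Lemma affine_fundamental f g a b w : a < f a -> b < g b -> a <= w < f a ->
  b <= affine a (f a) b (g b) w < g b.
Proof.
move=> af bg /andP[aw wf]; apply/andP; split.
  by rewrite -[leLHS](affineL a (f a) b (g b)) leNgt affine_lt // -leNgt.
by rewrite -[ltRHS](affineR b (g b) af) affine_lt.
Qed.

Lemma pieceC f g a b x y : a < f a -> b < g b ->
  piece f g a b x y -> piece g f b a y x.
Proof.
move=> af bg [n [w [wa -> ->]]].
exists n, (affine a (f a) b (g b) w); split=> //.
  exact: affine_fundamental.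
by rewrite affineK.
Qed.

Lemma piece_total f g a b x : a < f a -> same_orbital f a x ->
  exists y, piece f g a b x y.
Proof.
move=> af ax; have [n [w [h1 h2 ->]]] := orbital_fundamental af ax.
by eexists; exists n, w; split=> //; apply/andP.
Qed.

Lemma piece_homo f g a b x y x' y' : a < f a -> b < g b ->
  piece f g a b x y -> piece f g a b x' y' -> x < x' -> y < y'.
Proof.
move=> af bg [n [w [wa -> ->]]] [n' [w' [wa' -> ->]]].
have := affine_fundamental af bg wa; have := affine_fundamental af bg wa'.
set v := affine _ _ _ _ w; set v' := affine _ _ _ _ w' => /andP[bv' v'g] /andP[bv vg].
move: wa wa' => /andP[aw wf] /andP[aw' wf'].
have sep (h : autQ) c u u' (k k' : int) : c < h c -> c <= u' -> u < h c -> k < k' ->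
    zpow h k u < zpow h k' u'.
  move=> ch cu' uh kk'; apply: (@lt_le_trans _ _ (zpow h k (h c))).
    by rewrite autQ_lt.
  rewrite zpow_succ; apply: (@le_trans _ _ (zpow h k' c)); last by rewrite autQ_le.
  by apply: zpow_orbit_homo => //; lia.
case: (ltgtP n n') => [nn'|nn'|->].
- by move=> _; apply: (sep _ b).
- by move=> h; have := lt_trans h (sep _ a _ _ _ _ af aw wf' nn'); rewrite ltxx.
- by rewrite !autQ_lt /v /v' affine_lt.
Qed.

Lemma piece_orbital f g a b x y : a < f a -> piece f g a b x y ->
  same_orbital f a x.
Proof.
move=> af [n [w [/andP[aw wf] -> _]]]; exists n, (n + 1).
by rewrite -zpow_succ !autQ_le; split=> //; apply: ltW.
Qed.

Lemma piece_comm f g a b x y : piece f g a b x y -> piece f g a b (f x) (g y).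
Proof. by move=> [n [w [h -> ->]]]; exists (n + 1), w; rewrite !zpowSE. Qed.

Lemma piece_commV f g a b x y : piece f g a b x y ->
  piece f g a b (f^-1%g x) (g^-1%g y).
Proof.
by move=> [n [w [h -> ->]]]; exists (n - 1), w; rewrite !zpowP.
Qed.
End Piece.

(** The labelling induces an order isomorphism between the orbitals of [g] and those of [f] that
    respects directions. Equivariant bijections of matching orbitals then glue to an
    automorphism. *)
Theorem conj_of_labels (f g : autQ) (e : rat -> rat) :
  {homo e : x y / x <= y} ->
  (forall x y, e x = e y -> same_orbital g x y) ->
  (forall x, orep f (e x) = e x) ->
  (forall l, orep f l = l -> exists x, e x = l) ->
  (forall x, (x < g x) = (e x < f (e x))) ->
  (forall x, (g x < x) = (f (e x) < e x)) ->
  (forall x, e (g x) = e x) ->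
  exists k : autQ, forall x, k (f x) = g (k x).
Proof.
move=> emono eorb erep esurj epos eneg eg.
have ez n x : e (zpow g n x) = e x.
  elim/int_rec: n => [|n IH|n IH]; first by rewrite zpow0.
    by rewrite -addn1 PoszD zpowSE eg.
  have -> : - n.+1%:Z = - n%:Z - 1 by lia.
  by rewrite zpowP -[RHS]IH -[in RHS](autQ_invVK g (zpow g (- n%:Z) x)) eg.
have orbe x y : same_orbital g x y -> e x = e y.
  move=> [m [n [h1 h2]]]; apply: le_anti.
  by rewrite -{1}(ez m x) emono //= -(ez n x) emono.
have basex l : exists b, orep f l = l -> e b = l.
  have [/esurj[x <-]|h] := pselect (orep f l = l); first by exists x.
  by exists 0 => /h.
pose b l := sval (cid (basex l)).
have bE l : orep f l = l -> e (b l) = l by rewrite /b; case: cid.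
(* Pieces require an upward movement, so on orbitals moved down they are formed for the inverses; an
   orbital of sign zero is a single fixed point. *)
pose r x y := let a := orep f x in
  [\/ a < f a /\ piece f g a (b a) x y,
      f a < a /\ piece f^-1%g g^-1%g a (b a) x y |
      [/\ f a = a, x = a & y = b a]].
have ba a : orep f a = a -> (b a < g (b a)) = (a < f a) /\
                            (g (b a) < b a) = (f a < a).
  by move=> h; rewrite epos eneg bE.
have ltV (h : autQ) c : (c < h^-1%g c) = (h c < c).
  by rewrite autQ_inv_lt.
have re x y : r x y -> e y = orep f x.
  move=> h; have oa := orep_id f x; rewrite -(bE _ oa); apply/esym.
  have [pb nb] := ba _ oa.
  case: h => [[s p]|[s p]|[_ _ ->//]]; apply: orbe.
    by apply: (piece_orbital (f := g)); [rewrite pb|apply: pieceC p => //; rewrite pb].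
  apply/same_orbitalV; apply: (piece_orbital (f := g^-1%g)); first by rewrite ltV nb.
  by apply: pieceC p; rewrite ltV // nb.
have rcmp x y x' y' : r x y -> r x' y' -> orep f x = orep f x' ->
    (x < x') = (y < y').
  move=> + + aa; rewrite /r -aa; set a := orep f x.
  have oa : orep f a = a by exact: orep_id.
  have [pb nb] := ba _ oa.
  case=> [[s p]|[s p]|[s p1 p2]] [[s' p']|[s' p']|[s' p1' p2']].
  - have s2 : b a < g (b a) by rewrite pb.
    apply/idP/idP; first exact: piece_homo p p'.
    by apply: piece_homo (pieceC s s2 p) (pieceC s s2 p').
  - by have := lt_trans s s'; rewrite ltxx.
  - by move: s; rewrite s' ltxx.
  - by have := lt_trans s s'; rewrite ltxx.
  - have s1 : a < f^-1%g a by rewrite ltV.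
    have s2 : b a < g^-1%g (b a) by rewrite ltV nb.
    apply/idP/idP; first exact: piece_homo p p'.
    by apply: piece_homo (pieceC s1 s2 p) (pieceC s1 s2 p').
  - by move: s; rewrite s' ltxx.
  - by move: s'; rewrite s ltxx.
  - by move: s'; rewrite s ltxx.
  - by rewrite p1 p1' p2 p2' !ltxx.
have rord x y x' y' : r x y -> r x' y' -> (x < x') = (y < y').
  move=> h h'; have [aa|naa] := eqVneq (orep f x) (orep f x').
    exact: rcmp h h' aa.
  have sgn u u' v v' : r u v -> r u' v' -> orep f u != orep f u' -> u < u' -> v < v'.
    move=> k k' ne uu'; rewrite ltNge; apply/negP => /emono.
    by rewrite (re _ _ k) (re _ _ k') leNgt lt_neqAle ne orep_homo // ltW.
  have ynot : y != y'.
    by apply/eqP => yy'; move: naa; rewrite -(re _ _ h) -(re _ _ h') yy' eqxx.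
  apply/idP/idP; first exact: sgn.
  move=> yy'; rewrite ltNge le_eqVlt; apply/negP => /orP[/eqP xx'|xx'].
    by move: naa; rewrite xx' eqxx.
  have := sgn _ _ _ _ h' h; rewrite eq_sym naa => /(_ erefl xx') /(lt_trans yy').
  by rewrite ltxx.
have [||k kE] := autQ_of_graph _ _ rord.
- move=> x; rewrite /r; set a := orep f x.
  have ax : same_orbital f a x by apply/orbital_sym/orep_orbital.
  case: (ltgtP a (f a)) => s.
  + by have [y p] := piece_total g (b a) s ax; exists y; constructor 1.
  + have s1 : a < f^-1%g a by rewrite ltV.
    have /same_orbitalV ax' := ax.
    by have [y p] := piece_total g^-1%g (b a) s1 ax'; exists y; constructor 2.
  + exists (b a); constructor 3; split=> //.
    have [m [n []]] := ax.
    have fz i : zpow f i a = a.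
      elim/int_rec: i => [|i IH|i IH]; first by rewrite zpow0.
        by rewrite -addn1 PoszD zpowSE IH.
      have -> : - i.+1%:Z = - i%:Z - 1 by lia.
      by rewrite zpowP /= IH {1}s autQ_invK.
    by rewrite !fz => h1 h2; apply: le_anti; rewrite h1 h2.
- move=> y; have oa := erep y; set a := e y in oa.
  have [pb nb] := ba _ oa.
  have by_ : same_orbital g (b a) y by apply: eorb; rewrite bE.
  have rpl x : same_orbital f a x -> orep f x = a by move=> /orep_eq <-.
  case: (ltgtP a (f a)) => s.
  + have s2 : b a < g (b a) by rewrite pb.
    have [x p] := piece_total f a s2 by_; have p' := pieceC s2 s p.
    exists x; rewrite /r rpl; last exact: piece_orbital p'.
    by constructor 1.
  + have s1 : a < f^-1%g a by rewrite ltV.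
    have s2 : b a < g^-1%g (b a) by rewrite ltV nb.
    have /same_orbitalV by2 := by_.
    have [x p] := piece_total f^-1%g a s2 by2; have p' := pieceC s2 s1 p.
    exists x; rewrite /r rpl; last by apply/same_orbitalV; exact: piece_orbital p'.
    by constructor 2.
  + exists a; rewrite /r oa; constructor 3; split=> //.
    have gb : g (b a) = b a.
      by apply: le_anti; rewrite !leNgt pb nb -s !ltxx.
    have [m [n []]] := by_.
    have fz i : zpow g i (b a) = b a.
      elim/int_rec: i => [|i IH|i IH]; first by rewrite zpow0.
        by rewrite -addn1 PoszD zpowSE IH.
      have -> : - i.+1%:Z = - i%:Z - 1 by lia.
      by rewrite zpowP /= IH -{1}gb autQ_invK.
    by rewrite !fz => h1 h2; apply: le_anti; rewrite h1 h2.
exists k => x; apply/esym/kE.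
have /kE : k x = k x by [].
rewrite /r; have -> : orep f (f x) = orep f x.
  by apply: orep_eq; apply: orbital_sym; have := orbital_zpow f 1 x; rewrite zpow1.
case=> [[s p]|[s p]|[s p1 p2]]; first by constructor 1; split=> //; exact: piece_comm.
  constructor 2; split=> //; have := piece_commV p.
  by rewrite !invgK.
constructor 3; rewrite p2; split=> //; first by rewrite {1}p1.
have [pb nb] := ba _ (orep_id f x).
by apply: le_anti; rewrite !leNgt pb nb s ltxx.
Qed.

(** * Catching a conjugacy class *)

Definition touching (f : autQ) := exists p q : rat,
  [/\ p < q, forall r, p <= r <= q -> r < f r & forall n, (f ^+ n)%g p < q].

Lemma orbital_pos (f : autQ) x y : same_orbital f x y -> x < f x -> y < f y.
Proof.
move=> xy xf; have [n [w [xw wf ->]]] := orbital_fundamental xf xy.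
rewrite -zpowSE -zpow_succ autQ_lt; apply: (lt_le_trans wf).
by rewrite autQ_le.
Qed.

Lemma orbital_neg (f : autQ) x y : same_orbital f x y -> f x < x -> f y < y.
Proof.
move=> /same_orbitalV xy; rewrite -autQ_inv_lt => /(orbital_pos xy).
by rewrite autQ_inv_lt.
Qed.

Lemma touching_orbital (f : autQ) x y : ~ touching f -> x < y ->
  (forall r, x <= r <= y -> r < f r) -> same_orbital f x y.
Proof.
move=> nt xy pos; have [n ynx] : exists n, y <= (f ^+ n)%g x.
  apply/not_existsP => H; apply: nt; exists x, y; split=> // n.
  by rewrite ltNge; apply/negP/H.
by exists 0, n; rewrite zpow0 ltW.
Qed.

Lemma fixed_orbital (f : autQ) x y : f x = x -> same_orbital f x y -> y = x.
Proof.
move=> fx [m [n []]].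
have fz i : zpow f i x = x.
  elim/int_rec: i => [|i IH|i IH]; first by rewrite zpow0.
    by rewrite -addn1 PoszD zpowSE IH.
  have -> : - i.+1%:Z = - i%:Z - 1 by lia.
  by rewrite zpowP /= IH -{1}fx autQ_invK.
by rewrite !fz => h1 h2; apply: le_anti; rewrite h1 h2.
Qed.

(** The infinite elements count as fixed points, which lets the chain run between two labels of sign
    zero. *)
Definition orbital_sign (f : autQ) (l : \bar rat) : int :=
  if l is x%:E%E then sgz (f x - x) else 0.

Definition orbital_label (f : autQ) (l : \bar rat) : Prop :=
  if l is x%:E%E then orep f x = x else True.

Lemma orbital_sign_gt0 f x : (0 < orbital_sign f x%:E) = (x < f x).
Proof. by rewrite /= sgz_gt0 subr_gt0. Qed.

Lemma orbital_sign_lt0 f x : (orbital_sign f x%:E < 0) = (f x < x).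
Proof. by rewrite /= sgz_lt0 subr_lt0. Qed.

(** If every point between two distinct orbitals were moved up, [f] would touch the identity there.
    So some point in between is not moved up, and the representative of its orbital is the required
    label. Downward orbitals use the inverse. *)
Lemma orbital_alternating (f : autQ) : ~ touching f -> ~ touching f^-1%g ->
  alternating (orbital_label f) (orbital_sign f).
Proof.
move=> nt ntV [x||] [y||] //; rewrite ?ltxx ?andbF //.
rewrite lte_fin !orbital_sign_gt0 !orbital_sign_lt0 => Lx Ly xy.
have nO : ~ same_orbital f x y.
  by move=> /orep_eq; rewrite Lx Ly => e; move: xy; rewrite e ltxx.
have mid r : x <= r <= y -> ~ same_orbital f x r -> ~ same_orbital f y r ->
    x < orep f r < y.
  move=> /andP[xr ry] xnr ynr; rewrite !lt_neqAle.
  have := orep_homo f xr; have := orep_homo f ry; rewrite Lx Ly => -> ->.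
  rewrite !andbT; apply/andP; split; apply/eqP => e.
    by apply: xnr; rewrite e; apply/orbital_sym/orep_orbital.
  by apply: ynr; rewrite -e; apply/orbital_sym/orep_orbital.
move=> /orP[]/andP[sx sy].
  have [r xry fr] : exists2 r, x <= r <= y & f r <= r.
    apply: contrapT => H; apply: nO; apply: touching_orbital => // r xry.
    by rewrite ltNge; apply/negP => fr; apply: H; exists r.
  have npr z : same_orbital f z r -> ~~ (z < f z).
    by move=> zr; apply/negP => /(orbital_pos zr); rewrite ltNge fr.
  have /andP[xm my] : x < orep f r < y.
    by apply: mid => // /npr; rewrite ?sx ?sy.
  exists (orep f r)%:E; split; rewrite ?lte_fin //; first exact: orep_id.
  rewrite orbital_sign_gt0 sx (negbTE (npr _ _)) //.
  exact/orbital_sym/orep_orbital.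
have [r xry fr] : exists2 r, x <= r <= y & r <= f r.
  apply: contrapT => H; apply: nO; apply/same_orbitalV.
  apply: touching_orbital => // r xry.
  by rewrite autQ_inv_lt ltNge; apply/negP => fr; apply: H; exists r.
have npr z : same_orbital f z r -> ~~ (f z < z).
  by move=> zr; apply/negP => /(orbital_neg zr); rewrite ltNge fr.
have /andP[xm my] : x < orep f r < y.
  by apply: mid => // /npr; rewrite ?sx ?sy.
exists (orep f r)%:E; split; rewrite ?lte_fin //; first exact: orep_id.
rewrite orbital_sign_lt0 sx (negbTE (npr _ _)) ?orbT //.
exact/orbital_sym/orep_orbital.
Qed.

Lemma ereal_dense (x y : \bar rat) : (x < y)%E -> exists z, (x < z < y)%O.
Proof.
case: x => [x||]; case: y => [y||] //.
- rewrite lte_fin => xy; exists ((x + y) / 2)%:E.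
  by rewrite !lte_fin !midf_lt.
- by move=> _; exists (x + 1)%:E; rewrite lte_fin ltrDl ltr01 ltry.
- by move=> _; exists (y - 1)%:E; rewrite lte_fin gtrDl ltrN10 ltNyr.
- by move=> _; exists 0%:E; rewrite ltNyr ltry.
Qed.

Lemma ereal_rat_enum :
  exists e : nat -> \bar rat, forall x, exists n, e n = x.
Proof.
pose dec (n : nat) : \bar rat :=
  match n with 0%N => -oo%E | 1%N => +oo%E
  | n.+2 => if unpickle n is Some q then q%:E%E else -oo%E end.
exists dec => -[x||]; [|by exists 1%N|by exists 0%N].
by exists (pickle x).+2; rewrite /= pickleK.
Qed.

(** The form in which compactness is used; inverses are included because the group is not closed
    among all self-maps of [rat]. *)
Definition pointwise_finite (K : set autQ) :=
  (forall x, exists s : seq rat, forall h, K h -> h x \in s) /\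
  (forall x, exists s : seq rat, forall h, K h -> h^-1%g x \in s).

Section Extended.
Variable K : set autQ.
Definition ext (i : {h | K h}) : \bar rat -> \bar rat := er_map (sval i).
Definition extV (i : {h | K h}) : \bar rat -> \bar rat :=
  er_map (sval i)^-1%g.

Lemma ext_tame : pointwise_finite K -> tame_family ext extV.
Proof.
move=> [fin finV]; split.
- by move=> i [x||] //=; rewrite autQ_invK.
- by move=> i [x||] //=; rewrite autQ_invVK.
- by move=> i [x||] [y||] //=; rewrite /ext /= ?lte_fin ?autQ_lt ?ltry ?ltNyr.
- move=> [x||]; [|by exists [:: +oo%E] => i; rewrite mem_head
    |by exists [:: -oo%E] => i; rewrite mem_head].
  have [s H] := fin x; exists (map EFin s) => -[h Kh].
  by apply: map_f; apply: H.
- move=> [x||]; [|by exists [:: +oo%E] => i; rewrite mem_head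
    |by exists [:: -oo%E] => i; rewrite mem_head].
  have [s H] := finV x; exists (map EFin s) => -[h Kh].
  by apply: map_f; apply: H.
Qed.
End Extended.

(** The abscissas and ordinates of a generic chain give [g]. For each [h] the labels of its nodes
    form a labelling of the orbitals of [g^-1 * h] as required by [conj_of_labels]. *)
Theorem catch_conjugates (f : autQ) (K : set autQ) (zs : seq rat) :
  ~ touching f -> ~ touching f^-1%g -> (forall x, f x = x <-> x \in zs) ->
  pointwise_finite K ->
  (forall z, z \in zs -> forall h h', K h -> K h' -> h z = h' z) ->
  exists g : autQ, forall h, K h -> conjugacy_class f (g^-1 * h)%g.
Proof.
move=> nt ntV zsE Kfin Kzs.
have [[h0 Kh0]|K0] := pselect (exists h, K h); last first.
  by exists 1%g => h Kh; case: K0; exists h.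
pose I := {h | K h}; pose i0 : I := exist _ h0 Kh0.
pose sg := orbital_sign f; pose isL := orbital_label f.
have tame := ext_tame Kfin.
have alt : alternating isL sg := orbital_alternating nt ntV.
have fixed_label x : f x = x -> orep f x = x.
  by move=> fx; apply: (fixed_orbital fx); exact: orep_orbital.
pose zero := zero_label isL sg (@ext K) i0.
have zero_fin x : x \in zs -> zero x%:E.
  move=> xz; have /zsE fx := xz; split; first exact: fixed_label.
    by rewrite /sg /= fx subrr.
  by move=> [h Kh]; rewrite /ext /=; congr EFin; exact: Kzs.
have zeroP x : zero x%:E -> f x = x.
  by case=> _ /eqP; rewrite /sg /= sgz_eq0 subr_eq0 => /eqP.
have zeroNy : zero -oo%E by [].
have zeroy : zero +oo%E by [].
pose us := sort <=%O (undup zs).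
have srt : sorted <%O us.
  by rewrite sort_lt_sorted undup_uniq.
have lastE (z : \bar rat) : last z (rcons (map EFin us) +oo%E) = +oo%E.
  by rewrite last_rcons.
(* The initial chain runs from -oo to +oo through the fixed points in increasing order; the label
   required between two of them is the orbital of any rational in between. *)
have [|||||s0 [ch0 l0]] := @zero_chain _ _ I ereal_dense isL sg (@ext K)
    (@extV K) tame i0 -oo%E (rcons (map EFin us) +oo%E).
- move=> x y zx zy xy.
  have [z /andP[xz zy']] := ereal_dense xy.
  have {z xz zy'}[z [xz zy']] : exists z : rat, (x < z%:E)%E /\ (z%:E < y)%E.
    case: z xz zy' => [z||] // xz zy'; first by exists z.
      by move: zy'; rewrite ltNge leey.
    by move: xz; rewrite ltNge leNye.
  exists (orep f z)%:E; first exact: orep_id.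
  apply/andP; split.
    case: x zx xz {xy} => [x /zeroP fx| _|_ _]; last by rewrite ltNyr.
      2: by rewrite ltNge leey.
    rewrite !lte_fin => xz; rewrite lt_neqAle -{2}(fixed_label _ fx).
    rewrite orep_homo ?ltW // andbT; apply/eqP => e; move: xz.
    by rewrite (@fixed_orbital f x z fx) ?ltxx // e; apply/orbital_sym/orep_orbital.
  case: y zy zy' {xy} => [y /zeroP fy| _ _|_]; last by rewrite ltNge leNye.
    2: by rewrite ltry.
  rewrite !lte_fin => yz; rewrite lt_neqAle -{2}(fixed_label _ fy).
  rewrite orep_homo ?ltW // andbT; apply/eqP => e; move: yz.
  by rewrite (@fixed_orbital f y z fy) ?ltxx // -e; apply/orbital_sym/orep_orbital.
- exact: zeroNy.
- move=> z; rewrite mem_rcons inE => /orP[/eqP->//|/mapP[x]].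
  by rewrite mem_sort mem_undup => xz ->; apply: zero_fin.
- rewrite rcons_path; apply/andP; split.
    move: srt; case: (us) => //= u us' pu; rewrite ltNyr /=.
    by rewrite path_map /=; apply: sub_path pu => x y.
  by case: (us) => [//|u us'] /=; rewrite last_map /= ltry.
- rewrite lastE => -[x||] // _ _ _ /eqP; rewrite /sg /= sgz_eq0 subr_eq0 => /eqP.
  move=> /zsE xz; rewrite mem_rcons inE; apply/orP; right; apply: map_f.
  by rewrite mem_sort mem_undup.
rewrite lastE in l0.
have [en enP] := ereal_rat_enum.
have [A [[AP AQ] Adom Aran Alab [Agood Alast Acmp Alink]]] :=
  generic_chain ereal_dense tame alt enP (good_zero zeroNy) ch0.
set P := zero_node _ _ _ in AP Adom Aran Alab.
rewrite l0 in AQ Adom Aran Alab Alast.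
set Q := zero_node _ _ _ in AQ Adom Aran Alab Alast.
have Pbelow N : A N -> N = P \/ below P N.
  move=> AN; have [->|[]|] := Acmp _ _ AN AP; [by left| |by right].
  by rewrite ltNge leNye.
have interior N : A N -> N <> P -> N <> Q ->
    exists x y, N.1 = (x%:E, y%:E) :> \bar rat * \bar rat.
  move=> AN NP NQ; have [//|[Px Py _]] := Pbelow N AN.
  have [//|[xQ yQ _]] := Alast N AN.
  case: N Px Py xQ yQ {AN NP NQ} => -[[x||] [y||]] la //= _ _ _ _.
  by exists x, y.
have nodex (x : rat) : exists N y, A N /\ N.1 = (x%:E, y%:E).
  have [||N AN Nx] := Adom x%:E; rewrite ?ltNyr ?ltry //.
  have [||x' [y' e]] := interior N AN; try by move=> NE; move: Nx; rewrite NE.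
  by exists N, y'; split=> //; move: Nx; rewrite e /= => -[->].
have nodey (y : rat) : exists N x, A N /\ N.1 = (x%:E, y%:E).
  have [||N AN Nx] := Aran y%:E; rewrite ?ltNyr ?ltry //.
  have [||x' [y' e]] := interior N AN; try by move=> NE; move: Nx; rewrite NE.
  by exists N, x'; split=> //; move: Nx; rewrite e /= => -[->].
pose r x y := exists N, A N /\ N.1 = (x%:E, y%:E) :> \bar rat * \bar rat.
have rord x y x' y' : r x y -> r x' y' -> (x < x') = (y < y').
  move=> [N [AN Ne]] [N' [AN' Ne']].
  have [NN|[]|[]] := Acmp _ _ AN AN'.
  - by move: Ne; rewrite NN Ne' => -[-> ->]; rewrite !ltxx.
  - by rewrite Ne Ne' /= !lte_fin => -> ->.
  - by rewrite Ne Ne' /= !lte_fin => h1 h2 _; rewrite (lt_gtF h1) (lt_gtF h2).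
have [||g gE] := autQ_of_graph _ _ rord.
- by move=> x; have [N [y H]] := nodex x; exists y, N.
- by move=> y; have [N [x H]] := nodey y; exists x, N.
exists g => h Kh; pose i : I := exist _ h Kh; pose f' := (g^-1 * h)%g.
(* A label of sign zero puts the node on the graph of [h], and a strictly increasing [h] then enters
   the rectangle, against robustness. So no two nodes share such a label. *)
have nonzero N M : A N -> A M -> below N M -> N.2 i = M.2 i -> sg (N.2 i) <> 0.
  apply: (Alink (fun N _ => sg (N.2 i) <> 0)) => // B C AB AC [xBC yBC _] _ rb s.
  have [_ s1 s2] := Agood B AB i.
  have eB : ext i B.1.1 = B.1.2 by apply: le_anti; rewrite !leNgt s1 s2 s ltxx.
  have [_ _ Flt _ _] := tame.
  case: rb; first by rewrite eB leNgt yBC.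
  by rewrite -eB leNgt Flt xBC.
(* The infinite labels have sign zero and already occur at [P] and [Q], so the other nodes carry
   rational labels. *)
have labP N : A N -> N <> P -> N <> Q -> exists l, N.2 i = l%:E.
  move=> AN NP NQ; have [//|PN] := Pbelow N AN; have [//|NQ'] := Alast N AN.
  case E : (N.2 i) => [l||]; first by exists l.
    have [_ _ _] := NQ'; move: (nonzero _ _ AN AQ NQ'); rewrite E.
    by move=> /(_ erefl erefl).
  by move: (nonzero _ _ AP AN PN); rewrite E => /(_ erefl erefl).
have nodeE x : {N | A N /\ N.1 = (x%:E, (g x)%:E)}.
  apply: cid; have /gE[N H] : g x = g x by [].
  by exists N.
pose nd x := sval (nodeE x).
have ndA x : A (nd x) by rewrite /nd; case: (nodeE x) => ? [].
have nd1 x : (nd x).1 = (x%:E, (g x)%:E) by rewrite /nd; case: (nodeE x) => ? [].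
have ndP x : nd x <> P by move=> e; have := nd1 x; rewrite e.
have ndQ x : nd x <> Q by move=> e; have := nd1 x; rewrite e.
pose e x := fine ((nd x).2 i).
have eE x : (nd x).2 i = (e x)%:E.
  by have [l le] := labP _ (ndA x) (@ndP x) (@ndQ x); rewrite /e le.
have ndE N x y : A N -> N.1 = (x%:E, y%:E) -> N = nd x.
  move=> AN N1; have [//|[]|[]] := Acmp _ _ AN (ndA x); by rewrite N1 nd1 ltxx.
have ndbelow x y : x < y -> below (nd x) (nd y).
  move=> xy; have [e0|//|[]] := Acmp _ _ (ndA x) (ndA y).
    by move: (nd1 x); rewrite e0 nd1 => -[yx]; move: xy; rewrite yx ltxx.
  by rewrite !nd1 /= lte_fin => /(lt_trans xy); rewrite ltxx.
have emono : {homo e : x y / x <= y}.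
  move=> x y; rewrite le_eqVlt => /orP[/eqP->//|/ndbelow[_ _ /(_ i)]].
  by rewrite !eE lee_fin.
have elt x y : e x < e y -> x < y.
  by rewrite !ltNge; apply: contra => /emono.
have f'lt x y : (x < f' y) = (g x < h y) by rewrite /f' autQ_inv_lt.
have f'gt x y : (f' y < x) = (h y < g x) by rewrite /f' autQ_lt_inv.
have epos x : (x < f' x) = (e x < f (e x)).
  rewrite f'lt; have [_ + _] := Agood _ (ndA x) i.
  by rewrite eE nd1 /sg orbital_sign_gt0 /ext /= lte_fin.
have eneg x : (f' x < x) = (f (e x) < e x).
  rewrite f'gt; have [_ _] := Agood _ (ndA x) i.
  by rewrite eE nd1 /sg orbital_sign_lt0 /ext /= lte_fin.
have erep x : orep f (e x) = e x.
  by have [] := Agood _ (ndA x) i; rewrite eE.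
have esurj l : orep f l = l -> exists x, e x = l.
  move=> Ll; have [||N AN Nl] := Alab l%:E Ll i; rewrite ?ltNyr ?ltry //.
  have [||x' [y' E]] := interior N AN; try by move=> NE; move: Nl; rewrite NE.
  by exists x'; rewrite /e -(ndE _ _ _ AN E) Nl.
have eorb x y : e x = e y -> same_orbital f' x y.
  have main u v : u < v -> e u = e v -> same_orbital f' u v.
    move=> uv euv.
    pose r' (N M : @node _ (\bar rat) I) :=
      same_orbital f' (fine N.1.1) (fine M.1.1).
    have := Alink r' i (nd u) (nd v).
    rewrite /r' !nd1 /=; apply=> //.
    - by move=> B C D; exact: orbital_trans.
    (* Robustness says that one application of [f'] or of its inverse carries one abscissa to or
       past the other, so both are in one orbital. *)
    - move=> B C AB AC BC eBC rb.
      have nBP : B <> P.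
        by move=> BP; move: (nonzero _ _ AB AC BC eBC); rewrite BP.
      have nCQ : C <> Q.
        by move=> CQ; move: (nonzero _ _ AB AC BC eBC); rewrite eBC CQ.
      have nBQ : B <> Q by move=> BQ; case: BC; rewrite BQ ltNge leey.
      have nCP : C <> P by move=> CP; case: BC; rewrite CP ltNge leNye.
      have [x1 [y1 B1]] := interior B AB nBP nBQ.
      have [x2 [y2 C1]] := interior C AC nCP nCQ.
      move: BC rb => [+ + _]; rewrite B1 C1 /= /robust /ext /= !lte_fin !lee_fin.
      have -> : y1 = g x1 by apply/gE; exists B.
      have -> : y2 = g x2 by apply/gE; exists C.
      move=> x12 y12 [rb|rb].
        exists 0, 1; rewrite zpow0 zpow1; split; first exact: ltW.
        by rewrite leNgt f'gt -leNgt.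
      apply/orbital_sym; exists 1, 0; rewrite zpow0 zpow1.
      by split; [rewrite leNgt f'lt -leNgt|exact: ltW].
    - exact: ndbelow.
    - by rewrite !eE euv.
  move=> exy; case: (ltgtP x y) => [xy|xy|->]; last exact: orbital_refl.
    exact: main.
  by apply: orbital_sym; apply: main.
(* If the label increased from [x] to [f' x], both would be positive and alternation would give a
   point [z] in between whose label is not positive. But [f' z] lies beyond [f' x], hence beyond
   [z]. *)
have eg x : e (f' x) = e x.
  case: (ltgtP x (f' x)) => xf.
  - have le1 : e x <= e (f' x) by apply: emono; exact: ltW.
    apply: le_anti; rewrite le1 andbT leNgt.
    apply/negP => ex.
    have px : e x < f (e x) by rewrite -epos.
    have pfx : e (f' x) < f (e (f' x)) by rewrite -epos autQ_lt.
    have [||[m||]] := @alt (e x)%:E (e (f' x))%:E (erep x) (erep _).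
    + by rewrite lte_fin.
    + by rewrite /sg !orbital_sign_gt0 px pfx.
    + rewrite /sg !lte_fin !orbital_sign_gt0 !orbital_sign_lt0.
      move=> [/esurj[z <-] xz zfx]; rewrite px (lt_gtF px) -epos -eneg.
      have nz : f' z < z -> False.
        move=> fz; have := elt _ _ xz; rewrite -(autQ_lt f') => h1.
        by have := lt_trans (lt_trans h1 fz) (elt _ _ zfx); rewrite ltxx.
      case: (ltgtP z (f' z)) => // h1.
      move=> _; have := elt _ _ xz; rewrite -(autQ_lt f') -h1 => h2.
      by have := lt_trans h2 (elt _ _ zfx); rewrite ltxx.
    + by move=> [_ _]; rewrite ltNge leey.
    + by move=> [_]; rewrite ltNge leNye.
  - have le1 : e (f' x) <= e x by apply: emono; exact: ltW.
    apply: le_anti; rewrite le1 /= leNgt.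
    apply/negP => ex.
    have px : f (e x) < e x by rewrite -eneg.
    have pfx : f (e (f' x)) < e (f' x) by rewrite -eneg autQ_lt.
    have [||[m||]] := @alt (e (f' x))%:E (e x)%:E (erep _) (erep x).
    + by rewrite lte_fin.
    + by rewrite /sg !orbital_sign_lt0 px pfx orbT.
    + rewrite /sg !lte_fin !orbital_sign_gt0 !orbital_sign_lt0.
      move=> [/esurj[z <-] fxz zx]; rewrite pfx (lt_gtF pfx) -epos -eneg.
      have nz : z < f' z -> False.
        move=> fz; have := elt _ _ zx; rewrite -(autQ_lt f') => h1.
        by have := lt_trans (lt_trans (elt _ _ fxz) fz) h1; rewrite ltxx.
      case: (ltgtP z (f' z)) => // h1.
      move=> _; have := elt _ _ zx; rewrite -(autQ_lt f') -h1 => h2.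
      by have := lt_trans (elt _ _ fxz) h2; rewrite ltxx.
    + by move=> [_ _]; rewrite ltNge leey.
    + by move=> [_]; rewrite ltNge leNye.
  - by rewrite -xf.
have [k kE] := conj_of_labels emono eorb erep esurj epos eneg eg.
exists k^-1%g => //; rewrite conjgE invgK mulgA.
apply: autQ_eq => x /=.
by rewrite -[in RHS](autQ_invVK k x); exact: kE.
Qed.

(** * Borel sets of automorphisms *)

Lemma count_bigcup_measurable d (T : measurableType d) (U : countType)
    (P : set U) (F : U -> set T) :
  (forall i, P i -> measurable (F i)) -> measurable (\bigcup_(i in P) F i).
Proof.
move=> mF; rewrite bigcup_mkcond; apply: countable_bigcupT_measurable => // i.
by case: ifPn => // /set_mem /mF.
Qed.

Lemma count_bigcap_measurable d (T : measurableType d) (U : countType)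
    (P : set U) (F : U -> set T) :
  (forall i, P i -> measurable (F i)) -> measurable (\bigcap_(i in P) F i).
Proof.
move=> mF; rewrite -[X in measurable X]setCK setC_bigcap; apply: measurableC.
by apply: count_bigcup_measurable => i /mF; exact: measurableC.
Qed.

Definition cylinder (s : seq (rat * rat)) : set autQ :=
  [set f | forall p, p \in s -> f p.1 = p.2].

Lemma autQ_nbhs_cylinder (f : autQ) (U : set autQ) : nbhs f U ->
  exists s : seq rat, forall g : autQ, (forall x, x \in s -> g x = f x) -> U g.
Proof.
pose D (s : seq rat) := [set g : autQ | forall x, x \in s -> g x = f x].
pose FF := filter_from [set: seq rat] D.
have FFf : Filter FF.
  apply: filter_from_filter; first by exists [::].
  move=> s t _ _; exists (s ++ t) => // g Dg.
  by split=> x xs; apply: Dg; rewrite mem_cat xs ?orbT.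
have cv : autQ_ptws @ FF --> autQ_ptws f.
  apply/cvg_sup => t A /= [_ [[B oB <-] /= Bx] sub].
  exists [:: t] => // g /= Dg; apply: sub => /=.
  by rewrite /autQ_ptws Dg ?mem_head.
move=> [_ [[B oB <-] Bf sub]].
have /cv [s _ Ds] : nbhs (autQ_ptws f) B by rewrite nbhsE; exists B.
by exists s => g gs; apply: sub; apply: Ds.
Qed.

Lemma open_eval x y : open [set f : autQ | f x = y].
Proof.
rewrite openE => f /= <-; exact: autQ_nbhs_eval.
Qed.

Lemma borel_eval x y : borel_set [set f : autQ | f x = y].
Proof. by apply: sub_sigma_algebra; exact: open_eval. Qed.

(** An open set is the union of the cylinders it contains, and there are countably many
    cylinders. *)
Lemma autQ_measurable d (T : measurableType d) (F : T -> autQ) :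
  (forall x y, measurable [set t | F t x = y]) ->
  measurable_fun setT (F : T -> borelType autQ).
Proof.
move=> mF; apply: (@measurability _ _ T (borelType autQ) setT F (@open autQ)) => //.
move=> _ [U oU <-].
rewrite setTI.
have -> : F @^-1` U = \bigcup_(s in [set s : seq (rat * rat) | cylinder s `<=` U])
    [set t | cylinder s (F t)].
  apply/seteqP; split=> [t /= UFt|t [s sU /sU]//].
  have [s sU] := autQ_nbhs_cylinder (open_nbhs_nbhs (conj oU UFt)).
  exists [seq (x, F t x) | x <- s] => /=.
    move=> g gs; apply: sU => x xs.
    by apply: (gs (x, F t x)); apply/mapP; exists x.
  by move=> p /mapP[x xs ->].
apply: count_bigcup_measurable => s _; elim: s => [|[x y] s IH].
  by rewrite (_ : [set _ | _] = setT) //; apply/seteqP; split=> // t _ p.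
rewrite (_ : [set _ | _] = [set t | F t x = y] `&` [set t | cylinder s (F t)]).
  exact: measurableI.
apply/seteqP; split=> t /=.
  move=> h; split; first by apply: (h (x, y)); rewrite mem_head.
  by move=> p ps; apply: h; rewrite inE ps orbT.
by move=> [h1 h2] p; rewrite inE => /orP[/eqP->//|/h2].
Qed.

Lemma borel_translate (g h : autQ) (B : set autQ) : borel_set B ->
  borel_set [set (g * x * h)%g | x in B].
Proof.
move=> mB.
have -> : [set (g * x * h)%g | x in B] = (fun x => g^-1 * x * h^-1)%g @^-1` B.
  apply/seteqP; split=> [_ [x Bx <-]|x Bx] /=.
    by rewrite !mulgA mulVg mul1g mulgK.
  by exists (g^-1 * x * h^-1)%g => //; rewrite !mulgA mulgV mul1g mulgVK.
have := @autQ_measurable _ (borelType autQ) (fun x => g^-1 * x * h^-1)%g.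
move=> /(_ _ measurableT B mB); rewrite setTI; apply=> x y.
have -> : [set t : borelType autQ | (g^-1 * t * h^-1)%g x = y] =
    [set t : autQ | t (h^-1%g x) = g y].
  by apply/seteqP; split=> t /=; [move=> <-; rewrite autQ_invVK|move=> ->; rewrite autQ_invK].
exact: borel_eval.
Qed.

(** * Conjugacy classes that are not Haar null *)

Section Tightness.
Context d (T : measurableType d) (R : realType) (mu : probability T R).
Local Open Scope ereal_scope.

Lemma positive_fibre (A : set T) (psi : T -> nat) : measurable A ->
  (forall v, measurable [set t | psi t = v]) -> 0 < mu A ->
  exists v, 0 < mu (A `&` [set t | psi t = v]).
Proof.
move=> mA mpsi A0; apply/not_existsP => H.
suff : mu.-negligible A.
  by move=> /(measure_negligible mA) e; move: A0; rewrite e ltxx.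
have -> : A = \bigcup_v (A `&` [set t | psi t = v]).
  by apply/seteqP; split=> [t At|t [v _ []//]]; exists (psi t).
apply: negligible_bigcup => v.
have mAv : measurable (A `&` [set t | psi t = v]) by exact: measurableI.
apply/negligibleP => //; apply/eqP; rewrite eq_le measure_ge0 andbT leNgt.
exact/negP/H.
Qed.

(** The bound for index [j] is chosen to lose less than [e / 2 ^ j.+1], so that altogether at most
    [e], half of the mass of [A], is lost. *)
Lemma positive_bounded (A : set T) (psi : nat -> T -> nat) : measurable A ->
  (forall j n, measurable [set t | (psi j t <= n)%N]) -> 0 < mu A ->
  exists N : nat -> nat,
    0 < mu (A `&` \bigcap_j [set t | (psi j t <= N j)%N]).
Proof.
move=> mA mpsi A0.
have Afin : mu A \is a fin_num by exact: fin_num_measure.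
pose e : R := (fine (mu A) / 2)%R.
have e0 : (0 < e)%R.
  by rewrite divr_gt0 // fine_gt0 // A0 ltey_eq Afin.
have eA : e%:E < mu A.
  by rewrite -[ltRHS]fineK // lte_fin /e ltr_pdivrMr // ltr_pMr ?fine_gt0 ?ltr1n ?A0 ?ltey_eq ?Afin.
pose E j n := A `\` [set t | (psi j t <= n)%N].
have mE j n : measurable (E j n) by exact: measurableD.
have small j : exists n, mu (E j n) < (e / (2 ^ j.+1)%:R)%:E.
  have cv : mu \o E j @ \oo --> mu (\bigcap_n E j n).
    apply: nonincreasing_cvg_mu => //.
    - by rewrite ltey_eq fin_num_measure.
    - exact: bigcapT_measurable.
    - move=> n m nm; apply/subsetPset => t [At /= h]; split=> // h'.
      by apply: h; apply: leq_trans nm.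
  have E0 : \bigcap_n E j n = set0.
    by apply/seteqP; split=> // t /(_ (psi j t) I)[_ /=]; rewrite leqnn.
  rewrite E0 measure0 in cv.
  have ep : (0 < e / (2 ^ j.+1)%:R)%R by rewrite divr_gt0 // ltr0n expn_gt0.
  have := cv [set x | x < (e / (2 ^ j.+1)%:R)%:E].
  case; first by apply: open_nbhs_nbhs; split; [exact: open_ereal_lt_ereal|rewrite /= lte_fin].
  by move=> n _ /(_ n (leqnn n)) /= h; exists n.
pose N j := sval (cid (small j)).
have NP j : mu (E j (N j)) < (e / (2 ^ j.+1)%:R)%:E by rewrite /N; case: cid.
exists N; set K := \bigcap_j _.
have mK : measurable K by apply: bigcapT_measurable.
have DE : A `\` K `<=` \bigcup_j E j (N j).
  move=> t [At /existsNP[j /not_implyP[_ h]]]; exists j => //.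
have le1 : mu (A `\` K) <= e%:E.
  have sub : mu (A `\` K) <= \sum_(j <oo) mu (E j (N j)).
    by apply: measure_sigma_subadditive => //; exact: measurableD.
  apply: (le_trans sub); apply: le_trans (epsilon_trick0 xpredT (ltW e0)).
  by apply: lee_nneseries => // j _; apply: ltW.
have AE : mu A = mu (A `\` K) + mu (A `&` K) by exact: measureDI.
rewrite lt_neqAle measure_ge0 andbT; apply/negP => /eqP z.
by move: eA; rewrite AE -z adde0 ltNge le1.
Qed.
End Tightness.

Lemma pickle_bounded (T : countType) n :
  exists s : seq T, forall y : T, (pickle y <= n)%N -> y \in s.
Proof.
exists (pmap unpickle (iota 0 n.+1)) => y yn.
rewrite mem_pmap; apply/mapP; exists (pickle y); last by rewrite pickleK.
by rewrite mem_iota.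
Qed.

Theorem nonnull_class (R : realType) (f : autQ) (zs : seq rat) :
  ~ touching f -> ~ touching f^-1%g -> (forall x, f x = x <-> x \in zs) ->
  ~ haar_null R (conjugacy_class f).
Proof.
move=> nt ntV zsE [B [mB [mu muB]] CB].
(* The evaluation at a fixed point takes countably many values, so one fibre has positive measure;
   finitely many such splittings are needed. *)
have [A [mA A0 Azs]] : exists A : set (borelType autQ), [/\ measurable A,
    (0 < mu A)%E & forall z, z \in zs -> forall h h', A h -> A h' -> h z = h' z].
  elim: (zs) => [|z s [A [mA A0 As]]].
    by exists setT; split=> //; rewrite probability_setT.
  have [||v Av] := @positive_fibre _ _ _ mu A (fun h : autQ => pickle (h z)) mA.
  - move=> v; have -> : [set t : borelType autQ | pickle ((t : autQ) z) = v] =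
        \bigcup_(y in [set y : rat | pickle y = v]) [set t : autQ | t z = y].
      by apply/seteqP; split=> [t /= <-|t [y /= <- <-]]; [exists (t z)|].
    by apply: count_bigcup_measurable => y _; exact: borel_eval.
  - by [].
  exists (A `&` [set h : autQ | pickle (h z) = v]); split=> //.
    apply: measurableI => //.
    have -> : [set t : borelType autQ | pickle ((t : autQ) z) = v] =
        \bigcup_(y in [set y : rat | pickle y = v]) [set t : autQ | t z = y].
      by apply/seteqP; split=> [t /= <-|t [y /= <- <-]]; [exists (t z)|].
    by apply: count_bigcup_measurable => y _; exact: borel_eval.
  move=> w; rewrite inE => /orP[/eqP->|ws] h h' [Ah /= hv] [Ah' /= hv'].
    by apply: (pcan_inj pickleK); rewrite hv hv'.
  exact: As Ah Ah'.
(* One sequence lists the evaluations of [h] and of its inverse; numbers that code nothing are sent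
   to evaluation at 0. *)
pose ev (j : nat) (h : autQ) : rat :=
  if unpickle j is Some (x, b) then
    (if b : bool then h x else h^-1%g x) else h 0.
have mev j n : measurable [set h : borelType autQ | (pickle (ev j h) <= n)%N].
  have -> : [set h : borelType autQ | (pickle (ev j h) <= n)%N] =
     \bigcup_(y in [set y : rat | (pickle y <= n)%N]) [set h : autQ | ev j h = y].
    apply/seteqP; split=> [t /= h|t [y /= h e]]; first by exists (ev j t).
    by rewrite /= e.
  apply: count_bigcup_measurable => y _; rewrite /ev.
  case: (unpickle j) => [[x []]|].
  - exact: borel_eval.
  - have -> : [set h : autQ | h^-1%g x = y] = [set h : autQ | h y = x].
      apply/seteqP; split=> h /= <-; first by rewrite autQ_invVK.
      by rewrite autQ_invK.
    exact: borel_eval.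
  - exact: borel_eval.
have [N K0] := positive_bounded mA mev A0.
set K := _ `&` _ in K0.
have mK : measurable K by apply: measurableI => //; apply: bigcapT_measurable.
have Kfin : pointwise_finite K.
  split=> x.
    have [s sN] := pickle_bounded rat (N (pickle (x, true))).
    exists s => h [_ /(_ (pickle (x, true)) I)] /=.
    by rewrite /ev pickleK => /sN.
  have [s sN] := pickle_bounded rat (N (pickle (x, false))).
  exists s => h [_ /(_ (pickle (x, false)) I)] /=.
  by rewrite /ev pickleK => /sN.
have [|g gK] := catch_conjugates nt ntV zsE Kfin.
  by move=> z zz h h' [Ah _] [Ah' _]; exact: Azs.
(* One left translate of [B] covers [K], so it has positive measure. *)
have KB : K `<=` [set (g * x * 1)%g | x in B].
  move=> h Kh; exists (g^-1 * h)%g; first by apply: CB; exact: gK.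
  by rewrite mulg1 mulgA mulgV mul1g.
have := muB g 1%g; move=> z; move: K0; rewrite ltNge => /negP; apply.
rewrite -z; apply: le_measure => //; rewrite inE //.
exact: borel_translate.
Qed.

(** * Shifts of the lexicographic order *)

Fixpoint lexlt (s t : seq int) : bool :=
  match s, t with
  | _, [::] => false
  | [::], _ :: _ => true
  | a :: s', b :: t' => (a < b) || (a == b) && lexlt s' t'
  end.

Lemma lexlt_irr : irreflexive lexlt.
Proof. by elim=> //= a s ->; rewrite ltxx andbF. Qed.

Lemma lexlt_trans : transitive lexlt.
Proof.
elim=> [|b t IH] [|a s] [|c u] //= /orP[h1|/andP[/eqP-> h1]].
  by move=> /orP[h2|/andP[/eqP<- _]]; rewrite ?h1 // (lt_trans h1).
by move=> /orP[->//|/andP[/eqP-> h2]]; rewrite eqxx (IH _ _ h1 h2) orbT.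
Qed.

Lemma lexlt_total s t : s != t -> lexlt s t || lexlt t s.
Proof.
elim: s t => [|a s IH] [|b t] //=; rewrite eqseq_cons negb_and.
by case: (ltgtP a b) => //= _; apply: IH.
Qed.

Lemma lexlt_dense s t : lexlt s t -> exists u, [/\ u != [::], lexlt s u & lexlt u t].
Proof.
have pre u : lexlt u (u ++ [:: 0]) by elim: u => //= a u ->; rewrite eqxx orbT.
elim: s t => [|a s IH] [|b t] //=.
  by move=> _; exists [:: b - 1] => /=; split=> //; rewrite gtrDl ltrN10.
move=> /orP[ab|/andP[/eqP-> /IH[u [u0 su ut]]]].
  by exists (a :: s ++ [:: 0]); rewrite /= ab eqxx pre orbT.
by exists (b :: u); rewrite /= eqxx su ut !orbT.
Qed.

Lemma lexlt_cat2l t u v : lexlt (t ++ u) (t ++ v) = lexlt u v.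
Proof. by elim: t => //= a t ->; rewrite ltxx eqxx. Qed.

(** A sequence precedes its extensions, so the proper extensions of [rcons t a] are exactly what
    lies before the next sibling. *)
Lemma lexlt_between t a w : lexlt (rcons t a) w -> lexlt w (rcons t (a + 1)) ->
  exists b w', w = rcons t a ++ b :: w'.
Proof.
elim: t w => [|x t IH] [|c w] //=.
  move=> /orP[h1|/andP[/eqP-> h1]] /orP[h2|/andP[_]].
  - by exfalso; lia.
  - by case: w.
  - by case: w h1 => // b w' _; exists b, w'.
  - by case: w h1.
move=> /orP[h1|/andP[/eqP-> h1]] /orP[h2|/andP[/eqP h2 h2']].
- by have := lt_trans h1 h2; rewrite ltxx.
- by move: h1; rewrite h2 ltxx.
- by move: h2; rewrite ltxx.
- by have [b [w' ->]] := IH _ h1 h2'; exists b, w'.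
Qed.

Lemma int_jump (P : int -> Prop) a b : a <= b -> P a -> ~ P b ->
  exists c, P c /\ ~ P (c + 1).
Proof.
move=> ab Pa; have -> : b = a + `|b - a|%N by lia.
elim: `|b - a|%N => [|k IH]; first by rewrite addr0.
have [h|h] := pselect (P (a + k%:Z)); last by move=> _; apply: IH.
by move=> h'; exists (a + k%:Z); rewrite -addrA -PoszD addn1.
Qed.

Fixpoint shift (d : nat -> int) (s : seq int) : seq int :=
  if s is a :: s' then (a + d 0%N) :: shift (fun n => d n.+1) s' else [::].

Lemma shift_lt d s t : lexlt (shift d s) (shift d t) = lexlt s t.
Proof.
elim: s t d => [|a s IH] [|b t] d //=.
by rewrite ltrD2r (inj_eq (addIr _)) IH.
Qed.

Lemma shift_shift d e s : shift d (shift e s) = shift (fun n => e n + d n) s.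
Proof. by elim: s d e => //= a s IH d e; rewrite IH addrA. Qed.

Lemma shift0 d s : d =1 (fun=> 0) -> shift d s = s.
Proof.
by elim: s d => //= a s IH d d0; rewrite d0 addr0 IH // => n; rewrite d0.
Qed.

Lemma shift_nil d s : (shift d s == [::]) = (s == [::]).
Proof. by case: s. Qed.

Lemma shift_rcons d t a : (forall i, (i < size t)%N -> d i = 0) ->
  shift d (rcons t a) = rcons t (a + d (size t)).
Proof.
elim: t d => [|x t IH] d d0 //=; rewrite d0 // addr0 IH // => i it.
exact: d0.
Qed.

Lemma shift_le d e n s : (forall i, (i < n)%N -> d i = e i) -> d n < e n ->
  shift d s = shift e s \/ lexlt (shift d s) (shift e s).
Proof.
elim: s d e n => [|a s IH] d e n H dn /=; first by left.
case: n H dn => [|n] H dn; first by right; rewrite ltrD2l dn.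
rewrite H //; have [||->|h] := IH (fun k => d k.+1) (fun k => e k.+1) n.
- by move=> i iln; apply: H.
- by [].
- by left.
- by right; rewrite ltxx eqxx.
Qed.

(* A cut of the nonempty integer sequences that is not realised by a sequence
   is approximated, at every length [n.+1], by two consecutive siblings. *)
Section Cut.
Variable V : seq int -> Prop.
Hypothesis down : forall s t, s != [::] -> lexlt s t -> V t -> V s.
Hypothesis nomax : forall s, V s -> exists2 t, lexlt s t & V t.
Hypothesis nomin : forall t, t != [::] -> ~ V t ->
  exists s, [/\ s != [::], lexlt s t & ~ V s].
Hypothesis nonempty : exists2 s, s != [::] & V s.
Hypothesis proper : exists2 s, s != [::] & ~ V s.

Let rcons0 (t : seq int) a : rcons t a != [::]. Proof. by case: t. Qed.

Let prefix s b u : V (s ++ b :: u) -> V (rcons s b).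
Proof.
move=> Vs; case: u Vs => [|c u] Vs; first by rewrite -cats1.
by apply: down Vs => //; rewrite -cats1 lexlt_cat2l /= eqxx orbT.
Qed.

(** The sibling [rcons s c] may itself be in [V], being a prefix of the given non-member; the first
    sibling surely outside has last entry [c + 1]. *)
Let jump s b c u v : V (s ++ b :: u) -> ~ V (s ++ c :: v) ->
  exists a, V (rcons s a) /\ ~ V (rcons s (a + 1)).
Proof.
move=> Vb Vc; have nVc : ~ V (rcons s (c + 1)).
  move=> h; apply: Vc; apply: down h; first by case: (s).
  by rewrite -cats1 lexlt_cat2l /= ltrDl.
have Vb' := prefix Vb.
apply: (@int_jump (fun x => V (rcons s x)) b (c + 1)) => //.
rewrite leNgt; apply/negP => cb; apply: nVc; apply: down Vb' => //.
by rewrite -!cats1 lexlt_cat2l /= cb.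
Qed.

(** As the cut is not realised, there are members and non-members strictly between the two siblings.
    Both extend the lower one, so the cut can be located one level deeper. *)
Lemma cut_siblings n :
  exists t a, [/\ size t = n, V (rcons t a) & ~ V (rcons t (a + 1))].
Proof.
elim: n => [|n [t [a [tn Va Va1]]]].
  have [[//|b u] _ Vb] := nonempty; have [[//|c v] _ Vc] := proper.
  by have [a [h1 h2]] := @jump [::] b c u v Vb Vc; exists [::], a.
have [w tw Vw] := nomax Va.
have [|b [w' ew]] := lexlt_between tw (w := w).
  have /lexlt_total/orP[//|h] : w != rcons t (a + 1).
    by apply/eqP => e; move: Va1; rewrite -e.
  by case: Va1; apply: down h Vw.
have [v [v0 vt Vv]] := nomin (rcons0 _ _) Va1.
have [|c [v' ev]] := lexlt_between _ vt.
  have /lexlt_total/orP[//|h] : rcons t a != v.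
    by apply/eqP => e; move: Vv; rewrite -e.
  by case: Vv; apply: down h Va.
rewrite ew in Vw; rewrite ev in Vv.
have [a' [h1 h2]] := jump Vw Vv.
by exists (rcons t a), a'; rewrite size_rcons tn.
Qed.

(** The shift leaves the first [n] entries alone and lowers the next one by at least 1, so it
    carries the upper sibling at the cut to the lower one or below it. *)
Lemma cut_shift e n : (forall i, (i < n)%N -> e i = 0) -> e n < 0 ->
  (forall s, s != [::] -> V (shift e s) -> V s) -> False.
Proof.
move=> e0 en inv; have [t [a [tn Va Va1]]] := cut_siblings n.
apply: Va1; apply: inv => //; rewrite shift_rcons tn //.
have : a + 1 + e n <= a by lia.
rewrite le_eqVlt => /orP[/eqP->//|h]; apply: down Va => //.
by rewrite -!cats1 lexlt_cat2l /= h.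
Qed.
End Cut.

(** * The rationals as nonempty integer sequences *)

Definition lex := {s : seq int | s != [::]}.

Definition ltlex (x y : lex) := lexlt (val x) (val y).

Lemma dlo_lex : dlo ltlex.
Proof.
split.
- by move=> x; exact: lexlt_irr.
- by move=> y x z; exact: lexlt_trans.
- by move=> x y xy; apply: lexlt_total; rewrite (inj_eq val_inj).
- by move=> x y /lexlt_dense[u [u0 h1 h2]]; exists (exist _ u u0).
- case=> -[//|a s] h; split.
    exists (exist _ [:: a - 1] isT); rewrite /ltlex /= gtrDl ltrN10 //.
  by exists (exist _ [:: a + 1] isT); rewrite /ltlex /= ltrDl.
Qed.

Lemma dlo_rat : dlo (<%R : rel rat).
Proof.
split.
- by move=> x; rewrite ltxx.
- exact: lt_trans.
- by move=> x y; rewrite neq_lt.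
- by move=> x y xy; exists ((x + y) / 2); rewrite !midf_lt.
- by move=> x; split; [exists (x - 1)|exists (x + 1)];
    rewrite ?gtrDl ?ltrN10 ?ltrDl.
Qed.

(** Cantor's isomorphism theorem, obtained from the back-and-forth with the constant oracle; [be] is
    made total by a default at the empty sequence. *)
Lemma lex_coding : exists (al : rat -> seq int) (be : seq int -> rat),
  [/\ forall x, al x != [::], cancel al be, forall s, s != [::] -> al (be s) = s &
      forall x y, lexlt (al x) (al y) = (x < y)].
Proof.
pose pt : lex := exist _ [:: 0] isT.
pose r := limit_graph (X := rat) (Y := lex) 0 pt dlo_rat dlo_lex (fun=> 0%N).
have rord x s x' s' : r x s -> r x' s' -> (x < x') = ltlex s s'.
  exact: limit_graph_order.
have tot x : {s | r x s}.
  by apply: cid; have [s rs _] := limit_graph_dom 0 pt dlo_rat dlo_lex (fun=> 0%N) x; exists s.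
have sur s : {x | r x s} by apply: cid; exact: limit_graph_ran.
pose al x := sval (tot x); pose be s := sval (sur s).
have alP x : r x (al x) by exact: svalP (tot x).
have beP s : r (be s) s by exact: svalP (sur s).
have beal x : be (al x) = x.
  apply/eqP; rewrite eq_le !leNgt (rord _ _ _ _ (alP x) (beP (al x))).
  by rewrite (rord _ _ _ _ (beP (al x)) (alP x)) /ltlex lexlt_irr.
have albe s : al (be s) = s.
  apply/eqP; apply/negPn/negP => ne; have [_ _ + _ _] := dlo_lex.
  move=> /(_ _ _ ne); rewrite -(rord _ _ _ _ (alP (be s)) (beP s)).
  by rewrite -(rord _ _ _ _ (beP s) (alP (be s))) ltxx.
exists (fun x => val (al x)), (fun s => be (insubd pt s)); split.
- by move=> x; exact: (valP (al x)).
- by move=> x; rewrite valKd beal.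
- by move=> s s0; rewrite albe insubdK.
- by move=> x y; rewrite (rord _ _ _ _ (alP x) (alP y)).
Qed.

Lemma shift_autQ : exists (phi : (nat -> int) -> autQ) (al : rat -> seq int)
    (be : seq int -> rat),
  [/\ forall x, al x != [::], cancel al be, forall s, s != [::] -> al (be s) = s,
      forall x y, lexlt (al x) (al y) = (x < y) &
      forall d x, phi d x = be (shift d (al x))].
Proof.
have [al [be [al0 alK beK allt]]] := lex_coding.
have homo d : {homo (fun x => be (shift d (al x))) : x y / x < y}.
  move=> x y xy; rewrite -allt !beK ?shift_nil ?al0 //.
  by rewrite shift_lt allt.
have bij d : bijective (fun x => be (shift d (al x))).
  exists (fun x => be (shift (fun n => - d n) (al x))) => x.
    rewrite beK ?shift_nil ?al0 // shift_shift shift0 ?alK //.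
    by move=> n; rewrite addrN.
  rewrite beK ?shift_nil ?al0 // shift_shift shift0 ?alK //.
  by move=> n; rewrite addNr.
by exists (fun d => AutQ (homo d) (bij d)), al, be.
Qed.

(** * Cuts preserved by touching elements *)

Definition touching_at (p q : rat) (f : autQ) :=
  (forall r, p <= r <= q -> r < f r) /\ (forall n, (f ^+ n)%g p < q).

(** The cut lies above the [g]-orbit of [p], which is bounded by [q]. It is not realised because [g]
    preserves it and moves up the points from [p] to [q]. As [f <= g], [f] maps [S] into itself; as
    [f] moves up the same interval, it maps no point outside [S] into [S]. *)
Lemma touching_cut (p q : rat) (f g : autQ) : p < q ->
  touching_at p q f -> touching_at p q g -> (forall x, f x <= g x) ->
  exists S : rat -> Prop,
    [/\ forall x y, x < y -> S y -> S x, forall x, S x -> exists2 y, x < y & S y,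
        forall x, ~ S x -> exists2 y, y < x & ~ S y, S p /\ ~ S q &
        forall x, (S x <-> S (f x)) /\ (S x <-> S (g x))].
Proof.
move=> pq [fpos fp] [gpos gp] fg.
pose S x := exists n, x < (g ^+ n)%g p.
have pg : p < g p by apply: gpos; rewrite lexx ltW.
have gS n : g ((g ^+ n)%g p) = (g ^+ n.+1)%g p by rewrite expgS.
have ginc n : (g ^+ n)%g p < (g ^+ n.+1)%g p.
  by elim: n => [|n IH]; [rewrite expg0 expg1|rewrite -gS -[ltRHS]gS autQ_lt].
have down x y : x < y -> S y -> S x.
  by move=> xy [n yn]; exists n; apply: lt_trans yn.
have downle x y : x <= y -> S y -> S x.
  by rewrite le_eqVlt => /orP[/eqP->//|]; exact: down.
have Sg x : S x <-> S (g x).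
  split=> [[n xn]|[n gxn]]; first by exists n.+1; rewrite -gS autQ_lt.
  exists n; rewrite -(autQ_lt g); apply: (lt_trans gxn).
  by rewrite gS.
have nSq : ~ S q by move=> [n]; rewrite ltNge ltW.
have Sp : S p by exists 1%N; rewrite expg1.
have pnS x : ~ S x -> p < x.
  by move=> nS; rewrite ltNge; apply/negP => xp; apply: nS; apply: downle Sp.
exists S; split=> //.
- by move=> x [n xn]; exists ((g ^+ n)%g p) => //; exists n.+1.
- move=> x nSx; pose m := Num.min x q.
  have nSm : ~ S m by rewrite /m /Num.min; case: ifP.
  have mg : m < g m by apply: gpos; rewrite ltW ?pnS // /m ge_min lexx orbT.
  exists (g^-1%g m).
    by apply: (@lt_le_trans _ _ m); [rewrite autQ_lt_inv|rewrite /m ge_min lexx].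
  by move=> /Sg; rewrite autQ_invVK.
- move=> x; split; last exact: Sg.
  split=> [/Sg|Sfx]; first exact: downle.
  apply: contrapT => nSx; have px := pnS _ nSx.
  have [xq|qx] := leP x q.
    by apply: nSx; apply: down Sfx; apply: fpos; rewrite xq ltW.
  apply: nSq; apply: down Sfx; apply: (@lt_trans _ _ (f q)).
    by apply: fpos; rewrite lexx ltW.
  by rewrite autQ_lt.
Qed.

(* Two elements of the family that both touch would both fix the same
   unrealised cut, which no nontrivial shift does. *)
Lemma shift_touching (phi : (nat -> int) -> autQ) al be :
  [/\ forall x, al x != [::], cancel al be, forall s, s != [::] -> al (be s) = s,
      forall x y, lexlt (al x) (al y) = (x < y) &
      forall d x, phi d x = be (shift d (al x))] ->
  forall (u w : autQ) p q d e, p < q ->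
  touching_at p q (u * phi d * w)%g -> touching_at p q (u * phi e * w)%g ->
  d =1 e.
Proof.
move=> [al0 alK beK allt phiE] u w p q.
have belt s t : s != [::] -> t != [::] -> (be s < be t) = lexlt s t.
  by move=> s0 t0; rewrite -allt !beK.
have main d e n : (forall i, (i < n)%N -> d i = e i) -> d n < e n -> p < q ->
    touching_at p q (u * phi d * w)%g -> touching_at p q (u * phi e * w)%g -> False.
  move=> H dn pq td te.
  have le x : (u * phi d * w)%g x <= (u * phi e * w)%g x.
    rewrite !autQ_mulE autQ_le !phiE.
    have [->//|h] := shift_le (al (w x)) H dn.
    by rewrite ltW // belt // shift_nil.
  have [S [Sdown Smax Smin [Sp nSq] Sinv]] := touching_cut pq td te le.
  pose V s := s != [::] /\ S (u (be s)).
  have lt0 s t : lexlt s t -> t != [::] by case: t; case: s.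
  apply: (@cut_shift V _ _ _ _ _ (fun i => d i - e i) n).
  - move=> s t s0 st [t0 St]; split=> //.
    by apply: Sdown St; rewrite autQ_lt belt.
  - move=> s [s0 Ss]; have [y sy Sy] := Smax _ Ss.
    exists (al (u^-1%g y)); last by split; rewrite // alK autQ_invVK.
    by rewrite -belt // alK autQ_inv_lt.
  - move=> t t0 nVt; have [|y yt nSy] := Smin (u (be t)).
      by move=> h; apply: nVt.
    exists (al (u^-1%g y)); split=> //.
      by rewrite -belt // alK autQ_lt_inv.
    by move=> [_]; rewrite alK autQ_invVK.
  - by exists (al (u^-1%g p)) => //; split=> //; rewrite alK autQ_invVK.
  - by exists (al (u^-1%g q)) => // -[_]; rewrite alK autQ_invVK.
  - by move=> i /H ->; rewrite subrr.
  - by rewrite subr_lt0.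
  move=> s s0 [_ Vs]; split=> //.
  (* Both elements preserve the cut, so [phi d z] and [phi e z] lie on the same side of its pullback
     along [u]. With [z] the preimage of [be s] under [phi e], this is invariance under the shift by
     [d - e], negative at the first difference. *)
  pose z := be (shift (fun i => - e i) s).
  have alz : al z = shift (fun i => - e i) s by rewrite /z beK // shift_nil.
  have ez : phi e z = be s.
    by rewrite phiE alz shift_shift shift0 // => i; rewrite addNr.
  have dz : phi d z = be (shift (fun i => d i - e i) s).
    rewrite phiE alz shift_shift; congr (be (shift _ s)).
    by apply/funext => i; rewrite addrC.
  have [h1 h2] := Sinv (w^-1%g z).
  move: h1 h2; rewrite !autQ_mulE autQ_invVK ez dz => h1 h2.
  by apply/h2/h1.
move=> d e pq td te; apply: contrapT => ne.
have ex : exists n, d n != e n.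
  apply: contrapT => H; apply: ne => n; apply/eqP/negPn/negP => h.
  by apply: H; exists n.
have [n dn nmin] := ex_minnP ex.
have H i : (i < n)%N -> d i = e i.
  move=> il; apply/eqP/negPn/negP => h; have := nmin i h.
  by rewrite leqNgt il.
move: dn; rewrite neq_lt => /orP[h|h].
  exact: (main d e n).
by apply: (main e d n) => // i il; rewrite H.
Qed.

Lemma shift_inv (phi : (nat -> int) -> autQ) al be :
  [/\ forall x, al x != [::], cancel al be, forall s, s != [::] -> al (be s) = s,
      forall x y, lexlt (al x) (al y) = (x < y) &
      forall d x, phi d x = be (shift d (al x))] ->
  forall d, ((phi d)^-1)%g = phi (fun n => - d n).
Proof.
move=> [al0 alK beK _ phiE] d; apply/autQ_eq => x.
rewrite -{1}(_ : phi d (phi (fun n => - d n) x) = x) ?autQ_invK //.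
rewrite !phiE beK ?shift_nil // shift_shift shift0 ?alK // => n.
by rewrite addNr.
Qed.

(** * A random automorphism without many coincidences *)

Section Digits.
Variable R : realType.
Implicit Types t u : R.

(** For [t] from 0 up to 1 this number codes the first [m] binary digits. Truncation sends negative
    numbers to 0, whence the hypotheses [0 <= t] below. *)
Definition digits m t : nat := Num.truncn (2 ^+ m * t).

Lemma digits_itv m t : 0 <= t ->
  (digits m t)%:R <= 2 ^+ m * t < (digits m t).+1%:R.
Proof. by move=> t0; apply: truncn_itv; rewrite mulr_ge0 ?exprn_ge0. Qed.

Lemma digits_half m t : 0 <= t -> digits m t = (digits m.+1 t)./2.
Proof.
move=> t0; apply: truncn_def; have := digits_itv m.+1 t0.
set a := digits _ _; rewrite exprS -mulrA => /andP[h1 h2].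
have e := odd_double_half a.
have e1 : ((a./2).*2)%:R = 2 * (a./2)%:R :> R by rewrite -mul2n natrM.
have le1 : ((a./2).*2)%:R <= a%:R :> R by rewrite ler_nat -{2}e leq_addl.
have le2 : a.+1%:R <= ((a./2.+1).*2)%:R :> R.
  by rewrite ler_nat doubleS -{1}e; case: (odd a).
have e2 : ((a./2.+1).*2)%:R = 2 * (a./2.+1)%:R :> R by rewrite -mul2n natrM.
by rewrite e1 in le1; rewrite e2 in le2; apply/andP; split; lra.
Qed.

Lemma eq_digits m n t u : 0 <= t -> 0 <= u -> (m <= n)%N ->
  digits n t = digits n u -> digits m t = digits m u.
Proof.
move=> t0 u0 /subnKC <-; elim: (n - m)%N => [|k IH]; first by rewrite addn0.
by rewrite addnS => e; apply: IH; rewrite (digits_half _ t0) (digits_half _ u0) e.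
Qed.

Lemma digits_inj t u : 0 <= t -> 0 <= u -> (forall n, digits n t = digits n u) ->
  t = u.
Proof.
suff main v w : 0 <= v -> 0 <= w -> (forall n, digits n v = digits n w) -> v <= w.
  by move=> t0 u0 H; apply: le_anti; apply/andP; split; apply: main.
move=> v0 w0 H; rewrite leNgt; apply/negP => wv.
pose n := Num.truncn (v - w)^-1.
have vw : 0 < v - w by rewrite subr_gt0.
have n1 : (v - w)^-1 < n.+1%:R by apply: truncnS_gt.
have n2 : n.+1%:R <= 2 ^+ n.+1 :> R by rewrite -natrX ler_nat ltnW // ltn_expl.
have n3 : 1 < 2 ^+ n.+1 * (v - w).
  by rewrite -ltr_pdivrMr // mul1r (lt_le_trans n1).
have /andP[h1 h2] := digits_itv n.+1 v0; have /andP[h3 h4] := digits_itv n.+1 w0.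
move: h2 n3; rewrite H mulrBr -natr1 => h2 n3; lra.
Qed.

Lemma measurable_digits m n : measurable [set t | digits m t = n].
Proof.
have le k : measurable [set t | (digits m t <= k)%N].
  rewrite (_ : [set t | _] = [set` `]-oo, (k.+1%:R / 2 ^+ m)[%R]); first by [].
  apply/seteqP; split=> t /=; rewrite in_itv /= /digits truncn_le_nat.
    by rewrite ltr_pdivlMr ?exprn_gt0 // mulrC.
  by rewrite ltr_pdivlMr ?exprn_gt0 // mulrC.
case: n => [|n].
  rewrite (_ : [set t | _] = [set t | (digits m t <= 0)%N]) //.
  by apply/seteqP; split=> t /=; rewrite leqn0 => /eqP.
rewrite (_ : [set t | _] = [set t | (digits m t <= n.+1)%N] `\`
  [set t | (digits m t <= n)%N]); first exact: measurableD.
apply/seteqP; split=> t /= => [->|[h1 /negP h2]]; first by rewrite leqnn ltnn.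
by apply/eqP; rewrite eqn_leq h1 ltnNge.
Qed.

Definition U01 : probability _ R := uniform_prob (@ltr01 R).

Lemma U01E A : measurable A -> U01 A = lebesgue_measure (A `&` `[0, 1]).
Proof.
move=> mA; transitivity (\int[lebesgue_measure]_(x in A)
  (@uniform_pdf R 0 1 x)%:E)%E; first by [].
rewrite integral_uniform_pdf.
rewrite (eq_integral (fun=> 1%:E)); last first.
  move=> x; rewrite inE /= => -[_]; rewrite in_itv /= /uniform_pdf => ->.
  by rewrite subr0 invr1.
by rewrite integral_cst /= ?mul1e //; exact: measurableI.
Qed.

Lemma U01_set1 t : U01 [set t] = 0%E.
Proof.
rewrite U01E //; apply/eqP; rewrite eq_le measure_ge0 andbT.
rewrite -(lebesgue_measure_set1 t); apply: le_measure; rewrite ?inE //.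
exact: measurableI.
Qed.

Let negE : [set t : R | t < 0] = [set` `]-oo, 0[%R].
Proof. by apply/seteqP; split=> t /=; rewrite in_itv. Qed.

Lemma measurable_neg : measurable [set t : R | t < 0].
Proof. by rewrite negE. Qed.

Lemma U01_neg : U01 [set t | t < 0] = 0%E.
Proof.
rewrite negE U01E // (_ : _ `&` _ = set0) ?measure0 //.
apply/seteqP; split=> t //= []; rewrite !in_itv /= => h /andP[h' _].
by move: h; rewrite ltNge h'.
Qed.

Lemma U01_digits m n : (U01 [set t | digits m t = n] <= ((2 ^+ m)^-1)%:E)%E.
Proof.
have mD := measurable_digits m n; rewrite U01E //.
pose J : interval R := `[n%:R / 2 ^+ m, n.+1%:R / 2 ^+ m[%R.
have p2 : 0 < 2 ^+ m :> R by rewrite exprn_gt0.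
apply: (@le_trans _ _ (lebesgue_measure [set` J])).
  apply: le_measure; rewrite ?inE //; first exact: measurableI.
  move=> t [/= e]; rewrite /J !in_itv /= => /andP[t0 _].
  by rewrite ler_pdivrMr // ltr_pdivlMr // mulrC -e digits_itv.
rewrite lebesgue_measure_itv /= lte_fin ltr_pM2r ?invr_gt0 // ltr_nat ltnSn.
by rewrite -EFinB lee_fin -mulrBl -natr1 addrAC subrr add0r mul1r.
Qed.

End Digits.

(** A condition on the first [K] terms of a sequence of naturals is a countable union over the
    finite lists of their values. *)
Lemma measurable_prefix d (T : measurableType d) (c : T -> nat -> nat)
    (Q : (nat -> nat) -> Prop) K :
  (forall i n, measurable [set t | c t i = n]) ->
  (forall a b, (forall i, (i < K)%N -> a i = b i) -> Q a -> Q b) ->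
  measurable [set t | Q (c t)].
Proof.
move=> mc HQ.
have -> : [set t | Q (c t)] =
    \bigcup_(l in [set l : seq nat | Q (nth 0%N l)])
      \bigcap_(i in [set i : nat | (i < K)%N]) [set t | c t i = nth 0%N l i].
  apply/seteqP; split=> [t /= Qt|t [l /= Ql H]].
    exists (mkseq (c t) K) => [|i /= iK]; last by rewrite nth_mkseq.
    by apply: HQ Qt => i iK; rewrite nth_mkseq.
  by apply: HQ Ql => i iK; rewrite (H i iK).
apply: count_bigcup_measurable => l _.
by apply: count_bigcap_measurable => i _; exact: mc.
Qed.

(** * The random back-and-forth and its coincidences *)

Section RandomBackAndForth.
Variable R : realType.
Local Notation stage := (stage (0 : rat) (0 : rat) dlo_rat dlo_rat).
Local Notation new_pair := (new_pair (0 : rat) (0 : rat) dlo_rat dlo_rat).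
Local Notation limit_graph := (limit_graph (0 : rat) (0 : rat) dlo_rat dlo_rat).

(* The exponents grow quadratically, so that stage [k] chooses among
   [2 ^ k.+1] values even when all previous choices are known. *)
Definition oracle (t : R) k := digits 'C(k.+2, 2) t.

Lemma random_autQ_ex (t : R) :
  exists k : autQ, forall x y, limit_graph (oracle t) x y <-> y = k x.
Proof.
apply: autQ_of_graph.
- by move=> x; have [y h _] := limit_graph_dom 0 0 dlo_rat dlo_rat (oracle t) x; exists y.
- exact: limit_graph_ran.
- by move=> x y x' y'; exact: limit_graph_order.
Qed.

Definition random_autQ (t : R) : autQ := sval (cid (random_autQ_ex t)).

Lemma random_autQP t x y : limit_graph (oracle t) x y <-> y = random_autQ t x.
Proof. by rewrite /random_autQ; case: cid. Qed.

Lemma measurable_oracle i n : measurable [set t : R | oracle t i = n].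
Proof. exact: measurable_digits. Qed.

Lemma measurable_random_autQ x y : measurable [set t : R | random_autQ t x = y].
Proof.
have -> : [set t : R | random_autQ t x = y] =
    [set t : R | (x, y) \in stage (oracle t) (pickle x).*2.+1].
  apply/seteqP; split=> t /=.
    move=> e; have [y' /random_autQP y'E] :=
      limit_graph_dom 0 0 dlo_rat dlo_rat (oracle t) x.
    by rewrite y'E e.
  by move=> h; apply/esym/random_autQP; exists (pickle x).*2.+1.
apply: (@measurable_prefix _ _ oracle
  (fun c => (x, y) \in stage c (pickle x).*2.+1) (pickle x).*2.+1).
  exact: measurable_oracle.
by move=> a b ab; rewrite (eq_stage 0 0 dlo_rat dlo_rat ab).
Qed.

Definition hit (u : autQ) k : set R := [set t | exists x,
  new_pair (stage (oracle t) k) k (oracle t k) = Some (x, u x)].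

Lemma measurable_hit u k : measurable (hit u k).
Proof.
apply: (@measurable_prefix _ _ oracle (fun c => exists x,
  new_pair (stage c k) k (c k) = Some (x, u x)) k.+1).
  exact: measurable_oracle.
move=> a b ab; rewrite ab // (eq_stage 0 0 dlo_rat dlo_rat (c' := b)) //.
by move=> i ik; apply: ab; apply: ltnW.
Qed.

(** Given the digits read so far, the stage is determined and at most one oracle value produces a
    pair on the graph of [u]. It remains to add up the measures of these values over all
    prefixes. *)
Lemma U01_hit u k : (U01 R (hit u k) <= (2 / (2 ^ k.+1)%:R)%:E)%E.
Proof.
have mH := measurable_hit u k.
(* The stages before [k] read at most [S k] digits, and stage [k] reads [S k.+1], that is [k.+1]
   more. *)
pose S j := 'C(j.+1, 2).
pose good d (t : R) := [/\ 0 <= t, digits (S k) t = d & hit u k t].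
(* The only oracle value that can give a hit after the prefix [d], read off from an arbitrary
   witness; 0 if there is none. *)
pose n d := if pselect (exists t, good d t) is left ex
            then oracle (sval (cid ex)) k else 0%N.
pose B d : set R := [set t | digits (S k.+1) t = n d].
have mB d : measurable (B d) by exact: measurable_digits.
(* The endpoint [t = 1] accounts for one prefix beyond [2 ^ S k]; this is absorbed by the factor 2
   in the bound. *)
pose N := (2 ^ S k).+1.
have sub : hit u k `&` `[0, 1] `<=` \big[setU/set0]_(d < N) B d.
  move=> t [Ht]; rewrite /= in_itv /= => /andP[t0 t1].
  have dN : (digits (S k) t < N)%N.
    rewrite ltnS -(ler_nat R); have /andP[h _] := digits_itv (S k) t0.
    by apply: (le_trans h); rewrite natrX ler_piMr.
  rewrite -(bigcup_mkord N B); exists (digits (S k) t) => //=.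
  rewrite /B /= /n; case: pselect => [ex|[]]; last by exists t.
  case: cid => t' [t'0 t'd [x' Hx']] /=; case: Ht => x Hx.
  have es : stage (oracle t) k = stage (oracle t') k.
    apply: eq_stage => i ik; apply: (@eq_digits _ _ (S k)) => //.
    by apply: leq_bin2l; rewrite ltnS.
  rewrite -es in Hx'; apply: (new_pair_inj _ _ Hx Hx').
    exact: (can_inj (autQ_invK u)).
  exact: stage_iso.
have mU : measurable (\big[setU/set0]_(d < N) B d) by apply: bigsetU_measurable.
apply: (@le_trans _ _ (U01 R (\big[setU/set0]_(d < N) B d))).
  rewrite [leLHS]U01E // [leRHS]U01E //; apply: le_measure; rewrite ?inE.
  - by apply: measurableI.
  - by apply: measurableI.
  - by move=> t Ht; split; [apply: sub|case: Ht].
apply: (le_trans (Boole_inequality _ _)); first by move=> i _; exact: mB.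
apply: (@le_trans _ _ (\sum_(d < N) ((2 ^+ S k.+1)^-1)%:E)%E).
  by apply: lee_sum => d _; exact: U01_digits.
rewrite sumEFin lee_fin sumr_const card_ord -[_ *+ N]mulr_natr.
have -> : S k.+1 = (S k + k.+1)%N by rewrite /S binS bin1 addnC.
rewrite exprD invfM natrX mulrAC ler_pM2r ?invr_gt0 ?exprn_gt0 //.
rewrite mulrC ler_pdivrMr ?exprn_gt0 // /N -natr1 natrX.
have : 1 <= 2 ^+ S k :> R by rewrite exprn_ege1 // ler1n.
lra.
Qed.

(** Borel-Cantelli: the bounds on the hits sum to at most 2. *)
Lemma random_autQ_coincide u :
  U01 R (lim_sup_set (hit u)) = 0%E.
Proof.
apply: lim_sup_set_cvg0 => [k|]; first exact: measurable_hit.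
apply: (@le_lt_trans _ _ 2%:E); last exact: ltry.
apply: le_trans (epsilon_trick0 xpredT (ler0n R 2)).
by apply: lee_nneseries => // k _; exact: U01_hit.
Qed.

(** A coincidence outside the domain of stage [n] can only have been created at stage [n] or
    later. *)
Lemma coincide_hit (u : autQ) t : (forall s : seq rat, exists2 x, x \notin s &
  random_autQ t x = u x) -> lim_sup_set (hit u) t.
Proof.
move=> H n _; have [x xs ux] := H (map fst (stage (oracle t) n)).
have /random_autQP[k kx] : u x = random_autQ t x by [].
have [j jk jx] := stage_new kx.
exists j; last by exists x.
rewrite /= leqNgt; apply/negP => jn.
move/negP: xs; apply; apply/mapP; exists (x, u x) => //.
by apply: (stage_mono jn); rewrite /= jx mem_head.
Qed.
End RandomBackAndForth.

(** * The exceptional set *)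

Definition touching_set : set autQ :=
  \bigcup_(pq in [set pq : rat * rat | pq.1 < pq.2])
    [set f | touching_at pq.1 pq.2 f].

Definition touching_inv_set : set autQ := [set f | touching_set f^-1%g].

(** Infinitude is expressed by a quantifier over the countably many finite lists, which makes the
    set visibly Borel. *)
Definition infinite_fix : set autQ :=
  [set f | forall s : seq rat, exists2 x, x \notin s & f x = x].

Lemma touchingP f : touching f -> touching_set f.
Proof. by move=> [p [q [pq h1 h2]]]; exists (p, q). Qed.

Lemma borel_evalP (Q : rat -> Prop) x : borel_set [set f : autQ | Q (f x)].
Proof.
have -> : [set f : autQ | Q (f x)] =
    \bigcup_(y in [set y | Q y]) [set f : autQ | f x = y].
  apply/seteqP; split=> [f Qf|f [y /= Qy e]]; first by exists (f x).
  by rewrite /= e.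
by apply: (@count_bigcup_measurable _ (borelType autQ)) => y _; exact: borel_eval.
Qed.

Lemma borel_expg n p y : borel_set [set f : autQ | (f ^+ n)%g p = y].
Proof.
elim: n y => [|n IH] y.
  have [->|/eqP py] := eqVneq p y.
    rewrite (_ : [set _ | _] = setT); first exact: (@measurableT _ (borelType autQ)).
    by apply/seteqP; split=> f //= _; rewrite expg0.
  rewrite (_ : [set _ | _] = set0); first exact: (@measurable0 _ (borelType autQ)).
  by apply/seteqP; split=> f //=; rewrite expg0.
have -> : [set f : autQ | (f ^+ n.+1)%g p = y] =
    \bigcup_(z in [set: rat]) ([set f : autQ | (f ^+ n)%g p = z] `&` [set f : autQ | f z = y]).
  apply/seteqP; split=> f /=; first by rewrite expgS => h; exists ((f ^+ n)%g p).
  by move=> [z _ [/= h1 h2]]; rewrite expgS autQ_mulE h1.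
apply: (@count_bigcup_measurable _ (borelType autQ)) => z _.
by apply: (@measurableI _ (borelType autQ)); [exact: IH|exact: borel_eval].
Qed.

Lemma borel_touching_set : borel_set touching_set.
Proof.
apply: (@count_bigcup_measurable _ (borelType autQ)) => -[p q] /= pq.
have -> : [set f : autQ | touching_at p q f] =
    (\bigcap_(r in [set r | p <= r <= q]) [set f : autQ | r < f r]) `&`
    (\bigcap_(n in [set: nat]) \bigcup_(y in [set y | y < q])
       [set f : autQ | (f ^+ n)%g p = y]).
  apply/seteqP; split=> f [h1 h2].
    split; first by move=> r; exact: h1.
    by move=> n _; exists ((f ^+ n)%g p); first exact: h2.
  split; first by move=> r; exact: h1.
  by move=> n; have [y yq e] := h2 n I; rewrite e.
apply: (@measurableI _ (borelType autQ)).
  by apply: (@count_bigcap_measurable _ (borelType autQ)) => r _; exact: (borel_evalP (fun y => r < y)).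
apply: (@count_bigcap_measurable _ (borelType autQ)) => n _.
by apply: (@count_bigcup_measurable _ (borelType autQ)) => y _; exact: borel_expg.
Qed.

Lemma borel_touching_inv_set : borel_set touching_inv_set.
Proof.
have mV : measurable_fun setT
    ((fun f : autQ => f^-1%g) : borelType autQ -> borelType autQ).
  apply: autQ_measurable => x y.
  rewrite (_ : [set _ | _] = [set f : autQ | f y = x]); first exact: borel_eval.
  apply/seteqP; split=> f /= <-; first by rewrite autQ_invVK.
  by rewrite autQ_invK.
have := mV measurableT _ borel_touching_set; rewrite setTI; exact.
Qed.

Lemma borel_infinite_fix : borel_set infinite_fix.
Proof.
have -> : infinite_fix = \bigcap_(s in [set: seq rat])
    \bigcup_(x in [set x | x \notin s]) [set f : autQ | f x = x].
  apply/seteqP; split=> f H s => [_|]; first by have [x] := H s; exists x.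
  by have [x] := H s I; exists x.
apply: (@count_bigcap_measurable _ (borelType autQ)) => s _.
by apply: (@count_bigcup_measurable _ (borelType autQ)) => x _; exact: borel_eval.
Qed.

(** * Nullness of the exceptional set *)

Section Null.
Variable R : realType.
Local Notation T := (measurableTypeR R).
Local Notation P := (U01 R).

Lemma product_null_x (A : set (T * T)) : measurable A ->
  (forall a, P (xsection A a) = 0%E) -> (P \x P)%E A = 0%E.
Proof. by move=> mA H; apply: integral0_eq => a _; exact: H. Qed.

Lemma product_null_y (A : set (T * T)) : measurable A ->
  (forall b, P (ysection A b) = 0%E) -> (P \x P)%E A = 0%E.
Proof.
move=> mA H; rewrite (@product_measure_unique _ _ _ _ _ P P (P \x^ P)%E) //.
  by apply: integral0_eq => a _; exact: H.
by move=> B C mB mC; exact: product_measure2E.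
Qed.

(** For each of the countably many pairs of rationals at most one nonnegative [a] is bad, since all
    its digits are determined; negative numbers have measure zero. [phi] is arbitrary so that the
    inverse shifts are covered as well. *)
Lemma null_touching (phi : (nat -> int) -> autQ) :
  (forall (u w : autQ) p q d e, p < q -> touching_at p q (u * phi d * w)%g ->
     touching_at p q (u * phi e * w)%g -> d =1 e) ->
  forall u w : autQ, P.-negligible
    [set a : R | touching_set (u * phi (fun n => (digits n a)%:Z) * w)%g].
Proof.
move=> uniq u w.
pose A (pq : rat * rat) : set T := [set a | pq.1 < pq.2 /\
  touching_at pq.1 pq.2 (u * phi (fun n => (digits n a)%:Z) * w)%g].
have sub : [set a : R | touching_set (u * phi (fun n => (digits n a)%:Z) * w)%g]
    `<=` \bigcup_n (if unpickle n is Some pq then A pq else set0).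
  by move=> a [pq pq12 h]; exists (pickle pq); [|rewrite pickleK; split].
apply: (@negligibleS _ _ _ P _ _ sub); apply: negligible_bigcup => n.
case: (unpickle n) => [pq|]; last exact: negligible_set0.
have [[a0 [a00 Aa0]]|none] := pselect (exists a, 0 <= a /\ A pq a).
  exists ([set a0] `|` [set a | a < 0]).
  have mneg : measurable [set a : T | a < 0] := @measurable_neg R.
  split; first exact: measurableU.
    apply/eqP; rewrite eq_le measure_ge0 andbT.
    have : (P ([set a0] `|` [set a | (a < 0)%R]) <=
        P [set a0] + P [set a | (a < 0)%R])%E by apply: measureU2.
    by rewrite U01_set1 U01_neg adde0.
  move=> a Aa; have [a0'|] := leP 0 a; last by right.
  left; apply: digits_inj => // k.
  have [pq12 h1] := Aa; have [_ h2] := Aa0.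
  by have /(_ k)[] := uniq _ _ _ _ _ _ pq12 h1 h2.
exists [set a | a < 0]; split; last 1 first.
- move=> a Aa; rewrite /= ltNge; apply/negP => a0; apply: none; by exists a.
- exact: measurable_neg.
- exact: U01_neg.
Qed.

(** A fixed point [x] of [u * random_autQ b * w] is a coincidence of [random_autQ b] with
    [u^-1 * w^-1] at [w x]. *)
Lemma null_infinite_fix (u w : autQ) : P.-negligible
  [set b : R | infinite_fix (u * random_autQ b * w)%g].
Proof.
pose v := (u^-1 * w^-1)%g.
have mH : measurable (lim_sup_set (hit (R := R) v)).
  apply: bigcapT_measurable => n; apply: bigcup_measurable => k _.
  exact: measurable_hit.
exists (lim_sup_set (hit v)); split=> //; first exact: random_autQ_coincide.
move=> b H; apply: coincide_hit => s.
have [x xs fx] := H [seq w^-1%g y | y <- s].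
exists (w x); last by rewrite /v autQ_mulE autQ_invK -{2}fx !autQ_mulE autQ_invK.
by apply: contra xs => xs; apply/mapP; exists (w x); rewrite // autQ_invK.
Qed.

Theorem haar_null_exceptional :
  borel_haar_null R (touching_set `|` touching_inv_set `|` infinite_fix).
Proof.
have mB1 := borel_touching_set; have mB2 := borel_touching_inv_set.
have mB3 := borel_infinite_fix.
split.
  by apply: (@measurableU _ (borelType autQ)) => //; apply: (@measurableU _ (borelType autQ)).
have [phi [al [be H]]] := shift_autQ.
have uniq := shift_touching H; have phiV := shift_inv H.
have phiE : forall d x, phi d x = be (shift d (al x)) by case: H.
pose F (ab : T * T) : autQ :=
  (phi (fun n => (digits n ab.1)%:Z) * random_autQ ab.2)%g.
have mphi x y : measurable [set a : R | phi (fun n => (digits n a)%:Z) x = y].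
  have -> : [set a : R | phi (fun n => (digits n a)%:Z) x = y] =
      [set a : R | be (shift (fun n => (digits n a)%:Z) (al x)) = y].
    by apply/seteqP; split=> a /=; rewrite phiE.
  apply: (@measurable_prefix _ _ (fun (a : R) n => digits n a)
    (fun c => be (shift (fun n => (c n)%:Z) (al x)) = y) (size (al x))).
    by move=> i n; exact: measurable_digits.
  move=> c c' cc' <-; congr be.
  elim: (al x) c c' cc' => //= k s IH c c' cc'; rewrite -cc' //; congr cons.
  by apply: (IH (fun n => c n.+1) (fun n => c' n.+1)) => i ik; apply: cc'.
have mF : measurable_fun setT (F : T * T -> borelType autQ).
  apply: autQ_measurable => x y.
  have -> : [set ab : T * T | F ab x = y] = \bigcup_(z in [set: rat])
      ([set a : T | phi (fun n => (digits n a)%:Z) z = y] `*`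
       [set b : T | random_autQ b x = z]).
    apply/seteqP; split=> [[a b] /= h|[a b] [z _ [/= h1 h2]]].
      by exists (random_autQ b x).
    by rewrite /F /= h2.
  apply: count_bigcup_measurable => z _; apply: measurableX; first exact: mphi.
  exact: measurable_random_autQ.
pose X : {mfun (T * T)%type >-> borelType autQ} := mfun_Sub (mem_set mF).
exists (distribution (P \x P)%E X) => g h.
pose tr (C : set autQ) : set (T * T) := [set ab | C (g^-1 * F ab * h^-1)%g].
have mtr C : borel_set C -> measurable (tr C).
  move=> mC.
  have -> : tr C = F @^-1` [set (g * x * h)%g | x in C].
    apply/seteqP; split=> [ab Cab|ab [x Cx /= e]].
      by exists (g^-1 * F ab * h^-1)%g => //; rewrite !mulgA mulgV mul1g mulgVK.
    by rewrite /tr /= -e !mulgA mulVg mul1g mulgK.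
  have := mF measurableT _ (borel_translate g h mC); rewrite setTI; exact.
have trE ab : (g^-1 * F ab * h^-1 = g^-1 * phi (fun n => (digits n ab.1)%:Z) *
    (random_autQ ab.2 * h^-1))%g by rewrite /F !mulgA.
have n1 : (P \x P)%E (tr touching_set) = 0%E.
  apply: product_null_y; first exact: mtr.
  move=> b; apply: measure_negligible; first exact: measurable_ysection (mtr _ mB1).
  have := null_touching uniq g^-1%g (random_autQ b * h^-1)%g.
  apply: negligibleS => a; rewrite /ysection /= inE /tr /=.
  by rewrite trE.
have n2 : (P \x P)%E (tr touching_inv_set) = 0%E.
  apply: product_null_y; first exact: mtr.
  move=> b; apply: measure_negligible; first exact: measurable_ysection (mtr _ mB2).
  (* Inverting the product turns [phi] into the shift by the opposite digits, for which uniqueness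
     holds as well. *)
  have uniqV (u w : autQ) p q (d e : nat -> int) : p < q ->
      touching_at p q (u * phi (fun n => - d n) * w)%g ->
      touching_at p q (u * phi (fun n => - e n) * w)%g -> d =1 e.
    by move=> pq h1 h2 n; apply: oppr_inj; exact: (uniq _ _ _ _ _ _ pq h1 h2 n).
  have := @null_touching (fun d => phi (fun n => - d n)) uniqV
    (h * (random_autQ b)^-1)%g g.
  apply: negligibleS => a; rewrite /ysection /= inE /tr /touching_inv_set /=.
  by rewrite /F /= !invgM !invgK phiV !mulgA.
have n3 : (P \x P)%E (tr infinite_fix) = 0%E.
  apply: product_null_x; first exact: mtr.
  move=> a; apply: measure_negligible; first exact: measurable_xsection (mtr _ mB3).
  have := null_infinite_fix (g^-1 * phi (fun n => (digits n a)%:Z))%g h^-1%g.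
  apply: negligibleS => b; rewrite /xsection /= inE /tr /F /=.
  by rewrite !mulgA.
pose E := tr touching_set `|` tr touching_inv_set `|` tr infinite_fix.
have sub : F @^-1` [set (g * x * h)%g | x in touching_set `|` touching_inv_set
    `|` infinite_fix] `<=` E.
  move=> ab [x Cx /= e]; rewrite /E /tr /=.
  have -> : (g^-1 * F ab * h^-1)%g = x by rewrite -e !mulgA mulVg mul1g mulgK.
  exact: Cx.
have mC : borel_set (touching_set `|` touching_inv_set `|` infinite_fix).
  apply: (@measurableU _ (borelType autQ)) => //.
  exact: (@measurableU _ (borelType autQ)).
have mpre := mF measurableT _ (borel_translate g h mC); rewrite setTI in mpre.
suff negE : (P \x P)%E.-negligible E.
  exact: (measure_negligible mpre (negligibleS sub negE)).
have ng C : borel_set C -> (P \x P)%E (tr C) = 0%E -> (P \x P)%E.-negligible (tr C).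
  by move=> mC' z; exists (tr C); split; [exact: mtr|exact: z|].
exact: negligibleU (negligibleU (ng _ mB1 n1) (ng _ mB2 n2)) (ng _ mB3 n3).
Qed.
End Null.

Theorem theorem3p5 (R : realType) :
  haar_null R
    (\bigcup_(C in [set C : set autQ |
                     (exists f : autQ, C = conjugacy_class f) /\
                     haar_null R C]) C).
Proof.
exists (touching_set `|` touching_inv_set `|` infinite_fix).
  exact: haar_null_exceptional.
move=> f' [_ [[f ->] nullC] [h _ <-]].
(* The given element of the union replaces [f] as representative of its class, so that it is the one
   tested for membership in the exceptional set. *)
have classE : conjugacy_class f = conjugacy_class (f ^ h)%g.
  apply/seteqP; split=> _ [k _ <-].
    by exists (h^-1 * k)%g => //; rewrite -conjgM mulgA mulgV mul1g.
  by exists (h * k)%g => //; rewrite conjgM.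
rewrite classE in nullC; move: (f ^ h)%g nullC => {classE}{}f nullC.
(* Outside the exceptional set the element meets the assumptions of [nonnull_class], against the
   nullness of its class; its fixed points are filtered out of a finite list containing them. *)
apply: contrapT => /not_orP[/not_orP[nt ntV] fin].
have [s sP] : exists s : seq rat, forall x, x \notin s -> f x <> x.
  have /existsNP[s H] := fin; exists s => x xs fx; apply: H.
  by exists x.
apply: (@nonnull_class R f [seq x <- s | f x == x]) nullC => [/touchingP|/touchingP|] //.
move=> x; rewrite mem_filter; split=> [fx|/andP[/eqP]//].
by rewrite fx eqxx /=; apply: contrapT => /negP /sP.
Qed.
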